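(* For any finite simplicial complex $X$ there is a bijection $$\pi_0(X_+)\;\cong\;\widetilde{\mathrm{MC}}(\mathcal{L}_X),$$ where $X_+=X\sqcup\{\ast\}$ is the disjoint union of $X$ with a point, $\mathcal{L}_X$ is the complete differential graded Lie algebra model of $X$, and $\widetilde{\mathrm{MC}}(\mathcal{L}_X)$ is the set of gauge orbits of Maurer-Cartan elements of $\mathcal{L}_X$.
   Context: All Lie algebras are over $\mathbb{Q}$. A differential graded Lie algebra (DGL) $(L,d)$ is $\mathbb{Z}$-graded, with differential $d$ a derivation of degree $-1$. It is complete (a cDGL) if $L=\varprojlim_n L/L^{[n]}$, where $L^{[1]}=L$ and $L^{[n+1]}=[L,L^{[n]}]$ for $n\ge 1$. For $V$ a finite-dimensional graded vector space, $\mathbb{L}(V)$ is the free graded Lie algebra on $V$ and $\widehat{\mathbb{L}}(V)=\varprojlim_n \mathbb{L}(V)/\mathbb{L}(V)^{[n]}$ its completion. Maurer-Cartan elements and gauge action. For a cDGL $(L,d)$, $\mathrm{MC}(L)$ is the set of $u\in L_{-1}$ with $du=-\frac12[u,u]$. The group $L_0$, with the Baker-Campbell-Hausdorff product, acts on $\mathrm{MC}(L)$ by $$x\,\mathcal{G}\,z=e^{\mathrm{ad}_x}(z)-\frac{e^{\mathrm{ad}_x}-1}{\mathrm{ad}_x}(dx),\qquad x\in L_0,\ z\in \mathrm{MC}(L),$$ and $\widetilde{\mathrm{MC}}(L)$ denotes the orbit set. The model $\mathcal{L}_X$. Let $C_*(\Delta^n)$ be the simplicial chain complex over $\mathbb{Q}$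 of the standard simplex $\Delta^n$, with basis the simplices $i_0<\dots<i_p$ of $\{0,\dots,n\}$ (in degree $p$) and boundary $\delta$. Let $s^{-1}C_*(\Delta^n)$ be its desuspension (so a $p$-simplex gives a generator of degree $p-1$). The family of cDGL's $\mathcal{L}_{\Delta^n}=(\widehat{\mathbb{L}}(s^{-1}C_*(\Delta^n)),d)$, $n\ge 0$, is characterized, up to isomorphism, by the following properties (known theorem): (i) they are natural with respect to the inclusions of the faces $\Delta^p\subset\Delta^n$, $p<n$ (the induced map of completed free Lie algebras $\mathcal{L}_{\Delta^p}\to\mathcal{L}_{\Delta^n}$ commutes with the differentials); (ii) $\mathcal{L}_{\Delta^0}=(\widehat{\mathbb{L}}(a),d)$ with $a$ a Maurer-Cartan element; (iii) the linear part $d_1$ of the differential of $\mathcal{L}_{\Delta^n}$ is the desuspension of $\delta$. For a finite simplicial complex $X$, regarded as a subcomplex of some $\Delta^n$, the sub Lie algebra $\widehat{\mathbb{L}}(s^{-1}C_*(X))$ of $\mathcal{L}_{\Delta^n}$ is preserved by $d$, and $\mathcal{L}_X$ is this cDGL. *)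

(* Defs.v *)
Set Warnings "-notation-overridden,-notation-incompatible-prefix,-ambiguous-paths".
From mathcomp Require Export all_boot all_order all_algebra.
From mathcomp Require Export boolp classical_sets functions reals topology normedtype.
Export numFieldNormedType.Exports.
Set Implicit Arguments.
Unset Strict Implicit.
Unset Printing Implicit Defensive.
Import Order.TTheory GRing.Theory Num.Theory.
Local Open Scope classical_set_scope.
Local Open Scope ring_scope.

(* A graded vector space is a family (L_k), k : int, of subspaces of an ambient
   space.  All elements considered are homogeneous; the ambient space is only a
   container and its non-homogeneous elements carry no meaning. *)
Record grLie := GrLie {
  gr_space :> lmodType rat;
  gr_hom : int -> set gr_space;
  gr_br : gr_space -> gr_space -> gr_space }.

Record dgLie := DgLie {
  dg_lie :> grLie;
  dg_d : dg_lie -> dg_lie }.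

Record is_grLie (L : grLie) : Prop := {
  grL_zero : forall k, gr_hom k (0 : L);
  grL_lin : forall k a (x y : L),
    gr_hom k x -> gr_hom k y -> gr_hom k (a *: x + y);
  grL_br : forall i j (x y : L),
    gr_hom i x -> gr_hom j y -> gr_hom (i + j) (gr_br x y);
  grL_br_linl : forall i j a (x x' y : L),
    gr_hom i x -> gr_hom i x' -> gr_hom j y ->
    gr_br (a *: x + x') y = a *: gr_br x y + gr_br x' y;
  grL_br_linr : forall i j a (x y y' : L),
    gr_hom i x -> gr_hom j y -> gr_hom j y' ->
    gr_br x (a *: y + y') = a *: gr_br x y + gr_br x y';
  grL_antisym : forall i j (x y : L),
    gr_hom i x -> gr_hom j y ->
    gr_br x y = - ((-1 : rat) ^ (i * j) *: gr_br y x);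
  grL_jacobi : forall i j k (x y z : L),
    gr_hom i x -> gr_hom j y -> gr_hom k z ->
    gr_br x (gr_br y z) =
      gr_br (gr_br x y) z + (-1 : rat) ^ (i * j) *: gr_br y (gr_br x z) }.

Record is_dgLie (L : dgLie) : Prop := {
  dgL_gr : is_grLie L;
  dgL_deg : forall k (x : L), gr_hom k x -> gr_hom (k - 1) (dg_d x);
  dgL_lin : forall k a (x y : L), gr_hom k x -> gr_hom k y ->
    dg_d (a *: x + y) = a *: dg_d x + dg_d y;
  dgL_der : forall i j (x y : L), gr_hom i x -> gr_hom j y ->
    dg_d (gr_br x y) =
      gr_br (dg_d x) y + (-1 : rat) ^ i *: gr_br x (dg_d y);
  dgL_sq0 : forall k (x : L), gr_hom k x -> dg_d (dg_d x) = 0 }.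

Inductive span (E : lmodType rat) (A : set E) : set E :=
| span_zero : span A 0
| span_lin a x y : A x -> span A y -> span A (a *: x + y).

(* lcs L n k is the degree k part of L^[n] for n >= 1; lcs L 0 is L too. *)
Fixpoint lcs (L : grLie) (n : nat) (k : int) : set L :=
  match n with
  | 0 | 1 => @gr_hom L k
  | m.+1 => span [set z : L | exists i j x y,
      [/\ i + j = k, gr_hom i x, lcs m j y & z = gr_br x y]]
  end.

(* The natural map L_k -> (lim_n L / L^[n])_k is injective and surjective; a
   point of the limit is given by representatives x_n with
   x_{n+1} = x_n modulo L^[n]. *)
Definition complete (L : grLie) : Prop := forall k : int,
  (forall x : L, gr_hom k x -> (forall n, lcs n k x) -> x = 0) /\
  (forall x : nat -> L,
     (forall n, gr_hom k (x n)) -> (forall n, lcs n k (x n.+1 - x n)) ->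
     exists y : L, gr_hom k y /\ forall n, lcs n k (y - x n)).

Definition is_cdgLie (L : dgLie) : Prop := is_dgLie L /\ complete L.

Definition MC (L : dgLie) : set L :=
  [set u | gr_hom (-1) u /\ dg_d u = - ((1 / 2 : rat) *: gr_br u u)].
Arguments MC L : clear implicits.

(* y is the sum of the series u in L_k, for the topology defined by the L^[n]. *)
Definition sums_to (L : grLie) (k : int) (u : nat -> L) (y : L) : Prop :=
  gr_hom k y /\
  forall n, exists N0, forall N, (N0 <= N)%N ->
    lcs n k (y - \sum_(0 <= i < N) u i).

(* gauge x z y means y = e^{ad_x}(z) - ((e^{ad_x} - 1) / ad_x)(dx). *)
Definition gauge (L : dgLie) (x z y : L) : Prop :=
  exists s t : L,
  [/\ sums_to (-1) (fun i => (i`!%:R^-1 : rat) *: iter i (gr_br x) z) s,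
      sums_to (-1) (fun i => (i.+1`!%:R^-1 : rat) *: iter i (gr_br x) (dg_d x)) t
    & y = s - t].

Definition gauge_orbit (L : dgLie) (z : L) : set L :=
  [set y | exists2 x : L, gr_hom 0 x & gauge x z y].

Definition MC_tilde (L : dgLie) : set (set L) :=
  [set O | exists2 z, MC L z & O = gauge_orbit z].
Arguments MC_tilde L : clear implicits.

(* Formal noncommutative power series in the letters B.  The tensor algebra on
   the span of B consists of the series with finitely many nonzero
   coefficients. *)
Definition series (B : finType) : lmodType rat := [the lmodType rat of (seq B -> rat^o)].

Definition gen (B : finType) (b : B) : series B :=
  fun w => (w == [:: b])%:R.

Definition wdeg (B : finType) (deg : B -> int) (w : seq B) : int :=
  \sum_(b <- w) deg b.

(* The graded commutator fg - (-1)^{|f||g|} gf of the concatenation product,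
   extended bilinearly to all series. *)
Definition ser_br (B : finType) (deg : B -> int) (f g : series B) : series B :=
  fun w => \sum_(i < (size w).+1)
    let u := take i w in let v := drop i w in
    (f u * g v - (-1 : rat) ^ (wdeg deg u * wdeg deg v) * (g u * f v)).

(* Degree k part of the free graded Lie algebra on the letters of S, defined as
   the sub Lie algebra of the tensor algebra generated by them (as in Felix,
   Halperin, Thomas, Rational Homotopy Theory, section 21). *)
Inductive free_hom (B : finType) (deg : B -> int) (S : {set B}) :
  int -> set (series B) :=
| free_gen b : b \in S -> free_hom deg S (deg b) (gen b)
| free_zero k : free_hom deg S k 0
| free_lin k a f g : free_hom deg S k f -> free_hom deg S k g ->
    free_hom deg S k (a *: f + g)
| free_br i j f g : free_hom deg S i f -> free_hom deg S j g ->
    free_hom deg S (i + j) (ser_br deg f g).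

Definition free_lie (B : finType) (deg : B -> int) (S : {set B}) : grLie :=
  GrLie (free_hom deg S) (ser_br deg).

(* Elements of L^[n] only involve words of length >= n, so a point
   (x_n mod L^[n])_n of lim_n L / L^[n] is the same as the series f which agrees
   with x_n on words of length < n. *)
Definition cfree_hom (B : finType) (deg : B -> int) (S : {set B}) (k : int) :
  set (series B) :=
  [set f | exists x : nat -> free_lie deg S,
    [/\ forall n, gr_hom k (x n),
        forall n, lcs n k (x n.+1 - x n)
      & forall n (w : seq B), (size w < n)%N -> f w = x n w]].

Definition cfree_lie (B : finType) (deg : B -> int) (S : {set B}) : grLie :=
  GrLie (cfree_hom deg S) (ser_br deg).

(* The map of completed tensor algebras induced by a map of letters. *)
Definition ser_map (B C : finType) (h : B -> C) (f : series B) : series C :=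
  fun w => \sum_(u : (size w).-tuple B | map h u == w) f u.

Definition simplicial_complex (T : finType) (X : {set {set T}}) : Prop :=
  finset.set0 \notin X /\
  forall s t : {set T}, s \in X -> t \subset s -> t != finset.set0 -> t \in X.

Definition full_simplex (n : nat) : {set {set 'I_n.+1}} :=
  [set s : {set 'I_n.+1} | s != finset.set0]%SET.

Definition complex_image (T U : finType) (e : T -> U) (X : {set {set T}}) :
  {set {set U}} := (fun s : {set T} => e @: s) @: X.

(* X with an isolated vertex None added. *)
Definition complex_plus (T : finType) (X : {set {set T}}) :
  {set {set option T}} :=
  (complex_image Some X :|: [set [set None]])%SET.

Definition realization (R : realType) (T : finType) (X : {set {set T}}) :
  set {ptws T -> R} :=
  [set x | [/\ forall v, 0 <= x v, \sum_v x v = 1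
             & [set v | x v != 0]%SET \in X]].
Arguments realization R {T} X.

Definition path_joined (R : realType) (M : topologicalType) (A : set M)
    (x y : M) : Prop :=
  exists p : R -> M,
  [/\ {within `[0, 1], continuous p}, forall t, 0 <= t <= 1 -> A (p t),
      p 0 = x & p 1 = y].

Definition pi0 (R : realType) (T : finType) (X : {set {set T}}) :
  set (set {ptws T -> R}) :=
  [set C | exists2 x, realization R X x
         & C = [set y | path_joined R (realization R X) x y]].
Arguments pi0 R {T} X.

(* A p-simplex s has p + 1 vertices and is a generator of degree p - 1. *)
Definition simplex_deg (n : nat) (s : {set 'I_n.+1}) : int := #|s|%:Z - 2.

(* The coefficient of t in the boundary of s = {i_0 < ... < i_p}, that is, in
   the sum of the (-1)^j s \ {i_j}. *)
Definition boundary_coef (n : nat) (s t : {set 'I_n.+1}) : rat :=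
  \sum_(v in s | t == s :\ v) (-1) ^+ #|[set u in s | (u < v)%N]%SET|.

(* The letters are all subsets of {0, ..., n}; only those in X generate. *)
Definition complex_model
    (d : forall n, series {set 'I_n.+1} -> series {set 'I_n.+1})
    (n : nat) (X : {set {set 'I_n.+1}}) : dgLie :=
  @DgLie (cfree_lie (@simplex_deg n) X) (d n).

Record simplex_models
    (d : forall n, series {set 'I_n.+1} -> series {set 'I_n.+1}) : Prop := {
  sm_cdgLie : forall n, is_cdgLie (complex_model d (full_simplex n));
  sm_natural : forall p n (h : 'I_p.+1 -> 'I_n.+1), (p < n)%N ->
    {homo h : i j / (i < j)%N} ->
    forall k (f : series {set 'I_p.+1}),
      @gr_hom (complex_model d (full_simplex p)) k f ->
      ser_map (fun s : {set 'I_p.+1} => h @: s) (d p f) =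
      d n (ser_map (fun s : {set 'I_p.+1} => h @: s) f);
  sm_point : MC (complex_model d (full_simplex 0)) (gen [set ord0]%SET);
  sm_linear : forall n (s t : {set 'I_n.+1}),
    s \in full_simplex n -> t \in full_simplex n ->
    d n (gen s) [:: t] = boundary_coef s t }.

(* Main.v *)
From HB Require Import structures.
Require Import Defs.
From mathcomp Require Import ring lra zify.
Set Implicit Arguments.
Unset Strict Implicit.
Unset Printing Implicit Defensive.
Import Order.TTheory GRing.Theory Num.Theory.
Local Open Scope classical_set_scope.
Local Open Scope ring_scope.

(** Both sides are sets of fibres of a map to the same set of labels: the
    components of X and one further label None. So it is enough to see that the
    two maps have these fibres and the same image (fibre_bij,
    component_label).

    On the topological side a point of the realization is labelled by the
    component, in the graph of edges, of a vertex of its carrier. The mass of a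
    component is continuous along a path and only takes the values 0 and 1, and
    segments inside simplices give all the paths needed (path_joinedE).

    On the algebraic side let d = d_1 + d_2 + ... be the decomposition of the
    differential by word length. The degree -1 letters are the vertices, and the
    linear part of a Maurer-Cartan element u has a total coefficient, the mass,
    on each component. These masses only depend on the class of the linear part
    in the homology of d_1. Since d_2 v = - v v for a vertex v, and since
    boundaries have augmentation 0, the quadratic part of the Maurer-Cartan
    equation says that the masses are orthogonal idempotents of the rational
    numbers (mass_idem). Hence either all masses are 0, and u has the label
    None, or exactly one is not 0, and is equal to 1 (labelP). The gauge action
    changes the linear part by a boundary, so the label is invariant, and 0 and
    the vertices realize all labels.

    Conversely let y and z be Maurer-Cartan elements with the same label. A first
    gauge transformation makes their linear parts equal (gauge_label). Then one
    corrects the transformation length by length (gact_step, gact_connect). The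
    effect of replacing x by x + q on the gauge action is computed from the power
    series (gact_variation), in place of the group law of the degree 0 elements.
    The obstruction in each length is a Lie element w of degree -1 and length > 1
    which is closed under d_1 and for which D w is a boundary under d_1, where
    D = d_2 + ad c and c is the linear part of y. One has to find Lie elements p
    and q with d_1 p = 0 and w = d_1 q + D p (exact_at, exactness).

    Up to a gauge transformation c is 0 or a vertex. In both cases D is contracted
    in the tensor algebra, by a skew derivation hop with values in the scalars on
    the letters: the contraction of d_2 s with the augmentation is - s. This holds
    for vertices, and it passes from a face of s to s because d_1 d_2 + d_2 d_1 = 0
    (phi_counit). For c = 0 this contracts everything (exact_zero); for a vertex a
    it contracts everything onto the letters of the component of a, with v - a in
    place of the vertices v, where degree -1 letters are boundaries (exact_vertex).
    The operator hop leaves the Lie elements, but the Dynkin operator with the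
    weights deg + 1 commutes with D and brings one back; on Lie elements it is the
    multiplication by the total weight (dyn_free), which is not zero for p. The
    operator d_1 is treated in the same way, with a homotopy to a projection onto
    its homology (homology_projection) and with the weights 1.

    The completed free Lie algebra is handled inside the noncommutative power
    series. The Dynkin operator also shows that the lower central series is the
    filtration by word length (cfree_lcs); so convergence can be read off from the
    words, and d is the derivation determined by its values on the letters
    (dg_der). Operators of this kind are skew derivations, and identities between
    them are checked on letters (intertwiner_eq, skew_anticomm). *)

(** * Noncommutative power series and operators determined on letters *)

Section SeriesAlgebra.
Variable B : finType.
Implicit Types (f g x y : series B) (b c : B) (w : seq B) (M N : B -> B -> rat).

Lemma serDE f g w : (f + g) w = f w + g w. Proof. by []. Qed.
Lemma serZE (a : rat) f w : (a *: f) w = a * f w. Proof. by []. Qed.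
Lemma serNE f w : (- f) w = - f w. Proof. by []. Qed.
Lemma ser0E w : (0 : series B) w = 0. Proof. by []. Qed.
Lemma serBE f g w : (f - g) w = f w - g w. Proof. by []. Qed.
Lemma serP f g : (forall w, f w = g w) -> f = g. Proof. by move=> h; apply/funext. Qed.
Lemma ser_sumE (I : Type) (r : seq I) (P : pred I) (F : I -> series B) w :
  (\sum_(i <- r | P i) F i) w = \sum_(i <- r | P i) F i w.
Proof. by rewrite fct_sumE. Qed.
Definition serE := (serDE, serNE, serZE, ser0E, ser_sumE).

Definition one : series B := fun w => (w == [::])%:R.

Definition dl b f : series B := fun w => f (b :: w).

(** The concatenation product (mulE), defined by recursion on the word at
    which it is evaluated, so that identities are proved by induction on this
    word for all factors at once. *)
Fixpoint cmul f g w : rat :=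
  f [::] * g w + if w is c :: w' then cmul (dl c f) g w' else 0.
Definition mul f g : series B := cmul f g.
Arguments mul : simpl never.
Local Notation "f ** g" := (mul f g) (at level 40, left associativity).

Lemma dl_linear b (a : rat) f g : dl b (a *: f + g) = a *: dl b f + dl b g.
Proof. by []. Qed.
HB.instance Definition _ b :=
  GRing.isLinear.Build rat (series B) (series B) _ (dl b) (dl_linear b).

Lemma mul_nil f g : (f ** g) [::] = f [::] * g [::].
Proof. by rewrite /mul /= addr0. Qed.

Lemma mul_cons f g c w :
  (f ** g) (c :: w) = f [::] * g (c :: w) + (dl c f ** g) w.
Proof. by []. Qed.

Lemma dl_mul c f g : dl c (f ** g) = f [::] *: dl c g + dl c f ** g.
Proof. exact: serP. Qed.

Lemma mulE f g w :
  (f ** g) w = \sum_(i < (size w).+1) f (take i w) * g (drop i w).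
Proof.
elim: w f => [|c w IH] f; first by rewrite mul_nil big_ord_recl big_ord0 addr0.
by rewrite mul_cons IH [RHS]big_ord_recl; congr (_ + _).
Qed.

Lemma mul_linl g (a : rat) f f' : (a *: f + f') ** g = a *: (f ** g) + f' ** g.
Proof.
apply: serP => w; elim: w f f' => [|c w IH] f f'.
  by rewrite !(mul_nil, serE); ring.
by rewrite !(mul_cons, serE, dl_linear) IH !serE; ring.
Qed.

Lemma mul_linr f (a : rat) g g' : f ** (a *: g + g') = a *: (f ** g) + f ** g'.
Proof.
apply: serP => w; elim: w f => [|c w IH] f.
  by rewrite !(mul_nil, serE); ring.
by rewrite !(mul_cons, serE) IH !serE; ring.
Qed.

HB.instance Definition _ f :=
  GRing.isLinear.Build rat (series B) (series B) _ (mul f) (mul_linr f).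

Definition mulr g f := f ** g.
HB.instance Definition _ g :=
  GRing.isLinear.Build rat (series B) (series B) _ (mulr g) (mul_linl g).

Lemma cmulDr f g g' : f ** (g + g') = f ** g + f ** g'.
Proof. exact: linearD. Qed.
Lemma cmulZr f (a : rat) g : f ** (a *: g) = a *: (f ** g).
Proof. exact: linearZZ. Qed.
Lemma cmulBr f g g' : f ** (g - g') = f ** g - f ** g'.
Proof. exact: linearB. Qed.
Lemma cmul0r f : f ** 0 = 0.
Proof. exact: linear0. Qed.
Lemma cmulDl g f f' : (f + f') ** g = f ** g + f' ** g.
Proof. exact: (linearD (mulr g)). Qed.
Lemma cmulZl g (a : rat) f : (a *: f) ** g = a *: (f ** g).
Proof. exact: (linearZZ (mulr g)). Qed.
Lemma cmulNl g f : (- f) ** g = - (f ** g).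
Proof. exact: (linearN (mulr g)). Qed.
Lemma cmulBl g f f' : (f - f') ** g = f ** g - f' ** g.
Proof. exact: (linearB (mulr g)). Qed.
Lemma cmul0l g : 0 ** g = 0.
Proof. exact: (linear0 (mulr g)). Qed.
Lemma cmul_suml (I : Type) (r : seq I) (P : pred I) g (F : I -> series B) :
  (\sum_(i <- r | P i) F i) ** g = \sum_(i <- r | P i) F i ** g.
Proof. exact: (linear_sum (mulr g)). Qed.

Lemma cmul1l g : one ** g = g.
Proof.
apply: serP => -[|c w]; first by rewrite mul_nil mul1r.
rewrite mul_cons mul1r (_ : dl c one = 0) ?cmul0l ?ser0E ?addr0 //.
Qed.

Lemma cmul1r f : f ** one = f.
Proof.
apply: serP => w; elim: w f => [|c w IH] f; first by rewrite mul_nil mulr1.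
by rewrite mul_cons IH mulr0 add0r.
Qed.

Lemma cmulA f g h : f ** (g ** h) = (f ** g) ** h.
Proof.
apply: serP => w; elim: w f g => [|c w IH] f g.
  by rewrite !mul_nil mulrA.
by rewrite !(mul_cons, dl_mul, mul_linl, serE) IH mul_nil; ring.
Qed.

Lemma gen_mul_nil b g : (gen b ** g) [::] = 0.
Proof. by rewrite mul_nil mul0r. Qed.

Lemma dl_gen b c : dl c (gen b) = (c == b)%:R *: one.
Proof.
apply: serP => w; rewrite serZE /dl /gen /one eqseq_cons.
by case: (c == b); case: (w == [::]); rewrite ?mulr1 ?mulr0.
Qed.

Lemma gen_mul_cons b g c w : (gen b ** g) (c :: w) = (c == b)%:R * g w.
Proof. by rewrite mul_cons mul0r add0r dl_gen cmulZl cmul1l. Qed.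

Lemma dl_gen_mul b c g : dl c (gen b ** g) = (c == b)%:R *: g.
Proof. by apply: serP => w; rewrite serZE -gen_mul_cons. Qed.

(** Reduces identities of linear operators to the series 1 and to products
    with a letter on the left, without passing to a limit. *)
Lemma ser_dec f : f = f [::] *: one + \sum_b gen b ** dl b f.
Proof.
apply: serP => -[|c w]; rewrite !serE.
  by rewrite mulr1 big1 ?addr0 // => b _; rewrite gen_mul_nil.
rewrite mulr0 add0r (bigD1 c) //= gen_mul_cons eqxx mul1r big1 ?addr0 //.
by move=> b nbc; rewrite gen_mul_cons eq_sym (negPf nbc) mul0r.
Qed.

Definition supp (S : {set B}) f := forall w, f w != 0 -> all (mem S) w.

Lemma supp0 S f w : supp S f -> ~~ all (mem S) w -> f w = 0.
Proof. by move=> sf nw; apply/eqP; apply: contraNT nw => /sf. Qed.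

Lemma supp_dl S f b : supp S f -> supp S (dl b f).
Proof. by move=> sf w /sf /= /andP[]. Qed.

Lemma supp_dl0 S f b : supp S f -> b \notin S -> dl b f = 0.
Proof.
by move=> sf nb; apply: serP => w; apply: (supp0 sf); rewrite /= (negPf nb).
Qed.

Lemma suppT f : supp [set: B] f.
Proof. by move=> w _; apply/allP => b _; rewrite inE. Qed.

Lemma supp_zero S : supp S 0.
Proof. by move=> w; rewrite ser0E eqxx. Qed.

Lemma supp_lin S (a : rat) f g : supp S f -> supp S g -> supp S (a *: f + g).
Proof.
move=> sf sg w; apply: contraNT => nw.
by rewrite !serE (supp0 sf nw) (supp0 sg nw) mulr0 addr0.
Qed.

Lemma suppZ S (a : rat) f : supp S f -> supp S (a *: f).
Proof.
by move=> sf; rewrite -[_ *: _]addr0; apply: supp_lin => //; apply: supp_zero.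
Qed.

Lemma suppB S f g : supp S f -> supp S g -> supp S (f - g).
Proof. by move=> sf sg; rewrite -scaleN1r addrC; apply: supp_lin. Qed.

Lemma supp_gen (S : {set B}) b : b \in S -> supp S (gen b).
Proof.
by move=> bS w; rewrite /gen; case: (w =P [:: b]) => [->|_]; rewrite ?eqxx //= bS.
Qed.

Lemma supp_one S : supp S one.
Proof. by move=> [|c w]; rewrite /one ?eqxx. Qed.

Lemma supp_mul S f g : supp S f -> supp S g -> supp S (f ** g).
Proof.
move=> sf sg w; apply: contraNT => nw; rewrite mulE big1 // => i _.
move: nw; rewrite -{1}(cat_take_drop i w) all_cat negb_and => /orP[]h.
  by rewrite (supp0 sf h) mul0r.
by rewrite (supp0 sg h) mulr0.
Qed.

Lemma supp_sum S (I : Type) (r : seq I) (P : pred I) (F : I -> series B) :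
  (forall i, P i -> supp S (F i)) -> supp S (\sum_(i <- r | P i) F i).
Proof.
move=> h; apply: (big_ind (supp S)) => //.
by move=> f g sf sg; rewrite -[f]scale1r; apply: supp_lin.
Qed.

End SeriesAlgebra.
Arguments one {B}.
Notation "f ** g" := (mul f g) (at level 40, left associativity).
Arguments mul : simpl never.

Section Morphisms.
Variables B C : finType.
Implicit Types (f g : series B) (b : B) (M : B -> C -> rat).

Definition lin M b : series C := \sum_c M b c *: gen c.

Lemma lin_mul_nil M b (g : series C) : (lin M b ** g) [::] = 0.
Proof. by rewrite mul_nil /lin ser_sumE big1 ?mul0r // => c _; rewrite serE mulr0. Qed.

Lemma lin_mul_cons M b (g : series C) c w : (lin M b ** g) (c :: w) = M b c * g w.
Proof.
rewrite /lin cmul_suml ser_sumE (bigD1 c) //= cmulZl serE gen_mul_cons eqxx mul1r.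
rewrite big1 ?addr0 // => e nec.
by rewrite cmulZl serE gen_mul_cons eq_sym (negPf nec) mul0r mulr0.
Qed.

Lemma lin1 M b (c : C) : lin M b [:: c] = M b c.
Proof. by rewrite -[lin M b]cmul1r lin_mul_cons mulr1. Qed.

(** The uniqueness principle behind the operator identities below. The
    hypothesis strips a letter off the argument and off the word at which the
    value is read, so the claim follows by induction on the length of this
    word. *)
Lemma intertwiner_eq0 (S : {set B}) M (E : {linear series B -> series C}) :
  E (@one B) = 0 ->
  (forall b g, b \in S -> supp S g -> E (gen b ** g) = lin M b ** E g) ->
  forall f, supp S f -> E f = 0.
Proof.
move=> E1 Eb f sf; apply: serP => w; elim: w f sf => [|c w IH] f sf;
  rewrite [f]ser_dec linearP E1 scaler0 add0r linear_sum /= ser_sumE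
    big1 // => b _;
  (case: (boolP (b \in S)) => bS;
    last by rewrite (supp_dl0 sf bS) cmul0r linear0);
  rewrite (Eb _ _ bS (supp_dl sf)) ?lin_mul_nil // lin_mul_cons IH ?mulr0 //.
exact: supp_dl.
Qed.

(** The difference of two operators which obey the same twisted Leibniz rule
    in front of the letters intertwines the left multiplications. *)
Lemma intertwiner_eq (S : {set B}) M (E E' : {linear series B -> series C}) :
  E (@one B) = E' (@one B) ->
  (forall b g, b \in S -> supp S g ->
     E (gen b ** g) - E' (gen b ** g) = lin M b ** (E g - E' g)) ->
  forall f, supp S f -> E f = E' f.
Proof.
move=> E1 Eb f sf; apply/eqP; rewrite -subr_eq0; apply/eqP.
by apply: (@intertwiner_eq0 S M (E \- E')) => //; rewrite /= E1 subrr.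
Qed.

(** The morphism of complete tensor algebras which sends each letter b to lin
    M b. *)
Fixpoint algw M (w : seq C) f : rat :=
  if w is c :: w' then \sum_b M b c * algw M w' (dl b f) else f [::].
Definition alg M f : series C := fun w => algw M w f.

Lemma alg_linear M (a : rat) f g : alg M (a *: f + g) = a *: alg M f + alg M g.
Proof.
apply: serP => w; rewrite !serE /alg; elim: w f g => [|c w IH] f g //=.
rewrite mulr_sumr -big_split; apply: eq_bigr => b _ /=.
by rewrite dl_linear IH; ring.
Qed.
HB.instance Definition _ M :=
  GRing.isLinear.Build rat (series B) (series C) _ (alg M) (alg_linear M).
Lemma algw0 M w : algw M w 0 = 0.
Proof. exact: (congr1 (@^~ w) (linear0 (alg M))). Qed.

Lemma alg1 M : alg M (@one B) = @one C.
Proof.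
apply: serP => -[|c w] //; rewrite /alg /= big1 // => b _.
rewrite (_ : dl b one = 0) //.
by rewrite algw0 mulr0.
Qed.

Lemma alg_gen_mul M b g : alg M (gen b ** g) = lin M b ** alg M g.
Proof.
apply: serP => -[|c w]; first by rewrite lin_mul_nil /alg /= gen_mul_nil.
rewrite lin_mul_cons {1}/alg /= (bigD1 b) //= dl_gen_mul eqxx scale1r big1 ?addr0 //.
move=> e neb; rewrite dl_gen_mul (negPf neb) scale0r.
by rewrite algw0 mulr0.
Qed.

Lemma alg_gen M b : alg M (gen b) = lin M b.
Proof. by rewrite -{1}[gen b]cmul1r alg_gen_mul alg1 cmul1r. Qed.

End Morphisms.

Section SkewDerivations.
Variable B : finType.
Implicit Types (f g x y : series B) (b c : B) (w : seq B) (M N : B -> B -> rat).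

(** The skew derivation D with D b = phi b for each letter b and with the
    Leibniz rule D (f g) = (D f) g + (alg M f) (D g), proved in skew_mul.
    Differentials, contracting homotopies and differences of morphisms are all
    of this kind. *)
Fixpoint skeww M (phi : B -> series B) w f : rat :=
  (\sum_b phi b ** dl b f) w +
  if w is c :: w' then \sum_b M b c * skeww M phi w' (dl b f) else 0.
Definition skew M phi f : series B := fun w => skeww M phi w f.

Lemma skew_linear M phi (a : rat) f g :
  skew M phi (a *: f + g) = a *: skew M phi f + skew M phi g.
Proof.
have E1 : forall f g, \sum_b phi b ** dl b (a *: f + g) =
    a *: (\sum_b phi b ** dl b f) + \sum_b phi b ** dl b g.
  move=> f' g'; rewrite scaler_sumr -big_split; apply: eq_bigr => b _ /=.
  by rewrite dl_linear mul_linr.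
apply: serP => w; rewrite !serE /skew; elim: w f g => [|c w IH] f g /=.
  by rewrite E1 !serDE serZE; ring.
rewrite E1 serDE serZE (_ : \sum_b _ = 
   a * \sum_b M b c * skeww M phi w (dl b f) +
   \sum_b M b c * skeww M phi w (dl b g)); first by ring.
rewrite mulr_sumr -big_split; apply: eq_bigr => b _ /=.
by rewrite dl_linear IH; ring.
Qed.
HB.instance Definition _ M phi :=
  GRing.isLinear.Build rat (series B) (series B) _ (skew M phi)
    (skew_linear M phi).
Lemma skeww0 M phi w : skeww M phi w 0 = 0.
Proof. exact: (congr1 (@^~ w) (linear0 (skew M phi))). Qed.

Lemma skew1 M phi : skew M phi one = 0.
Proof.
have d1 b : dl b one = 0 by apply: serP.
apply: serP => w; rewrite /skew.
case: w => [|c w] /=; rewrite ser_sumE big1 ?add0r //; try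
  by move=> b _; rewrite d1 cmul0r ser0E.
rewrite big1 // => b _; rewrite d1.
by rewrite skeww0 mulr0.
Qed.

Lemma skew_gen_mul M phi b g :
  skew M phi (gen b ** g) = phi b ** g + lin M b ** skew M phi g.
Proof.
have E1 : \sum_e phi e ** dl e (gen b ** g) = phi b ** g.
  rewrite (bigD1 b) //= dl_gen_mul eqxx scale1r big1 ?addr0 // => e neb.
  by rewrite dl_gen_mul (negPf neb) scale0r cmul0r.
apply: serP => -[|c w]; rewrite serDE.
  by rewrite /skew /= E1 lin_mul_nil.
rewrite lin_mul_cons {1}/skew /= E1; congr (_ + _).
rewrite (bigD1 b) //= dl_gen_mul eqxx scale1r big1 ?addr0 // => e neb.
rewrite dl_gen_mul (negPf neb) scale0r.
by rewrite skeww0 mulr0.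
Qed.

Lemma skew_gen M phi b : skew M phi (gen b) = phi b.
Proof. by rewrite -{1}[gen b]cmul1r skew_gen_mul skew1 cmul0r addr0 cmul1r. Qed.

End SkewDerivations.

(** * Gradings and the calculus of skew derivations *)

Definition odz (k : int) : bool := odd `|k|%N.

Lemma odzD i j : odz (i + j) = odz i (+) odz j.
Proof. by rewrite /odz; lia. Qed.
Lemma odzN i : odz (- i) = odz i.
Proof. by rewrite /odz; lia. Qed.
Lemma odzM i j : odz (i * j) = odz i && odz j.
Proof. by rewrite /odz abszM oddM. Qed.
Lemma odz1 : odz 1. Proof. by []. Qed.

Lemma signzE (k : int) : (-1 : rat) ^ k = (-1) ^+ odz k.
Proof.
rewrite /odz signr_odd; case: k => k; first by [].
by rewrite NegzE -exprnN abszN absz_nat -exprVn invrN invr1.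
Qed.
Definition sgnE := (signzE, odzD, odzN, odzM, odz1).

Section Graded.
Variables (B : finType) (wt : B -> int).
Implicit Types (f g h : series B) (b c : B) (w : seq B) (M N : B -> B -> rat).
Implicit Types (k i j r : int) (S : {set B}).

Lemma wdeg_nil : wdeg wt [::] = 0. Proof. exact: big_nil. Qed.
Lemma wdeg_cons b w : wdeg wt (b :: w) = wt b + wdeg wt w.
Proof. exact: big_cons. Qed.
Lemma wdeg_cat u w : wdeg wt (u ++ w) = wdeg wt u + wdeg wt w.
Proof. exact: big_cat. Qed.

(** The weights wt are a parameter, because three gradings are used: the
    degree, the word length (all weights 1), and their sum. *)
Definition homog k f := forall w, f w != 0 -> wdeg wt w = k.

Lemma homog0 k f w : homog k f -> wdeg wt w != k -> f w = 0.
Proof. by move=> hf nk; apply/eqP; apply: contraNT nk => /hf ->. Qed.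

Lemma homogP k f : (forall w, wdeg wt w != k -> f w = 0) -> homog k f.
Proof. by move=> hf w; apply: contraNeq => /hf ->. Qed.

Lemma homog_zero k : homog k 0.
Proof. by apply: homogP. Qed.

Lemma homog_lin k (a : rat) f g : homog k f -> homog k g -> homog k (a *: f + g).
Proof.
move=> hf hg; apply: homogP => w nk.
by rewrite !serE (homog0 hf nk) (homog0 hg nk) mulr0 addr0.
Qed.

Lemma homog_sum (I : Type) (s : seq I) (P : pred I) (F : I -> series B) k :
  (forall a : I, P a -> homog k (F a)) -> homog k (\sum_(a <- s | P a) F a).
Proof.
move=> h; apply: (big_ind (homog k)) => //.
  by move=> f g hf hg; rewrite -[f]scale1r; apply: homog_lin.
Qed.

Lemma homogD k f g : homog k f -> homog k g -> homog k (f + g).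
Proof. by move=> hf hg; rewrite -[f]scale1r; apply: homog_lin. Qed.

Lemma homogZ k (a : rat) f : homog k f -> homog k (a *: f).
Proof. by move=> hf; rewrite -[_ *: _]addr0; apply: homog_lin => //; apply: homog_zero. Qed.

Lemma homogB k f g : homog k f -> homog k g -> homog k (f - g).
Proof. by move=> hf hg; rewrite -scaleN1r addrC; apply: homog_lin. Qed.

Lemma homog_gen b : homog (wt b) (gen b).
Proof.
apply: homogP => w; rewrite /gen; case: (w =P [:: b]) => // ->.
by rewrite wdeg_cons wdeg_nil addr0 eqxx.
Qed.

Lemma homog_one : homog 0 (@one B).
Proof. by apply: homogP => -[|//]; rewrite wdeg_nil eqxx. Qed.

Lemma homog_dl k f b : homog k f -> homog (k - wt b) (dl b f).
Proof. by move=> hf w /hf; rewrite wdeg_cons => <-; rewrite addrC addKr. Qed.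

Lemma homog_mul i j f g : homog i f -> homog j g -> homog (i + j) (f ** g).
Proof.
move=> hf hg; apply: homogP => w nk; rewrite mulE big1 // => l _.
have [e|ne] := eqVneq (wdeg wt (take l w)) i.
  rewrite (homog0 hg) ?mulr0 //; apply: contraNneq nk => e'.
  by rewrite -(cat_take_drop l w) wdeg_cat e e'.
by rewrite (homog0 hf) ?mul0r.
Qed.

Lemma skew_homog S M phi k r f :
  (forall b c, b \in S -> M b c != 0 -> wt c = wt b) ->
  (forall b, b \in S -> homog (wt b + r) (phi b)) ->
  supp S f -> homog k f -> homog (k + r) (skew M phi f).
Proof.
move=> hM hp sf hf; apply: homogP => w; rewrite /skew.
have E1 : forall k f, supp S f -> homog k f -> homog (k + r) (\sum_b phi b ** dl b f).
  move=> k' f' sf' hf'; apply: homog_sum => b _.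
  have [bS|nb] := boolP (b \in S); last first.
    by rewrite (supp_dl0 sf' nb) cmul0r; apply: homog_zero.
  have -> : k' + r = (wt b + r) + (k' - wt b) by ring.
  by apply: homog_mul; [exact: hp|exact: homog_dl].
elim: w k f sf hf => [|c w IH] k f sf hf nk /=.
  by rewrite (homog0 (E1 _ _ sf hf)) ?addr0.
rewrite (homog0 (E1 _ _ sf hf)) // add0r big1 // => b _.
have [bS|nb] := boolP (b \in S); last first.
  by rewrite (supp_dl0 sf nb) skeww0 mulr0.
have [->|nz] := eqVneq (M b c) 0; first by rewrite mul0r.
rewrite (IH _ _ (supp_dl sf) (homog_dl hf)) ?mulr0 //.
apply: contraNneq nk => e; rewrite wdeg_cons e (hM b c) //.
by apply/eqP; ring.
Qed.

End Graded.

Section MorphismGrading.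
Variables (B C : finType) (wt : B -> int) (wt' : C -> int).
Implicit Types (f g : series B) (b : B) (c : C) (M : B -> C -> rat).
Implicit Types (S : {set B}) (k : int).

Lemma alg_homog S M k f :
  (forall b c, b \in S -> M b c != 0 -> wt' c = wt b) ->
  supp S f -> homog wt k f -> homog wt' k (alg M f).
Proof.
move=> hM sf hf; apply: homogP => w; rewrite /alg.
elim: w k f sf hf => [|c w IH] k f sf hf nk /=.
  by apply: (homog0 hf); move: nk; rewrite !wdeg_nil.
rewrite big1 // => b _; have [bS|nb] := boolP (b \in S); last first.
  by rewrite (supp_dl0 sf nb) algw0 mulr0.
have [->|nz] := eqVneq (M b c) 0; first by rewrite mul0r.
rewrite (IH _ _ (supp_dl sf) (homog_dl hf)) ?mulr0 //.
apply: contraNneq nk => e; rewrite wdeg_cons e (hM b c) //.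
by rewrite addrC subrK.
Qed.

Lemma alg_supp S (S' : {set C}) M f :
  (forall b c, b \in S -> M b c != 0 -> c \in S') ->
  supp S f -> supp S' (alg M f).
Proof.
move=> hM sf w; apply: contraNT; rewrite /alg.
elim: w f sf => [//|c w IH] f sf /=; rewrite negb_and => nw.
rewrite big1 // => b _; have [bS|nb] := boolP (b \in S); last first.
  by rewrite (supp_dl0 sf nb) algw0 mulr0.
have [->|nz] := eqVneq (M b c) 0; first by rewrite mul0r.
case/orP: nw => [|nw]; first by rewrite (hM _ _ bS nz).
by rewrite (eqP (IH _ (supp_dl sf) nw)) mulr0.
Qed.

Lemma alg_mul M f g : alg M (f ** g) = alg M f ** alg M g.
Proof.
apply: (@intertwiner_eq _ _ [set: B] M (alg M \o mulr g) (mulr (alg M g) \o alg M)).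
- by rewrite /= /mulr cmul1l alg1 cmul1l.
- move=> b f' _ _; rewrite /= /mulr -cmulA !alg_gen_mul.
  by rewrite -cmulA cmulBr.
- exact: suppT.
Qed.

End MorphismGrading.

Section Leibniz.
Variables (B : finType).
Implicit Types (f g h : series B) (b c : B) (w : seq B) (M N : B -> B -> rat).
Implicit Types (S : {set B}).

Lemma skew_supp S M phi f :
  (forall b c, b \in S -> M b c != 0 -> c \in S) ->
  (forall b, b \in S -> supp S (phi b)) ->
  supp S f -> supp S (skew M phi f).
Proof.
move=> hM hp sf w; apply: contraNT; rewrite /skew.
have E1 : forall f, supp S f -> supp S (\sum_b phi b ** dl b f).
  move=> f' sf'; apply: supp_sum => b _.
  have [bS|nb] := boolP (b \in S); last first.
    by rewrite (supp_dl0 sf' nb) cmul0r; apply: supp_zero.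
  by apply: supp_mul; [exact: hp|exact: supp_dl].
elim: w f sf => [//|c w IH] f sf nw /=.
rewrite (supp0 (E1 _ sf) nw) add0r big1 // => b _.
move: nw; rewrite /= negb_and => nw.
have [bS|nb] := boolP (b \in S); last first.
  by rewrite (supp_dl0 sf nb) skeww0 mulr0.
have [->|nz] := eqVneq (M b c) 0; first by rewrite mul0r.
case/orP: nw => [|nw]; first by rewrite (hM _ _ bS nz).
by rewrite (eqP (IH _ (supp_dl sf) nw)) mulr0.
Qed.

Lemma skew_mul M phi f g :
  skew M phi (f ** g) = skew M phi f ** g + alg M f ** skew M phi g.
Proof.
apply: (@intertwiner_eq _ _ [set: B] M (skew M phi \o mulr g)
   ((mulr g \o skew M phi) \+ (mulr (skew M phi g) \o alg M))).
- by rewrite /= /mulr cmul1l skew1 cmul0l add0r alg1 cmul1l.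
- move=> b f' _ _; rewrite /= /mulr -cmulA !skew_gen_mul !alg_gen_mul.
  rewrite -!cmulA cmulDl cmulBr cmulDr -!cmulA.
  rewrite opprD opprD !addrA (addrC (phi b ** _)) addrK.
  by rewrite opprD addrA.
- exact: suppT.
Qed.

(** The first two hypotheses cancel the mixed terms of the two Leibniz rules;
    what remains is again a Leibniz rule, so the anticommutator is determined
    by its values chi on the letters. *)
Lemma skew_anticomm S M N Q phi psi chi :
  (forall b, b \in S -> alg M (psi b) + skew N psi (lin M b) = 0) ->
  (forall b, b \in S -> skew M phi (lin N b) + alg N (phi b) = 0) ->
  (forall b, b \in S -> alg M (lin N b) = lin Q b) ->
  (forall b, b \in S -> alg N (lin M b) = lin Q b) ->
  (forall b, b \in S -> skew M phi (psi b) + skew N psi (phi b) = chi b) ->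
  forall f, supp S f ->
  skew M phi (skew N psi f) + skew N psi (skew M phi f) = skew Q chi f.
Proof.
move=> h1 h2 h3 h4 h5 f.
apply: (@intertwiner_eq _ _ S Q
  ((skew M phi \o skew N psi) \+ (skew N psi \o skew M phi)) (skew Q chi)).
  by rewrite /= !skew1 !linear0 addr0.
move=> b g bS sg; rewrite /= !skew_gen_mul.
rewrite (linearD (skew M phi)) (linearD (skew N psi)) /= !skew_mul.
rewrite h3 // h4 // cmulBr cmulDr -[chi b]h5 // cmulDl.
have e1 := h1 b bS; have e2 := h2 b bS.
apply/eqP; rewrite -subr_eq0; apply/eqP.
set a1 := skew M phi (psi b) ** g; set a2 := skew N psi (phi b) ** g.
have -> : skew N psi (lin M b) = - alg M (psi b).
  by apply/eqP; rewrite -addr_eq0 addrC e1.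
have -> : skew M phi (lin N b) = - alg N (phi b).
  by apply/eqP; rewrite -addr_eq0 e2.
by rewrite !cmulNl; apply: serP => w; rewrite !(serBE, serE); ring.
Qed.

Lemma skew_ext S M phi psi :
  (forall b, b \in S -> phi b = psi b) ->
  forall f, supp S f -> skew M phi f = skew M psi f.
Proof.
move=> h; apply: (@intertwiner_eq _ _ S M (skew M phi) (skew M psi)).
  by rewrite /= !skew1.
by move=> b g bS _; rewrite /= !skew_gen_mul (h b bS) cmulBr opprD addrACA subrr add0r.
Qed.

Lemma skew_phiD M phi psi f :
  skew M (fun b => phi b + psi b) f = skew M phi f + skew M psi f.
Proof.
apply: (@intertwiner_eq _ _ [set: B] M (skew M (fun b => phi b + psi b))
  (skew M phi \+ skew M psi)).
- by rewrite /= !skew1 addr0.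
- move=> b g _ _; rewrite /= !skew_gen_mul cmulDl cmulBr cmulDr.
  by apply: serP => w; rewrite !(serBE, serE); ring.
- exact: suppT.
Qed.

Lemma skew_phi0 M f : skew M (fun _ => 0) f = 0.
Proof.
apply: (@intertwiner_eq0 _ _ [set: B] M (skew M (fun _ => 0))).
- by rewrite /= skew1.
- by move=> b g _ _; rewrite /= skew_gen_mul cmul0l add0r.
- exact: suppT.
Qed.

Definition idm b c : rat := (b == c)%:R.

Lemma lin_idm b : lin idm b = gen b.
Proof.
rewrite /lin (bigD1 b) //= /idm eqxx scale1r big1 ?addr0 // => c nc.
by rewrite eq_sym (negPf nc) scale0r.
Qed.

(** Since f g - (alg M f) (alg M g) = (f - alg M f) g + (alg M f) (g - alg M
    g), the difference of the identity and an algebra morphism is a skew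
    derivation. *)
Lemma skew_sub_alg S M f : supp S f ->
  skew M (fun b => gen b - lin M b) f = f - alg M f.
Proof.
apply: (@intertwiner_eq _ _ S M _ (idfun \- alg M)) => [|b g _ _]; rewrite /=.
  by rewrite skew1 alg1 subrr.
rewrite skew_gen_mul alg_gen_mul cmulBl !cmulBr.
by apply: serP => w; rewrite !(serBE, serE); ring.
Qed.

End Leibniz.

(** * The graded bracket and the weighted Dynkin operator *)

Section Bracket.
Variables (B : finType) (deg : B -> int).
Implicit Types (f g h : series B) (b c : B) (w : seq B) (M N : B -> B -> rat).
Implicit Types (i j k : int) (S : {set B}).
Local Notation br := (ser_br deg).

Lemma br_linearl g (a : rat) f f' : br (a *: f + f') g = a *: br f g + br f' g.
Proof.
apply: serP => w; rewrite !serE /ser_br mulr_sumr -big_split.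
by apply: eq_bigr => l _ /=; rewrite !serE; ring.
Qed.

Lemma br_linearr f (a : rat) g g' : br f (a *: g + g') = a *: br f g + br f g'.
Proof.
apply: serP => w; rewrite !serE /ser_br mulr_sumr -big_split.
by apply: eq_bigr => l _ /=; rewrite !serE; ring.
Qed.

HB.instance Definition _ f :=
  GRing.isLinear.Build rat (series B) (series B) _ (br f) (br_linearr f).
Definition brr g f := br f g.
HB.instance Definition _ g :=
  GRing.isLinear.Build rat (series B) (series B) _ (brr g) (br_linearl g).

Lemma brDr f g g' : br f (g + g') = br f g + br f g'.
Proof. exact: linearD. Qed.
Lemma brZr f (a : rat) g : br f (a *: g) = a *: br f g.
Proof. exact: linearZZ. Qed.
Lemma brNr f g : br f (- g) = - br f g.
Proof. exact: linearN. Qed.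
Lemma brBr f g g' : br f (g - g') = br f g - br f g'.
Proof. exact: linearB. Qed.
Lemma br0r f : br f 0 = 0.
Proof. exact: linear0. Qed.
Lemma br_sumr (I : Type) (r : seq I) (P : pred I) f (F : I -> series B) :
  br f (\sum_(a <- r | P a) F a) = \sum_(a <- r | P a) br f (F a).
Proof. exact: linear_sum. Qed.
Lemma brDl g f f' : br (f + f') g = br f g + br f' g.
Proof. exact: (linearD (brr g)). Qed.
Lemma brZl g (a : rat) f : br (a *: f) g = a *: br f g.
Proof. exact: (linearZZ (brr g)). Qed.
Lemma brBl g f f' : br (f - f') g = br f g - br f' g.
Proof. exact: (linearB (brr g)). Qed.
Lemma br0l g : br 0 g = 0.
Proof. exact: (linear0 (brr g)). Qed.
Lemma br_suml (I : Type) (r : seq I) (P : pred I) g (F : I -> series B) :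
  br (\sum_(a <- r | P a) F a) g = \sum_(a <- r | P a) br (F a) g.
Proof. exact: (linear_sum (brr g)). Qed.

Lemma brE i j f g : homog deg i f -> homog deg j g ->
  br f g = f ** g - (-1 : rat) ^ (i * j) *: (g ** f).
Proof.
move=> hf hg; apply: serP => w; rewrite !(serBE, serE) !mulE /ser_br.
rewrite mulr_sumr -sumrB; apply: eq_bigr => l _ /=; congr (_ - _).
have [e|ne] := eqVneq (wdeg deg (take l w)) j; last first.
  by rewrite (homog0 hg ne) !mul0r !mulr0.
have [e'|ne] := eqVneq (wdeg deg (drop l w)) i; last first.
  by rewrite (homog0 hf ne) !mulr0.
by rewrite e e' mulrC [j * i]mulrC mulrC.
Qed.

Lemma br_homog (wt : B -> int) i j f g :
  homog wt i f -> homog wt j g -> homog wt (i + j) (br f g).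
Proof.
move=> hf hg; apply: homogP => w nk; rewrite /ser_br big1 // => l _ /=.
have cutE : wdeg wt w = wdeg wt (take l w) + wdeg wt (drop l w).
  by rewrite -wdeg_cat cat_take_drop.
have -> : f (take l w) * g (drop l w) = 0.
  have [e|ne] := eqVneq (wdeg wt (take l w)) i; last by rewrite (homog0 hf) ?mul0r.
  by rewrite (homog0 hg) ?mulr0 //; apply: contraNneq nk => e'; rewrite cutE e e'.
have -> : g (take l w) * f (drop l w) = 0.
  have [e|ne] := eqVneq (wdeg wt (take l w)) j; last by rewrite (homog0 hg) ?mul0r.
  rewrite (homog0 hf) ?mulr0 //; apply: contraNneq nk => e'.
  by rewrite cutE e e' addrC.
by rewrite mulr0 subr0.
Qed.

Lemma br_supp S f g : supp S f -> supp S g -> supp S (br f g).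
Proof.
move=> sf sg w; apply: contraNT => nw; rewrite /ser_br big1 // => l _ /=.
move: nw; rewrite -{1}(cat_take_drop l w) all_cat negb_and => /orP[]h.
  by rewrite (supp0 sf h) (supp0 sg h) !mul0r mulr0 subr0.
by rewrite (supp0 sf h) (supp0 sg h) !mulr0 subr0.
Qed.

Lemma br_antisym i j f g : homog deg i f -> homog deg j g ->
  br f g = - ((-1 : rat) ^ (i * j) *: br g f).
Proof.
move=> hf hg; rewrite (brE hf hg) (brE hg hf); apply: serP => w.
rewrite !(serBE, serE) !sgnE; case: (odz i); case: (odz j) => /=; ring.
Qed.

Lemma br_jacobi i j k f g h :
  homog deg i f -> homog deg j g -> homog deg k h ->
  br f (br g h) = br (br f g) h + (-1 : rat) ^ (i * j) *: br g (br f h).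
Proof.
move=> hf hg hh.
rewrite (brE hf (br_homog hg hh)) (brE (br_homog hf hg) hh)
  (brE hg (br_homog hf hh)) (brE hg hh) (brE hf hg) (brE hf hh).
rewrite !(cmulBl, cmulBr, cmulZl, cmulZr) !cmulA; apply: serP => w.
rewrite !(serBE, serE) !sgnE.
by case: (odz i); case: (odz j); case: (odz k) => /=; ring.
Qed.

(** The sign is that of the parity involution f |-> (-1)^|f| f, so alg (tw M)
    is the composite of alg M with it (alg_tw). *)
Definition tw M b c : rat := (-1) ^ deg b * M b c.

Lemma lin_tw M b : lin (tw M) b = (-1 : rat) ^ deg b *: lin M b.
Proof.
by rewrite /lin scaler_sumr; apply: eq_bigr => c _; rewrite /tw scalerA.
Qed.

Lemma alg_tw M k f : homog deg k f -> alg (tw M) f = (-1 : rat) ^ k *: alg M f.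
Proof.
move=> hf; apply: serP => w; rewrite serE /alg.
elim: w k f hf => [|c w IH] k f hf /=.
  have [e|ne] := eqVneq 0 k; first by rewrite -e expr0z mul1r.
  by rewrite (homog0 hf) ?mulr0 // wdeg_nil.
rewrite mulr_sumr; apply: eq_bigr => b _; rewrite (IH _ _ (homog_dl hf)) /tw.
by rewrite !sgnE; case: (odz k); case: (odz (deg b)) => /=; ring.
Qed.

Lemma tw_neq0 M b c : tw M b c != 0 -> M b c != 0.
Proof. by apply: contra_neq => h; rewrite /tw h mulr0. Qed.

(** With the parity involution as the twisting morphism, skew derivations are
    the derivations of odd degree with the Koszul sign rule (der_mul). *)
Definition der (phi : B -> series B) := skew (tw (@idm B)) phi.
HB.instance Definition _ phi := GRing.Linear.on (der phi).

Lemma alg_idm f : alg (@idm B) f = f.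
Proof.
apply: (@intertwiner_eq _ _ [set: B] (@idm B) (alg (@idm B)) idfun).
- by rewrite /= alg1.
- by move=> b g _ _; rewrite /= alg_gen_mul lin_idm cmulBr.
- exact: suppT.
Qed.

Lemma idm_neq0 b c : idm b c != 0 -> c = b.
Proof. by rewrite /idm; case: (b =P c). Qed.

Lemma der_gen phi b : der phi (gen b) = phi b.
Proof. exact: skew_gen. Qed.

Lemma der1 phi : der phi (@one B) = 0.
Proof. exact: skew1. Qed.

Lemma der_gen_mul phi b g :
  der phi (gen b ** g) = phi b ** g + (-1 : rat) ^ deg b *: (gen b ** der phi g).
Proof. by rewrite /der skew_gen_mul lin_tw lin_idm cmulZl. Qed.

Lemma der_mul phi i f g : homog deg i f ->
  der phi (f ** g) = der phi f ** g + (-1 : rat) ^ i *: (f ** der phi g).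
Proof. by move=> hf; rewrite /der skew_mul (alg_tw _ hf) alg_idm cmulZl. Qed.

Lemma der_homog (wt : B -> int) S r phi k f :
  (forall b, b \in S -> homog wt (wt b + r) (phi b)) ->
  supp S f -> homog wt k f -> homog wt (k + r) (der phi f).
Proof.
by apply: skew_homog => b c _ /tw_neq0/idm_neq0 ->.
Qed.

Lemma der_supp S phi f :
  (forall b, b \in S -> supp S (phi b)) -> supp S f -> supp S (der phi f).
Proof. by apply: skew_supp => b c bS /tw_neq0/idm_neq0 ->. Qed.

Lemma der_ext S phi psi : (forall b, b \in S -> phi b = psi b) ->
  forall f, supp S f -> der phi f = der psi f.
Proof. exact: skew_ext. Qed.

Lemma der_phiD phi psi f :
  der (fun b => phi b + psi b) f = der phi f + der psi f.
Proof. exact: skew_phiD. Qed.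

Lemma der_br phi i j f g :
  homog deg i f -> homog deg j g ->
  homog deg (i - 1) (der phi f) -> homog deg (j - 1) (der phi g) ->
  der phi (br f g) = br (der phi f) g + (-1 : rat) ^ i *: br f (der phi g).
Proof.
move=> hf hg hdf hdg.
rewrite (brE hf hg) linearB linearZZ /= (der_mul _ _ hf) (der_mul _ _ hg).
rewrite (brE hdf hg) (brE hf hdg); apply: serP => w; rewrite !(serBE, serE) !sgnE.
by case: (odz i); case: (odz j) => /=; ring.
Qed.

Lemma free_homog S k f : free_hom deg S k f -> homog deg k f.
Proof.
elim => {k f} [b _|k|k a f g _ hf _ hg|i j f g _ hf _ hg].
- exact: homog_gen.
- exact: homog_zero.
- exact: homog_lin.
- exact: br_homog.
Qed.

Lemma free_supp S k f : free_hom deg S k f -> supp S f.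
Proof.
elim => {k f} [b bS|k|k a f g _ hf _ hg|i j f g _ hf _ hg].
- exact: supp_gen.
- exact: supp_zero.
- exact: supp_lin.
- exact: br_supp.
Qed.

Lemma br_nil f g : f [::] = 0 -> g [::] = 0 -> br f g [::] = 0.
Proof.
by move=> f0 g0; rewrite /ser_br big_ord_recl big_ord0 /= f0 g0 !mul0r mulr0 subr0 addr0.
Qed.

Lemma br_gen_nil b f : br (gen b) f [::] = 0.
Proof.
by rewrite /ser_br big_ord_recl big_ord0 addr0 /gen /= mul0r !mulr0 subr0.
Qed.

Lemma free_nil S k f : free_hom deg S k f -> f [::] = 0.
Proof.
elim => {k f} [b bS|k|k a f g _ hf _ hg|i j f g _ hf _ hg] //.
- by rewrite !serE hf hg mulr0 addr0.
- exact: br_nil.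
Qed.

Lemma free_sum S k (I : Type) (r : seq I) (P : pred I) (F : I -> series B) :
  (forall a : I, P a -> free_hom deg S k (F a)) ->
  free_hom deg S k (\sum_(a <- r | P a) F a).
Proof.
move=> h; apply: (big_ind (free_hom deg S k)) => //; first exact: free_zero.
by move=> f g hf hg; rewrite -[f]scale1r; apply: free_lin.
Qed.

Lemma free_scale S k (a : rat) f : free_hom deg S k f -> free_hom deg S k (a *: f).
Proof.
by move=> hf; rewrite -[_ *: _]addr0; apply: free_lin => //; apply: free_zero.
Qed.

Lemma freeD S k f g : free_hom deg S k f -> free_hom deg S k g ->
  free_hom deg S k (f + g).
Proof. by move=> hf hg; rewrite -[f]scale1r; apply: free_lin. Qed.

Lemma freeB S k f g : free_hom deg S k f -> free_hom deg S k g ->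
  free_hom deg S k (f - g).
Proof. by move=> hf hg; rewrite -scaleN1r; apply/freeD/free_scale. Qed.

Lemma br_gen_local m b f f' w :
  (forall u, size u = m -> f u = f' u) -> size w = m.+1 ->
  br (gen b) f w = br (gen b) f' w.
Proof.
move=> e sw; rewrite /ser_br; apply: eq_bigr => l _ /=.
have lw : (l <= size w)%N by rewrite -ltnS.
congr (_ - _ * _); rewrite /gen.
  case: (take l w =P [:: b]) => [e1|]; last by rewrite !mul0r.
  rewrite e // size_drop.
  by have := congr1 size e1; rewrite size_takel //= => ->; rewrite sw subn1.
case: (drop l w =P [:: b]) => [e1|]; last by rewrite !mulr0.
rewrite e // size_takel //.
have := congr1 size e1; rewrite size_drop /=.
by move: sw lw; move: (nat_of_ord l) => p; lia.
Qed.

End Bracket.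

Section MorphismBracket.
Variables (B C : finType) (deg : B -> int) (deg' : C -> int).

Lemma alg_br (S : {set B}) (M : B -> C -> rat) i j (f g : series B) :
  (forall b c, b \in S -> M b c != 0 -> deg' c = deg b) ->
  supp S f -> supp S g -> homog deg i f -> homog deg j g ->
  alg M (ser_br deg f g) = ser_br deg' (alg M f) (alg M g).
Proof.
move=> hM sf sg hf hg.
rewrite (brE hf hg) (brE (alg_homog hM sf hf) (alg_homog hM sg hg)).
by rewrite linearB linearZZ /= !alg_mul.
Qed.

End MorphismBracket.

Section Dynkin.
Variables (B : finType) (deg : B -> int).
Implicit Types (f g h : series B) (b c : B) (w : seq B) (M N : B -> B -> rat).
Implicit Types (i j k : int) (S : {set B}).
Local Notation br := (ser_br deg).
Local Notation der := (der deg).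

Variable th : B -> int.

(** The value on words of length n of the weighted Dynkin operator, which
    sends the word b_1 ... b_n to the right normed bracket of its letters
    times the weight of the last one. On Lie elements it is the multiplication
    by the total weight (dyn_free); the weights are chosen below such that the
    operator also commutes with a given derivation (dyn_der). *)
Fixpoint dynn n f : series B :=
  if n is m.+1 then
    (if m is 0%N then \sum_b ((th b)%:~R * f [:: b]) *: gen b else 0)
    + \sum_b br (gen b) (dynn m (dl b f))
  else 0.

Definition dyn f : series B := fun w => dynn (size w) f w.

Lemma dynn_linear n (a : rat) f g : dynn n (a *: f + g) = a *: dynn n f + dynn n g.
Proof.
elim: n f g => [|n IH] f g /=; first by rewrite scaler0 addr0.
rewrite scalerDr addrACA; congr (_ + _).
  case: n {IH} => [|n]; last by rewrite scaler0 addr0.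
  rewrite scaler_sumr -big_split; apply: eq_bigr => b _ /=.
  by rewrite !serE scalerA -scalerDl; congr (_ *: _); ring.
rewrite scaler_sumr -big_split; apply: eq_bigr => b _ /=.
by rewrite dl_linear IH linearP.
Qed.

HB.instance Definition _ n :=
  GRing.isLinear.Build rat (series B) (series B) _ (dynn n) (dynn_linear n).

Lemma dyn_linear (a : rat) f g : dyn (a *: f + g) = a *: dyn f + dyn g.
Proof. by apply: serP => w; rewrite /dyn dynn_linear. Qed.
HB.instance Definition _ :=
  GRing.isLinear.Build rat (series B) (series B) _ dyn dyn_linear.

Lemma dynE f : dyn f = \sum_b ((th b)%:~R * f [:: b]) *: gen b
                       + \sum_b br (gen b) (dyn (dl b f)).
Proof.
apply: serP => w; rewrite {1}/dyn; case sw: (size w) => [|n] /=.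
  have -> : w = [::] by apply: size0nil.
  rewrite !serE !big1 ?addr0 // => b _; first by rewrite br_nil.
  by rewrite serE mulr0.
rewrite !serE; congr (_ + _).
  case: n sw => [|n] sw; first by rewrite !ser_sumE.
  rewrite serE big1 // => b _; rewrite serE /gen.
  by case: (w =P [:: b]) sw => [->|]; rewrite ?mulr0.
apply: eq_bigr => b _; apply: br_gen_local sw => u su.
by rewrite /dyn su.
Qed.

Lemma dyn1 : dyn (@one B) = 0.
Proof.
rewrite dynE !big1 ?addr0 // => b _; last by rewrite mulr0 scale0r.
by rewrite (_ : dl b (@one B) = 0) ?linear0 //; apply: serP.
Qed.

Lemma dyn_gen_mul b g :
  dyn (gen b ** g) = br (gen b) (dyn g) + (g [::] * (th b)%:~R) *: gen b.
Proof.
rewrite dynE addrC; congr (_ + _).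
  rewrite (bigD1 b) //= dl_gen_mul eqxx scale1r big1 ?addr0 // => c nc.
  by rewrite dl_gen_mul (negPf nc) scale0r !linear0.
rewrite (bigD1 b) //= gen_mul_cons eqxx mul1r big1 ?addr0 => [|c nc].
  by rewrite mulrC.
by rewrite gen_mul_cons (negPf nc) mul0r mulr0 scale0r.
Qed.

Lemma dyn_gen b : dyn (gen b) = (th b)%:~R *: gen b.
Proof. by rewrite -{1}[gen b]cmul1r dyn_gen_mul dyn1 linear0 add0r mul1r. Qed.

Lemma dynn_free S k n f : supp S f -> homog deg k f ->
  free_hom deg S k (dynn n f).
Proof.
elim: n k f => [|n IH] k f sf hf /=; first exact: free_zero.
apply: freeD.
  case: n {IH} => [|n]; last exact: free_zero.
  apply: free_sum => b _; have [e|ne] := eqVneq (f [:: b]) 0.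
    by rewrite e mulr0 scale0r; apply: free_zero.
  have <- : deg b = k.
    by have := hf _ ne; rewrite wdeg_cons wdeg_nil addr0.
  by apply/free_scale/free_gen; have := sf _ ne; rewrite /= andbT.
apply: free_sum => b _; have [bS|nb] := boolP (b \in S); last first.
  rewrite (supp_dl0 sf nb).
  by rewrite linear0 br0r; apply: free_zero.
have -> : k = deg b + (k - deg b) by ring.
by apply: free_br; [exact: free_gen|apply: IH; [exact: supp_dl|exact: homog_dl]].
Qed.

Lemma dynn_homog (wt : B -> int) k n f : homog wt k f -> homog wt k (dynn n f).
Proof.
elim: n k f => [|n IH] k f hf /=; first exact: homog_zero.
apply: homogD.
  case: n {IH} => [|n]; last exact: homog_zero.
  apply: homog_sum => b _; have [e|ne] := eqVneq (f [:: b]) 0.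
    by rewrite e mulr0 scale0r; apply: homog_zero.
  have <- : wt b = k.
    by have := hf _ ne; rewrite wdeg_cons wdeg_nil addr0.
  by apply/homogZ/homog_gen.
apply: homog_sum => b _.
have -> : k = wt b + (k - wt b) by ring.
by apply: br_homog; [exact: homog_gen|apply: IH; exact: homog_dl].
Qed.

Lemma dyn_homog (wt : B -> int) k f : homog wt k f -> homog wt k (dyn f).
Proof. by move=> hf w; apply: dynn_homog. Qed.

(** For a letter f this is the recursive definition. The Jacobi identity
    extends it to brackets: both sides let Lie elements act, on the left by
    multiplication and on the right by brackets. *)
Lemma dyn_mul_free S i j f g : free_hom deg S i f -> homog deg j g ->
  dyn (f ** g) = br f (dyn g) + g [::] *: dyn f.
Proof.
move=> ff; elim: ff j g => {i f} [b _|k|k a f f' _ hf _ hf'|i i' f f' Ff hf Ff' hf'] j g hg.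
- by rewrite dyn_gen_mul dyn_gen scalerA.
- by rewrite cmul0l !linear0 br0l addr0.
- rewrite mul_linl linearP /= (hf _ _ hg) (hf' _ _ hg) linearP br_linearl /=.
  by apply: serP => w; rewrite !serE; ring.
- have h1 := free_homog Ff; have h2 := free_homog Ff'.
  have hd := dyn_homog hg.
  rewrite (brE h1 h2) cmulBl cmulZl !(linearB dyn) !(linearZZ dyn) /= -!cmulA.
  rewrite (hf _ _ (homog_mul h2 hg)) (hf' _ _ (homog_mul h1 hg)).
  rewrite (hf' _ _ hg) (hf _ _ hg) !mul_nil (free_nil Ff) (free_nil Ff').
  rewrite !mul0r !scale0r !addr0 (hf _ _ h2) (hf' _ _ h1) (free_nil Ff) (free_nil Ff').
  rewrite !scale0r !addr0 -(brE h1 h2) !brDr !brZr.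
  rewrite (br_jacobi h1 h2 hd); apply: serP => w; rewrite !(serBE, serE); ring.
Qed.

Definition wsc f : series B := fun w => (wdeg th w)%:~R * f w.

Lemma wsc_mul f g : wsc (f ** g) = wsc f ** g + f ** wsc g.
Proof.
apply: serP => w; rewrite serE /wsc !mulE mulr_sumr -big_split.
apply: eq_bigr => l _ /=.
by rewrite -{1}(cat_take_drop l w) wdeg_cat intrD; ring.
Qed.

Lemma wsc_homog k f : homog deg k f -> homog deg k (wsc f).
Proof. by move=> hf; apply: homogP => w nk; rewrite /wsc (homog0 hf nk) mulr0. Qed.

(** The Dynkin-Specht-Wever identity: by dyn_mul_free, the Dynkin operator is
    a derivation of the bracket of Lie elements, and so is the multiplication
    by the weight. *)
Lemma dyn_free S k f : free_hom deg S k f -> dyn f = wsc f.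
Proof.
elim => {k f} [b _|k|k a f g _ hf _ hg|i j f g Ff hf Fg hg].
- rewrite dyn_gen; apply: serP => w; rewrite serE /wsc /gen.
  by case: (w =P [:: b]) => [->|]; rewrite ?mulr0 // wdeg_cons wdeg_nil addr0.
- by rewrite linear0; apply: serP => w; rewrite /wsc serE mulr0.
- by rewrite linearP /= hf hg; apply: serP => w; rewrite /wsc !serE; ring.
- have h1 := free_homog Ff; have h2 := free_homog Fg.
  rewrite {1}(brE h1 h2) (linearB dyn) (linearZZ dyn) /=.
  rewrite (dyn_mul_free Ff h2) (dyn_mul_free Fg h1) (free_nil Ff) (free_nil Fg).
  rewrite !scale0r !addr0 hf hg.
  rewrite (brE h1 (wsc_homog h2)) (brE h2 (wsc_homog h1)).
  apply: serP => w.
  have -> : wsc (br f g) w = (wsc (f ** g) - (-1 : rat) ^ (i * j) *: wsc (g ** f)) w.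
    by rewrite (brE h1 h2) /wsc !(serBE, serE); ring.
  rewrite !wsc_mul !(serBE, serE) [j * i]mulrC !sgnE.
  by case: (odz i); case: (odz j) => /=; ring.
Qed.

(** The analogue of intertwiner_eq0 for brackets with letters, which govern
    the Dynkin operator. *)
Lemma br_intertwiner_eq0 S (m : B -> B -> rat) (E : {linear series B -> series B}) :
  E (@one B) = 0 ->
  (forall b k g, b \in S -> supp S g -> homog deg k g ->
     E (gen b ** g) = \sum_c m b c *: br (gen c) (E g)) ->
  forall k f, supp S f -> homog deg k f -> E f = 0.
Proof.
move=> E1 Eb k f sf hf; apply: serP => w.
move: {2}(size w) (leqnn (size w)) => n.
elim: n w k f sf hf => [|n IH] w k f sf hf sw;
  rewrite [f]ser_dec linearP E1 scaler0 add0r linear_sum /= ser_sumE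
    big1 // => b _;
  (case: (boolP (b \in S)) => bS;
    last by rewrite (supp_dl0 sf bS) cmul0r linear0);
  rewrite (Eb _ _ _ bS (supp_dl sf) (homog_dl hf)) ser_sumE big1 // => c _;
  rewrite serE.
  move: sw; rewrite leqn0 => /eqP/size0nil ->.
  by rewrite br_gen_nil mulr0.
case sw': (size w) sw => [|l] sw.
  move/size0nil: sw' => ->.
  by rewrite br_gen_nil mulr0.
rewrite (@br_gen_local _ _ l c _ 0) ?br0r ?serE ?mulr0 // => u su.
by rewrite (IH _ _ _ (supp_dl sf) (homog_dl hf)) // su.
Qed.

Lemma dyn_alg S M k f :
  (forall b c, b \in S -> M b c != 0 -> c \in S /\ deg c = deg b /\ th c = th b) ->
  supp S f -> homog deg k f -> dyn (alg M f) = alg M (dyn f).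
Proof.
move=> hM sf hf; apply/eqP; rewrite -subr_eq0; apply/eqP.
apply: (@br_intertwiner_eq0 S M ((dyn \o alg M) \- (alg M \o dyn)) _ _ k f) => //=.
  by rewrite alg1 dyn1 linear0 subrr.
move=> b j g bS sg hg.
have hdeg : forall b c, b \in S -> M b c != 0 -> deg c = deg b.
  by move=> ? ? h1 /(hM _ _ h1)[_ []].
rewrite alg_gen_mul dyn_gen_mul linearD linearZZ /= alg_gen.
have sdg : supp S (dyn g) by move=> w; apply: (free_supp (dynn_free _ sg hg)).
rewrite (alg_br (deg' := deg) hdeg (supp_gen bS) sdg (homog_gen deg (b := b)) (dyn_homog hg)).
rewrite alg_gen {1 2 3}/lin cmul_suml br_suml linear_sum scaler_sumr /=.
rewrite opprD addrA -sumrB -sumrB; apply: eq_bigr => c _.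
have [e|ne] := eqVneq (M b c) 0.
  by rewrite e !scale0r cmul0l linear0 br0l scaler0 !subr0.
rewrite cmulZl linearZZ /= dyn_gen_mul brZl brBr.
have [_ [_ ->]] := hM _ _ bS ne.
have -> : alg M g [::] = g [::] by [].
by apply: serP => w; rewrite !(serBE, serE); ring.
Qed.

(** Since phi b is a Lie element, dyn_mul_free computes the Dynkin operator on
    phi b g, and since phi preserves the weight, dyn (phi b) is the multiple
    th b of phi b, as needed in the Leibniz rule. *)
Lemma dyn_der S phi k f :
  (forall b, b \in S -> free_hom deg S (deg b - 1) (phi b)) ->
  (forall b, b \in S -> homog th (th b) (phi b)) ->
  supp S f -> homog deg k f -> dyn (der phi f) = der phi (dyn f).
Proof.
move=> hp ht sf hf; apply/eqP; rewrite -subr_eq0; apply/eqP.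
apply: (@br_intertwiner_eq0 S (tw deg (@idm B)) ((dyn \o der phi) \- (der phi \o dyn)) _ _ k f) => //=.
  by rewrite der1 dyn1 (linear0 dyn) (linear0 (der phi)) subrr.
move=> b j g bS sg hg.
rewrite (bigD1 b) //= [X in _ = _ + X]big1 ?addr0 => [|c nc]; last first.
  by rewrite /tw /idm eq_sym (negPf nc) mulr0 scale0r.
rewrite {1}/tw /idm eqxx mulr1 der_gen_mul (linearD dyn) (linearZZ dyn) /=.
have hpb : homog deg (deg b - 1) (phi b) by apply: free_homog (hp _ bS).
have hph : forall b, b \in S -> homog deg (deg b + -1) (phi b).
  by move=> c cS; apply: free_homog (hp _ cS).
have sdg : supp S (dyn g) by move=> w; apply: (free_supp (dynn_free _ sg hg)).
rewrite (dyn_mul_free (hp _ bS) hg) !dyn_gen_mul (linearD (der phi)) (linearZZ (der phi)) /=.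
rewrite (der_br (phi := phi) (i := deg b) (j := j)) ?der_gen //; first last.
- by apply: (der_homog hph sdg); apply: dyn_homog.
- exact: dyn_homog.
- exact: homog_gen.
have -> : der phi g [::] = 0.
  rewrite /der /skew /= addr0 ser_sumE big1 // => c _.
  have [cS|nc] := boolP (c \in S).
    by rewrite mul_nil (free_nil (hp _ cS)) mul0r.
  by rewrite (supp_dl0 sg nc) cmul0r.
have -> : dyn (phi b) = (th b)%:~R *: phi b.
  rewrite (dyn_free (hp _ bS)); apply: serP => w; rewrite /wsc serE.
  have [->|ne] := eqVneq (phi b w) 0; first by rewrite !mulr0.
  by rewrite (ht _ bS _ ne).
rewrite brBr; apply: serP => w; rewrite !(serBE, serE); ring.
Qed.

End Dynkin.

(** * Word length and the completed free Lie algebra *)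

Section Lengths.
Variable B : finType.
Implicit Types (f g h : series B) (w : seq B) (m n : nat).

(** The part of word length m. *)
Definition comp m f : series B := fun w => if size w == m then f w else 0.

Definition low n f := forall w, (size w < n)%N -> f w = 0.

Lemma comp_linear m (a : rat) f g : comp m (a *: f + g) = a *: comp m f + comp m g.
Proof.
by apply: serP => w; rewrite !serE /comp; case: eqP; rewrite ?mulr0 ?addr0.
Qed.
HB.instance Definition _ m :=
  GRing.isLinear.Build rat (series B) (series B) _ (comp m) (comp_linear m).

Lemma wdeg1 w : wdeg (fun=> 1) w = (size w)%:Z.
Proof. by elim: w => [|c w IH]; rewrite ?wdeg_nil // wdeg_cons IH /=; lia. Qed.

Lemma comp_id m f : homog (fun=> 1) m%:Z f -> comp m f = f.
Proof.
move=> hf; apply: serP => w; rewrite /comp; case: eqP => // ne.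
by rewrite (homog0 hf) // wdeg1; apply/eqP => -[].
Qed.

Lemma comp_size m f : homog (fun=> 1) m%:Z (comp m f).
Proof. by apply: homogP => w; rewrite wdeg1 /comp; case: (size w =P m) => // ->; rewrite eqxx. Qed.

Lemma comp_homog wt k m f : homog wt k f -> homog wt k (comp m f).
Proof.
by move=> hf; apply: homogP => w nk; rewrite /comp (homog0 hf nk); case: eqP.
Qed.

Lemma comp_supp S m f : supp S f -> supp S (comp m f).
Proof. by move=> sf w; rewrite /comp; case: (size w == m) => //; exact: sf. Qed.

Lemma comp_comp m n f : comp m (comp n f) = if m == n then comp n f else 0.
Proof.
apply: serP => w; rewrite /comp.
case: (m =P n) => [->|ne]; first by case: eqP.
by case: eqP => // ->; case: eqP.
Qed.

Lemma low_lin n (a : rat) f g : low n f -> low n g -> low n (a *: f + g).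
Proof. by move=> lf lg w h; rewrite !serE lf // lg // mulr0 addr0. Qed.
Lemma lowD n f g : low n f -> low n g -> low n (f + g).
Proof. by move=> lf lg w h; rewrite serE lf // lg // addr0. Qed.
Lemma lowB n f g : low n f -> low n g -> low n (f - g).
Proof. by move=> lf lg w h; rewrite serBE lf // lg // subr0. Qed.
Lemma lowZ n (a : rat) f : low n f -> low n (a *: f).
Proof. by move=> lf w h; rewrite serE lf // mulr0. Qed.
Lemma low_sum n (I : Type) (r : seq I) (P : pred I) (F : I -> series B) :
  (forall a : I, P a -> low n (F a)) -> low n (\sum_(a <- r | P a) F a).
Proof.
by move=> h; apply: (big_ind (low n)) => // f g; apply: lowD.
Qed.
Lemma low_le m n f : (m <= n)%N -> low n f -> low m f.
Proof. by move=> mn lf w h; apply: lf; apply: leq_trans mn. Qed.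
Lemma low1 f : f [::] = 0 -> low 1 f.
Proof. by move=> f0 [|c w]. Qed.
Lemma low_all f : (forall n, low n f) -> f = 0.
Proof. by move=> h; apply: serP => w; apply: (h (size w).+1). Qed.
Lemma low_eq f g : (forall n, low n (f - g)) -> f = g.
Proof. by move=> h; apply/eqP; rewrite -subr_eq0; apply/eqP/low_all. Qed.

Lemma low_mul m n f g : low m f -> low n g -> low (m + n) (f ** g).
Proof.
move=> lf lg w h; rewrite mulE big1 // => l _.
have lw : (l <= size w)%N by rewrite -ltnS.
case: (ltnP l m) => lm; first by rewrite lf ?mul0r // size_takel.
by rewrite lg ?mulr0 // size_drop; lia.
Qed.

Lemma low_br deg m n f g : low m f -> low n g -> low (m + n) (ser_br deg f g).
Proof.
move=> lf lg w h; rewrite /ser_br big1 // => l _ /=.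
have lw : (l <= size w)%N by rewrite -ltnS.
have -> : f (take l w) * g (drop l w) = 0.
  case: (ltnP l m) => lm; first by rewrite lf ?mul0r // size_takel.
  by rewrite lg ?mulr0 // size_drop; lia.
have -> : g (take l w) * f (drop l w) = 0.
  case: (ltnP l n) => lm; first by rewrite lg ?mul0r // size_takel.
  by rewrite lf ?mulr0 // size_drop; lia.
by rewrite mulr0 subr0.
Qed.

Lemma low_comp m n f : (n <= m)%N -> low n (comp m f).
Proof.
by move=> nm w h; rewrite /comp; case: eqP => // e; move: h; rewrite e; lia.
Qed.

Lemma comp_low m n f : (m < n)%N -> low n f -> comp m f = 0.
Proof.
by move=> mn lf; apply: serP => w; rewrite /comp; case: eqP => // e; rewrite lf // e.
Qed.

Lemma low_homog n f : homog (fun=> 1) n%:Z f -> low n f.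
Proof. by move=> hf; rewrite -(comp_id hf); apply: low_comp. Qed.

Lemma low_rest n f : low n f -> low n.+1 (f - comp n f).
Proof.
move=> lf w; rewrite ltnS leq_eqVlt => /orP[/eqP e|h].
  by rewrite serBE /comp e eqxx subrr.
by rewrite serBE (lf w h) (@low_comp n n f (leqnn n) w h) subr0.
Qed.

Definition trunc n f : series B := \sum_(m < n) comp m f.

Lemma truncE n f w : trunc n f w = if (size w < n)%N then f w else 0.
Proof.
rewrite /trunc ser_sumE; case: ltnP => h.
  rewrite (bigD1 (Ordinal h)) //= {1}/comp eqxx big1 ?addr0 // => i ni.
  by rewrite /comp; case: eqP => // e; case/negP: ni; apply/eqP/val_inj.
by rewrite big1 // => i _; rewrite /comp; case: eqP => // e; have := ltn_ord i; lia.
Qed.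

Lemma low_trunc n f : low n (f - trunc n f).
Proof. by move=> w h; rewrite serBE truncE h subrr. Qed.

Lemma comp_br deg m f g :
  comp m (ser_br deg f g) = \sum_(i < m.+1) ser_br deg (comp i f) (comp (m - i) g).
Proof.
apply: serP => w; rewrite ser_sumE {1}/comp.
case: (size w =P m) => [e|ne].
  rewrite /ser_br exchange_big /=; apply: eq_bigr => l _.
  have lw : (l <= size w)%N by rewrite -ltnS.
  have lm : (l < m.+1)%N by rewrite ltnS -e.
  have sd : size (drop l w) = (m - l)%N by rewrite size_drop; congr (_ - _)%N.
  have -> : f (take l w) * g (drop l w) =
     \sum_(i < m.+1) comp i f (take l w) * comp (m - i) g (drop l w).
    rewrite (bigD1 (Ordinal lm)) //= /comp sd size_takel // !eqxx.
    rewrite big1 ?addr0 // => i ni.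
    by case: eqP => [e1|]; rewrite ?mul0r //; case/negP: ni; apply/eqP/val_inj.
  have ml : (m - l < m.+1)%N by rewrite ltnS leq_subr.
  have -> : g (take l w) * f (drop l w) =
     \sum_(i < m.+1) comp (m - i) g (take l w) * comp i f (drop l w).
    rewrite (bigD1 (Ordinal ml)) //= /comp sd size_takel // subKn; last by rewrite -ltnS.
    rewrite !eqxx big1 ?addr0 // => i ni.
    have [e1|e1] := eqVneq (m - l)%N i; rewrite ?mulr0 //.
    by case/negP: ni; apply/eqP/val_inj.
  by rewrite mulr_sumr -sumrB.
rewrite big1 // => i _; have im : (i <= m)%N by rewrite -ltnS.
have hh := br_homog (deg := deg) (@comp_size i f) (@comp_size (m - i)%N g).
rewrite (homog0 hh) // wdeg1.
by apply/eqP => e; apply: ne; lia.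
Qed.

Lemma size1E f : homog (fun=> 1) 1 f -> f = \sum_c f [:: c] *: gen c.
Proof.
move=> hf; apply: serP => -[|b [|e w]]; rewrite ser_sumE.
- rewrite (homog0 hf) ?wdeg_nil // big1 // => c _; by rewrite serE mulr0.
- rewrite (bigD1 b) //= serE /gen eqxx mulr1 big1 ?addr0 // => c nc.
  by rewrite serE eqseq_cons eq_sym (negPf nc) mulr0.
- rewrite (homog0 hf) ?wdeg1 // big1 // => c _.
  by rewrite serE /gen eqseq_cons andbF mulr0.
Qed.

End Lengths.

Section CompletedFree.
Variables (B : finType) (deg : B -> int) (S : {set B}).
Implicit Types (f g h : series B) (w : seq B) (m n : nat) (i j k : int).
Local Notation br := (ser_br deg).
Local Notation free := (free_hom deg S).
Local Notation cfree := (cfree_hom deg S).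

Lemma free_comp k m f : free k f -> free k (comp m f).
Proof.
move=> ff; elim: ff m => {k f} [b bS|k|k a f g _ hf _ hg|i j f g Ff hf Fg hg] m.
- have [->|ne] := eqVneq m 1%N.
    by rewrite (comp_id (homog_gen (fun=> 1) (b := b))); apply: free_gen.
  have -> : comp m (gen b) = 0.
    apply: serP => w; rewrite /comp /gen; case: eqP => // e.
    by case: (w =P [:: b]) => // e'; case/negP: ne; rewrite -e e'.
  exact: free_zero.
- by rewrite linear0; apply: free_zero.
- by rewrite linearP /=; apply: free_lin.
- by rewrite comp_br; apply: free_sum => l _; apply: free_br.
Qed.

Lemma span_sum (E : lmodType rat) (A : set E) (I : Type) (r : seq I) (F : I -> E) :
  (forall a : I, A (F a) \/ F a = 0) -> span A (\sum_(a <- r) F a).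
Proof.
move=> h; elim: r => [|a r IH]; first by rewrite big_nil; apply: span_zero.
rewrite big_cons; case: (h a) => [Aa|->]; last by rewrite add0r.
by rewrite -[F a]scale1r; apply: span_lin.
Qed.

(** The Dynkin operator produces iterated brackets of n letters. *)
Lemma lcs_dynn n k f : supp S f -> homog deg k f ->
  lcs (L := free_lie deg S) n k (dynn deg (fun=> 1) n f).
Proof.
case: n => [|n]; first by move=> *; apply: free_zero.
elim: n k f => [|n IH] k f sf hf; first exact: dynn_free.
rewrite (_ : dynn deg (fun=> 1) n.+2 f =
   \sum_b br (gen b) (dynn deg (fun=> 1) n.+1 (dl b f))); last by rewrite /= add0r.
apply: span_sum => b; have [bS|nb] := boolP (b \in S); last first.
  by right; rewrite (supp_dl0 sf nb) linear0 br0r.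
left; exists (deg b), (k - deg b), (gen b), (dynn deg (fun=> 1) n.+1 (dl b f)).
split => //; first by ring.
- exact: free_gen.
- by apply: IH; [exact: supp_dl|exact: homog_dl].
Qed.

Lemma dynn_local th n f g :
  (forall w, size w = n -> f w = g w) -> dynn deg th n f = dynn deg th n g.
Proof.
elim: n f g => [//|n IH] f g h /=; congr (_ + _).
  case: n h {IH} => [|//] h; apply: eq_bigr => b _; by rewrite h.
by apply: eq_bigr => b _; rewrite (IH _ (dl b g)) // => w sw; apply: h; rewrite /= sw.
Qed.

Lemma dyn_local th f g w :
  (forall u, size u = size w -> f u = g u) -> dyn deg th f w = dyn deg th g w.
Proof. by move=> h; rewrite /dyn (dynn_local _ h). Qed.

Lemma lcs_comp n k f : free k (comp n f) ->
  lcs (L := free_lie deg S) n k (comp n f).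
Proof.
case: n => [|n] //.
set u := comp n.+1 f => fu.
have e : dynn deg (fun=> 1) n.+1 (n.+1%:R^-1 *: u) = u.
  apply: serP => w; have [sw|nw] := eqVneq (size w) n.+1.
    rewrite -[n.+1]sw -[LHS]/(dyn deg (fun=> 1) _ w) linearZZ /= (dyn_free _ fu).
    by rewrite serE /wsc wdeg1 sw mulKf // pnatr_eq0.
  rewrite {2}/u /comp (negPf nw).
  have h : homog (fun=> 1) (n.+1)%:Z (n.+1%:R^-1 *: u).
    by apply/homogZ/comp_size.
  by rewrite (homog0 (dynn_homog h)) // wdeg1; apply: contra_neq nw => -[].
rewrite -e; apply: lcs_dynn; first by rewrite -[_ *: _]addr0;
  apply: supp_lin; [exact: free_supp fu|exact: supp_zero].
exact/homogZ/(free_homog fu).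
Qed.

(** A Lie polynomial which is homogeneous of length n lies in the n-th term of
    the lower central series (lcs_comp), so the truncations of a series with
    Lie components represent a point of the completion. *)
Lemma cfreeP k f : cfree k f <-> forall m, free k (comp m f).
Proof.
split=> [[x [hx _ hw]] m|h].
  suff -> : comp m f = comp m (x m.+1) by apply: free_comp; exact: hx.
  by apply: serP => w; rewrite /comp; case: eqP => // e; apply: hw; rewrite e.
exists (fun n => trunc n f); split => [n|n|n w sw].
- by apply: free_sum.
- rewrite [X in lcs _ _ X](_ : _ = comp n f); first exact: lcs_comp.
  by rewrite /trunc big_ord_recr /= addrAC subrr add0r.
- by rewrite truncE sw.
Qed.

Lemma cfree_comp k m f : cfree k f -> free k (comp m f).
Proof. by move/cfreeP. Qed.

Lemma free_cfree k f : free k f -> cfree k f.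
Proof. by move=> hf; apply/cfreeP => m; apply: free_comp. Qed.

Lemma cfree_trunc n k f : cfree k f -> free k (trunc n f).
Proof. by move=> /cfreeP h; apply: free_sum. Qed.

Lemma comp_self (m : nat) f w : size w = m -> comp m f w = f w.
Proof. by rewrite /comp => ->; rewrite eqxx. Qed.

Lemma cfree_homog k f : cfree k f -> homog deg k f.
Proof.
move=> /cfreeP h w nz; apply: (free_homog (h (size w))).
by rewrite comp_self.
Qed.

Lemma cfree_supp k f : cfree k f -> supp S f.
Proof.
move=> /cfreeP h w nz; apply: (free_supp (h (size w))).
by rewrite comp_self.
Qed.

Lemma cfree_low k f : cfree k f -> low 1 f.
Proof.
move=> /cfreeP h; apply: low1.
by rewrite -(@comp_self 0 f) //; apply: (free_nil (h 0%N)).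
Qed.

Lemma cfree_zero k : cfree k 0.
Proof. exact/free_cfree/free_zero. Qed.

Lemma cfree_lin k (a : rat) f g : cfree k f -> cfree k g -> cfree k (a *: f + g).
Proof.
move=> /cfreeP hf /cfreeP hg; apply/cfreeP => m; rewrite linearP /=.
exact: free_lin.
Qed.

Lemma cfreeD k f g : cfree k f -> cfree k g -> cfree k (f + g).
Proof. by move=> hf hg; rewrite -[f]scale1r; apply: cfree_lin. Qed.
Lemma cfreeZ k (a : rat) f : cfree k f -> cfree k (a *: f).
Proof. by move=> hf; rewrite -[_ *: _]addr0; apply: cfree_lin => //; apply: cfree_zero. Qed.
Lemma cfreeB k f g : cfree k f -> cfree k g -> cfree k (f - g).
Proof. by move=> hf hg; rewrite -scaleN1r; apply/cfreeD/cfreeZ. Qed.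
Lemma cfree_sum k (I : Type) (r : seq I) (P : pred I) (F : I -> series B) :
  (forall a : I, P a -> cfree k (F a)) -> cfree k (\sum_(a <- r | P a) F a).
Proof.
move=> h; apply: (big_ind (cfree k)) => //; [exact: cfree_zero|exact: cfreeD].
Qed.

Lemma cfree_br i j f g : cfree i f -> cfree j g -> cfree (i + j) (br f g).
Proof.
move=> /cfreeP hf /cfreeP hg; apply/cfreeP => m; rewrite comp_br.
by apply: free_sum => l _; apply: free_br.
Qed.

Lemma cfree_dyn th k f : supp S f -> homog deg k f -> cfree k (dyn deg th f).
Proof.
move=> sf hf; apply/cfreeP => m.
rewrite (_ : comp m _ = comp m (dynn deg th m f)).
  exact/free_comp/dynn_free.
by apply: serP => w; rewrite /comp; case: eqP => // <-.
Qed.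

Lemma lcs_cfree n k f : lcs (L := cfree_lie deg S) n k f -> cfree k f /\ low n f.
Proof.
case: n => [|n]; first by move=> h; split.
elim: n k f => [|n IH] k f; first by move=> h; split; last exact: cfree_low h.
elim => [|a x y [i [j [u [v [e hu hv ->]]]]] _ [cy ly]].
  by split; first exact: cfree_zero.
have [cv lv] := IH _ _ hv; have lu := cfree_low hu.
split; first by apply: cfree_lin => //; rewrite -e; apply: cfree_br.
by apply: low_lin => //; apply: (low_br _ lu lv).
Qed.

(** Since there are finitely many letters, the Dynkin operator writes a Lie
    series without terms of length < n as a finite sum of brackets of letters
    with Lie series without terms of length < n - 1. Hence the lower central
    series of the completion is the filtration by the word length. *)
Lemma cfree_lcs n k f : cfree k f -> low n f -> lcs (L := cfree_lie deg S) n k f.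
Proof.
case: n => [|n] //; elim: n k f => [//|n IH] k f cf lf.
pose f' : series B := fun w => (size w)%:R^-1 * f w.
have sf : supp S f.
  exact: cfree_supp cf.
have hf : homog deg k f by apply: cfree_homog cf.
have sf' : supp S f' by move=> w nz; apply: sf; apply: contra_neq nz => e; rewrite /f' e mulr0.
have hf' : homog deg k f' by move=> w nz; apply: hf; apply: contra_neq nz => e; rewrite /f' e mulr0.
have lf' : low n.+2 f' by move=> w h; rewrite /f' lf // mulr0.
have e : f = dyn deg (fun=> 1) f'.
  apply: serP => w.
  rewrite (@dyn_local _ _ ((size w)%:R^-1 *: comp (size w) f)) => [|u su]; last first.
    by rewrite serE /f' su comp_self.
  rewrite linearZZ /= (dyn_free _ (cfree_comp _ cf)) serE /wsc wdeg1 comp_self //.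
  have [s0|s0] := eqVneq (size w) 0%N; first by rewrite lf ?mulr0 // s0.
  by rewrite mulKf // pnatr_eq0.
rewrite e dynE big1 ?add0r => [|b _]; last by rewrite lf' // mulr0 scale0r.
apply: span_sum => b; have [bS|nb] := boolP (b \in S); last first.
  by right; rewrite (supp_dl0 sf' nb) (linear0 (dyn deg (fun=> 1))) br0r.
left; exists (deg b), (k - deg b), (gen b), (dyn deg (fun=> 1) (dl b f')).
split => //; first by ring.
- exact/free_cfree/free_gen.
- apply: IH; first by apply: cfree_dyn; [exact: supp_dl|exact: homog_dl].
  move=> w sw; rewrite (@dyn_local _ _ 0) => [|u su].
    by rewrite (linear0 (dyn deg (fun=> 1))).
  by apply: lf'; rewrite /= su.
Qed.

(** The topology of the lower central series is that of the word length. *)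
Lemma sums_toP k (u : nat -> series B) y : (forall l, cfree k (u l)) ->
  sums_to (L := cfree_lie deg S) k u y <->
  cfree k y /\ (forall n, exists N0, forall N, (N0 <= N)%N ->
                 low n (y - \sum_(0 <= l < N) u l)).
Proof.
move=> hu; split=> -[cy h]; split => // n; have [N0 hN] := h n; exists N0 => N le.
  by have /lcs_cfree[] := hN N le.
by apply: cfree_lcs; [apply/cfreeB => //; apply: cfree_sum|exact: hN].
Qed.

End CompletedFree.

Section ExtendedLetterMap.
Variables (B C : finType) (degB : B -> int) (degC : C -> int) (h : B -> C).

Lemma ser_mapE f : ser_map h f = alg (fun b c => (c == h b)%:R) f.
Proof.
apply: serP => w; rewrite /ser_map /alg; elim: w f => [|c w IH] f /=.
  rewrite (big_pred1 [tuple]) // => u.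
  by rewrite [u]tuple0 /= !eqxx.
pose F (p : B * (size w).-tuple B) : (size w).+1.-tuple B := cons_tuple p.1 p.2.
rewrite (reindex F) /=; last first.
  exists (fun u => (thead u, behead_tuple u)) => [[b u] _|u _].
    by rewrite /F theadE; congr (_, _); apply: val_inj.
  by rewrite /F [u in RHS]tuple_eta; apply: val_inj.
rewrite (eq_bigl (fun p : B * (size w).-tuple B => (c == h p.1) && (map h p.2 == w))); last first.
  by move=> p; rewrite /= eqseq_cons eq_sym.
rewrite -(pair_big_dep (fun b => c == h b) (fun b (u : (size w).-tuple B) => map h u == w)
   (fun b u => f (b :: u))) /=.
rewrite big_mkcond; apply: eq_bigr => b _.
by case: (c =P h b) => _; rewrite ?mul0r // mul1r -IH.
Qed.

End ExtendedLetterMap.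

(** * Differentials of complete free Lie algebras *)

Section Differentials.
Variables (B : finType) (deg : B -> int) (S : {set B}).
Implicit Types (f g h : series B) (w : seq B) (m n : nat) (i j k : int).
Implicit Types (phi : B -> series B).
Local Notation br := (ser_br deg).
Local Notation der := (der deg).
Local Notation cfree := (cfree_hom deg S).

Lemma der_low r m phi f :
  (forall b, b \in S -> low r.+1 (phi b)) -> supp S f -> low m f ->
  low (m + r) (der phi f).
Proof.
move=> hp; rewrite /der /skew => sf lf w; elim: w m f sf lf => [|c w IH] m f sf lf h.
  rewrite /= addr0 ser_sumE big1 // => b _.
  have [bS|nb] := boolP (b \in S); last by rewrite (supp_dl0 sf nb) cmul0r.
  by rewrite mul_nil (hp _ bS) ?mul0r.
have ld b : low m.-1 (dl b f) by move=> u hu; apply: lf => /=; lia.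
rewrite /= ser_sumE big1 => [|b _]; last first.
  have [bS|nb] := boolP (b \in S); last by rewrite (supp_dl0 sf nb) cmul0r.
  by apply: (low_mul (hp _ bS) (ld b)); move: h => /=; lia.
rewrite add0r big1 // => b _.
by rewrite (IH m.-1) ?mulr0 //; [exact: supp_dl|move: h => /=; lia].
Qed.

Lemma der_low0 m phi f :
  (forall b, b \in S -> low 1 (phi b)) -> supp S f -> low m f ->
  low m (der phi f).
Proof. by move=> h1 h2 h3; rewrite -[m]addn0; apply: der_low. Qed.

Lemma der_cfree phi k f : (forall b, b \in S -> cfree (deg b - 1) (phi b)) ->
  cfree k f -> cfree (k - 1) (der phi f).
Proof.
move=> hp cf.
have hfree k' f' : free_hom deg S k' f' -> cfree (k' - 1) (der phi f').
  elim => {k' f'} [b bS|k'|k' a f' g _ hf _ hg|i j f' g Ff hf Fg hg].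
  - by rewrite der_gen; apply: hp.
  - by rewrite linear0; apply: cfree_zero.
  - by rewrite linearP /=; apply: cfree_lin.
  - have h1 := free_homog Ff; have h2 := free_homog Fg.
    rewrite (der_br h1 h2 (cfree_homog hf) (cfree_homog hg)).
    apply: cfreeD.
      have -> : i + j - 1 = (i - 1) + j by ring.
      by apply: cfree_br => //; apply: free_cfree.
    apply: cfreeZ.
    have -> : i + j - 1 = i + (j - 1) by ring.
    by apply: cfree_br => //; apply: free_cfree.
apply/cfreeP => m.
have hp1 b : b \in S -> low 1 (phi b) by move=> bS; apply: cfree_low (hp _ bS).
have -> : comp m (der phi f) = comp m (der phi (trunc m.+1 f)).
  apply/eqP; rewrite -subr_eq0 -linearB /= -(linearB (der phi)) /=; apply/eqP.
  apply: (comp_low (n := m.+1)) => //; apply: der_low0 => //; last exact: low_trunc.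
  by apply: (cfree_supp (deg := deg) (k := k)); apply: cfreeB => //; apply/free_cfree/cfree_trunc.
by apply: cfree_comp; apply: hfree; apply: cfree_trunc.
Qed.

(** On Lie polynomials this is the Leibniz rule. The Leibniz rule also makes D
    preserve the lower central series, which is the filtration by the word
    length, so D is continuous and the equality extends to all Lie series. *)
Lemma dg_der (D : series B -> series B) k f :
  is_dgLie (@DgLie (cfree_lie deg S) D) -> cfree k f ->
  D f = der (fun b => D (gen b)) f.
Proof.
case=> _ /= hdeg hlin hder _ cf; set phi := fun b => D (gen b).
have hphi b : b \in S -> cfree (deg b - 1) (phi b).
  by move=> bS; apply: hdeg; apply/free_cfree/free_gen.
have D0 : D 0 = 0.
  have := hlin 0 1 0 0 (cfree_zero deg S 0) (cfree_zero deg S 0).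
  rewrite scaler0 addr0 scale1r => /eqP.
  by rewrite addrC -subr_eq subrr eq_sym => /eqP.
have hfree k' f' : free_hom deg S k' f' -> D f' = der phi f'.
  elim => {k' f'} [b bS|k'|k' a f' g Ff hf Fg hg|i j f' g Ff hf Fg hg].
  - by rewrite der_gen.
  - by rewrite D0 linear0.
  - rewrite (hlin k') ?linearP /= ?hf ?hg //; exact: free_cfree.
  - have cf' := free_cfree Ff; have cg := free_cfree Fg.
    rewrite (hder i j) // hf hg (der_br (free_homog Ff) (free_homog Fg)) //.
    + exact: cfree_homog (der_cfree hphi cf').
    + exact: cfree_homog (der_cfree hphi cg).
have hlow m k' f' : cfree k' f' -> low m f' -> low m (D f').
  move=> cf' lf'; have := cfree_lcs cf' lf'.
  case: m {lf' cf'} => [|m]; first by [].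
  elim: m k' f' => [|m IH] k' f'; first by move=> /hdeg; apply: cfree_low.
  suff: lcs (L := cfree_lie deg S) m.+2 k' f' -> cfree k' f' /\ low m.+2 (D f').
    by move=> h /h[].
  elim => [|a x y [i [j [u [v [e hu hv ->]]]]] _ [cy ly]].
    by rewrite D0; split; first exact: cfree_zero.
  have {}hv : lcs (L := cfree_lie deg S) m.+1 j v := hv.
  have [cv lv] := lcs_cfree hv.
  have cb : cfree k' (br u v) by rewrite -e; apply: cfree_br.
  split; first exact: cfree_lin.
  rewrite (hlin k') // (hder i j) //; apply: low_lin => //.
  apply: lowD; first exact: (low_br _ (cfree_low (hdeg _ _ hu)) lv).
  by apply: lowZ; apply: (low_br _ (cfree_low hu) (IH _ _ hv)).
have hp1 b : b \in S -> low 1 (phi b) by move=> bS; apply: cfree_low (hphi _ bS).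
apply: low_eq => m.
have ct := cfree_trunc m cf.
have cr : cfree k (f - trunc m f) by apply/cfreeB/free_cfree.
have {1}-> : f = 1 *: (f - trunc m f) + trunc m f by rewrite scale1r subrK.
rewrite (hlin k) // ?(hfree _ _ ct) ?scale1r; last exact: free_cfree.
have -> : D (f - trunc m f) + der phi (trunc m f) - der phi f =
          D (f - trunc m f) - der phi (f - trunc m f).
  by rewrite (linearB (der phi)) opprB addrA.
apply: lowB; first by apply: hlow cr _; apply: low_trunc.
by apply: der_low0 => //; [exact: cfree_supp cr|exact: low_trunc].
Qed.

Section LeadingTerms.
Variable phi : B -> series B.
Hypothesis phi_cfree : forall b, b \in S -> cfree (deg b - 1) (phi b).
Definition phi1 b := comp 1 (phi b).
Definition phi2 b := comp 2 (phi b).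

Lemma phi_low b : b \in S -> low 1 (phi b).
Proof. by move=> bS; apply: cfree_low (phi_cfree bS). Qed.

Lemma phi1_free b : b \in S -> free_hom deg S (deg b - 1) (phi1 b).
Proof. by move=> bS; apply: cfree_comp (phi_cfree bS). Qed.

Lemma phi2_free b : b \in S -> free_hom deg S (deg b - 1) (phi2 b).
Proof. by move=> bS; apply: cfree_comp (phi_cfree bS). Qed.

Lemma comp_der psi r n f : (forall b, homog (fun=> 1) r.+1%:Z (psi b)) ->
  supp S f -> comp (n + r) (der psi f) = der psi (comp n f).
Proof.
move=> hp sf.
have hs m : comp (m + r) (der psi (comp m f)) = der psi (comp m f).
  apply: comp_id; rewrite PoszD.
  apply: der_homog (comp_supp sf) (@comp_size _ m f) => b _.
  by have -> : 1 + r%:Z = r.+1%:Z by lia.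
have -> : f = trunc n f + (comp n f + (f - trunc n.+1 f)).
  by rewrite /trunc big_ord_recr /= addrA addrC subrK.
set g := f - _.
have sg : supp S g by apply: suppB => //; apply: supp_sum => i _; apply: comp_supp.
have lg : low n.+1 g by apply: low_trunc.
have lg' : low (n.+1 + r) (der psi g).
  by apply: der_low sg lg => b _; apply: low_homog.
have e0 (i : 'I_n) : (n == i) = false by apply/negP => /eqP e; have := ltn_ord i; lia.
clearbody g; rewrite !linearD /= hs (comp_low _ lg') ?addSn // addr0.
rewrite (comp_low _ lg) // linear0 addr0 comp_comp eqxx.
rewrite /trunc !linear_sum /= !big1 ?add0r // => i _.
  by rewrite comp_comp e0 linear0.
by rewrite -hs comp_comp eqn_add2r e0.
Qed.

Lemma comp_der1 n f : supp S f -> comp n (der phi1 f) = der phi1 (comp n f).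
Proof.
by move=> sf; rewrite -[n in LHS]addn0; apply: comp_der => // b; apply: comp_size.
Qed.

Lemma comp_der2 n f : supp S f -> comp n.+1 (der phi2 f) = der phi2 (comp n f).
Proof.
by move=> sf; rewrite -addn1; apply: comp_der => // b; apply: comp_size.
Qed.

(** The first two terms of the differential; the rest raises the length by at
    least two. *)
Lemma der_split f : supp S f ->
  exists2 g, der phi f = der phi1 f + der phi2 f + g &
    forall m, low m f -> low m.+2 g.
Proof.
move=> sf; pose phi3 b := phi b - phi1 b - phi2 b.
exists (der phi3 f).
  rewrite -!der_phiD; apply: (@der_ext _ deg S) => // b _.
  by apply: serP => w; rewrite /phi3 !(serBE, serE); ring.
move=> m lf; rewrite -addn2; apply: der_low sf lf => b bS w sw.
have h1 : low 2 (phi b - phi1 b) by apply: low_rest; apply: phi_low.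
have h2 := low_rest h1.
have -> : phi3 b = (phi b - phi1 b) - comp 2 (phi b - phi1 b).
  by rewrite /phi3 linearB /= /phi1 comp_comp subr0.
exact: h2.
Qed.

Lemma comp_der_lead n f : supp S f -> low n f ->
  comp n (der phi f) = der phi1 (comp n f).
Proof.
move=> sf lf; have [g -> hg] := der_split sf.
rewrite !linearD /= comp_der1 // (comp_low _ (hg _ lf)) // addr0.
have h1 b : b \in S -> low 2 (phi2 b) by move=> _; apply: low_comp.
have := der_low h1 sf lf; rewrite addn1 => l2.
by rewrite (comp_low _ l2) // addr0.
Qed.

Lemma comp_der_next n f : supp S f -> low n f ->
  comp n.+1 (der phi f) = der phi1 (comp n.+1 f) + der phi2 (comp n f).
Proof.
move=> sf lf; have [g -> hg] := der_split sf.
rewrite !linearD /= comp_der1 // comp_der2 // (comp_low _ (hg _ lf)) // addr0 //.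
Qed.

Hypothesis phi_sq0 : forall b, b \in S -> der phi (phi b) = 0.

Lemma phi1_sq0 b : b \in S -> der phi1 (phi1 b) = 0.
Proof.
move=> bS; rewrite -comp_der_lead ?phi_sq0 ?linear0 //.
  exact: cfree_supp (phi_cfree bS).
exact: phi_low.
Qed.

Lemma phi12_anticomm b : b \in S -> der phi1 (phi2 b) + der phi2 (phi1 b) = 0.
Proof.
move=> bS; rewrite -comp_der_next ?phi_sq0 ?linear0 //.
  exact: cfree_supp (phi_cfree bS).
exact: phi_low.
Qed.

End LeadingTerms.

(** The mixed terms of the Leibniz rules of a derivation of degree -1 and of a
    skew derivation of odd degree cancel because of the signs. *)
Lemma der_skew_anticomm phi psi chi N j : odz j ->
  (forall b, b \in S -> homog deg (deg b - 1) (phi b)) ->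
  (forall b, b \in S -> homog deg (deg b + j) (psi b)) ->
  (forall b, b \in S -> homog deg (deg b) (lin N b)) ->
  (forall b, b \in S -> der phi (lin N b) = alg N (phi b)) ->
  (forall b, b \in S -> der phi (psi b) + skew (tw deg N) psi (phi b) = chi b) ->
  forall f, supp S f ->
  der phi (skew (tw deg N) psi f) + skew (tw deg N) psi (der phi f) = skew N chi f.
Proof.
move=> oj hphi hpsi hN hd hchi; rewrite /der.
have sgn2 b (f : series B) : (-1 : rat) ^ deg b *: ((-1 : rat) ^ deg b *: f) = f.
  by rewrite scalerA signzE -expr2 sqrr_sign scale1r.
apply: skew_anticomm => b bS; last exact: hchi.
- rewrite lin_tw lin_idm linearZZ /= skew_gen (alg_tw _ (hpsi _ bS)) alg_idm.
  rewrite -scalerDl !sgnE oj; case: (odz _); rewrite /= ?expr0 ?expr1 ?addNr ?subrr ?scale0r //.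
- rewrite lin_tw linearZZ /= (alg_tw _ (hphi _ bS)) -/(der phi _) hd //.
  rewrite -scalerDl !sgnE; case: (odz _); rewrite /= ?expr0 ?expr1 ?addNr ?subrr ?scale0r //.
- by rewrite lin_tw linearZZ /= (alg_tw _ (hN _ bS)) alg_idm sgn2.
- by rewrite !lin_tw lin_idm linearZZ /= alg_gen lin_tw sgn2.
Qed.

Lemma der_anticomm phi psi :
  (forall b, b \in S -> homog deg (deg b - 1) (phi b)) ->
  (forall b, b \in S -> homog deg (deg b - 1) (psi b)) ->
  (forall b, b \in S -> der phi (psi b) + der psi (phi b) = 0) ->
  forall f, supp S f -> der phi (der psi f) + der psi (der phi f) = 0.
Proof.
move=> h1 h2 h3 f sf; rewrite -(skew_phi0 (@idm B) f).
apply: (der_skew_anticomm (j := -1)) sf => // b bS.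
- by rewrite lin_idm; apply: homog_gen.
- by rewrite lin_idm der_gen alg_idm.
Qed.

Lemma der_sq0 phi :
  (forall b, b \in S -> homog deg (deg b - 1) (phi b)) ->
  (forall b, b \in S -> der phi (phi b) = 0) ->
  forall f, supp S f -> der phi (der phi f) = 0.
Proof.
move=> h1 h2 f sf.
have /eqP : der phi (der phi f) + der phi (der phi f) = 0.
  by apply: (der_anticomm h1 h1 _ sf) => b bS; rewrite h2 // addr0.
by rewrite -mulr2n -scaler_nat scaler_eq0 pnatr_eq0 /= => /eqP.
Qed.

End Differentials.

(** * The gauge action and successive approximation *)

Section Gauge.
Variables (B : finType) (deg : B -> int) (S : {set B}) (phi : B -> series B).
Implicit Types (f g h x y z p q : series B) (w : seq B) (m n : nat) (i j k : int).
Local Notation br := (ser_br deg).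
Local Notation cfree := (cfree_hom deg S).
Local Notation free := (free_hom deg S).
Local Notation dd := (der deg phi).
Hypothesis phi_cfree : forall b, b \in S -> cfree (deg b - 1) (phi b).
Hypothesis phi_sq0 : forall b, b \in S -> dd (phi b) = 0.

Lemma dd_cfree k f : cfree k f -> cfree (k - 1) (dd f).
Proof. exact: der_cfree. Qed.

Lemma dd_low m k f : cfree k f -> low m f -> low m (dd f).
Proof.
move=> cf lf; apply: (@der_low0 _ deg S) => //; last exact: cfree_supp cf.
by move=> b /phi_cfree; apply: cfree_low.
Qed.

Lemma dd_sq0 k f : cfree k f -> dd (dd f) = 0.
Proof.
move=> cf; apply: (@der_sq0 _ deg S) => //; last exact: cfree_supp cf.
by move=> b /phi_cfree; apply: cfree_homog.
Qed.

Lemma dd_br i j f g : cfree i f -> cfree j g ->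
  dd (br f g) = br (dd f) g + (-1 : rat) ^ i *: br f (dd g).
Proof.
move=> cf cg; apply: (der_br (cfree_homog cf) (cfree_homog cg)).
- exact: cfree_homog (dd_cfree cf).
- exact: cfree_homog (dd_cfree cg).
Qed.

Lemma dd_br0 j f g : cfree 0 f -> cfree j g ->
  dd (br f g) = br (dd f) g + br f (dd g).
Proof. by move=> cf cg; rewrite (dd_br cf cg) expr0z scale1r. Qed.

Lemma br_symN1 f g : cfree (-1) f -> cfree (-1) g -> br f g = br g f.
Proof.
move=> cf cg; rewrite (br_antisym (cfree_homog cf) (cfree_homog cg)).
by rewrite -scaleNr !sgnE /= expr1 opprK scale1r.
Qed.

Lemma br_anti0 j f g : cfree 0 f -> cfree j g -> br f g = - br g f.
Proof.
move=> cf cg; rewrite (br_antisym (cfree_homog cf) (cfree_homog cg)).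
by rewrite mul0r expr0z scale1r.
Qed.

Lemma br_der0 j l x f g : cfree 0 x -> cfree j f -> cfree l g ->
  br x (br f g) = br (br x f) g + br f (br x g).
Proof.
move=> cx cf cg.
rewrite (br_jacobi (cfree_homog cx) (cfree_homog cf) (cfree_homog cg)).
by rewrite mul0r expr0z scale1r.
Qed.

(** The Taylor coefficients of the path u (t) = (t x) . z, that is, of the
    solution of u' = [x, u] - d x with u (0) = z. *)
Fixpoint gs x z m : series B :=
  if m is l.+1 then
    l.+1%:R^-1 *: (br x (gs x z l) - (if l is 0%N then dd x else 0))
  else z.

(** The value of this path at t = 1. The sum is finite at each word, since gs
    x z l has no terms of length < l (gs_low, gact_low). *)
Definition gact x z : series B := fun w => \sum_(l < (size w).+1) gs x z l w.

Definition mc u := cfree (-1) u /\ dd u = - ((1 / 2 : rat) *: br u u).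

Section OneGauge.
Variables x z : series B.
Hypotheses (cx : cfree 0 x) (cz : cfree (-1) z).

Lemma gs_cfree m : cfree (-1) (gs x z m).
Proof.
elim: m => [//|m IH] /=; apply/cfreeZ/cfreeB.
  by rewrite -[-1]add0r; apply: cfree_br.
by case: m {IH} => [|m]; [rewrite -[-1]add0r; apply: dd_cfree|apply: cfree_zero].
Qed.

Lemma gs_low m : low m (gs x z m).
Proof.
elim: m => [//|m IH] /=; apply/lowZ/lowB.
  by rewrite -add1n; apply: low_br => //; apply: cfree_low cx.
by case: m {IH} => [|m] //; apply: (dd_low cx); apply: cfree_low cx.
Qed.

Lemma gact_low N : low N (gact x z - \sum_(l < N) gs x z l).
Proof.
move=> w sw; rewrite serBE ser_sumE /gact.
rewrite -(big_mkord xpredT (fun l => gs x z l w)).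
rewrite -(big_mkord xpredT (fun l => gs x z l w)).
rewrite (big_cat_nat (n := (size w).+1) (p := N)) //= big_nat_cond.
rewrite [X in _ - (_ + X)]big_nat_cond [X in _ - (_ + X)]big1 => [|l].
  by rewrite addr0 -big_nat_cond subrr.
by rewrite andbT => /andP[h _]; apply: gs_low.
Qed.

Lemma gact_cfree : cfree (-1) (gact x z).
Proof.
apply/cfreeP => m.
have -> : comp m (gact x z) = comp m (\sum_(l < m.+1) gs x z l).
  apply/eqP; rewrite -subr_eq0 -linearB /=; apply/eqP.
  by apply: (@comp_low _ m m.+1) => //; apply: gact_low.
by apply: cfree_comp; apply: cfree_sum => l _; apply: gs_cfree.
Qed.

(** The Taylor coefficients of the curvature d u + 1/2 [u, u] of the path u
    (t) = (t x) . z. *)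
Definition curv m : series B :=
  dd (gs x z m) + (1 / 2 : rat) *: \sum_(l < m.+1) br (gs x z l) (gs x z (m - l)%N).

Lemma gsS m : m.+1%:R *: gs x z m.+1 = br x (gs x z m) - (if m is 0%N then dd x else 0).
Proof. by rewrite /= scalerA divff ?scale1r // pnatr_eq0. Qed.

Lemma conv_sym m :
  \sum_(l < m.+1) br (gs x z l) (br x (gs x z (m - l)%N)) =
  \sum_(l < m.+1) br (br x (gs x z l)) (gs x z (m - l)%N).
Proof.
rewrite (reindex_inj rev_ord_inj) /=; apply: eq_bigr => l _.
rewrite subSS subKn; last by rewrite -ltnS.
apply: br_symN1; first exact: gs_cfree.
by rewrite -[-1]add0r; apply: cfree_br => //; apply: gs_cfree.
Qed.

(** The curvature is transported by ad x, so it is zero along the path if it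
    is zero at t = 0. This is why the gauge action preserves Maurer-Cartan
    elements. *)
Lemma curvS m : m.+1%:R *: curv m.+1 = br x (curv m).
Proof.
have cg := gs_cfree.
have h1 : m.+1%:R *: dd (gs x z m.+1) = br (dd x) (gs x z m) + br x (dd (gs x z m)).
  rewrite -(linearZZ (der deg phi)) /= gsS (linearB (der deg phi)) /= (dd_br0 cx (cg m)).
  by case: (m) => [|l]; rewrite ?(dd_sq0 cx) ?linear0 subr0.
have h2 : m.+1%:R *: \sum_(l < m.+2) br (gs x z l) (gs x z (m.+1 - l)%N) =
   2%:R *: (\sum_(l < m.+1) br (br x (gs x z l)) (gs x z (m - l)%N) - br (dd x) (gs x z m)).
  have e1 : \sum_(l < m.+1) br (br x (gs x z l)) (gs x z (m - l)%N) - br (dd x) (gs x z m)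
    = \sum_(l < m.+2) l%:R *: br (gs x z l) (gs x z (m.+1 - l)%N).
    rewrite [RHS]big_ord_recl scale0r add0r.
    under [RHS]eq_bigr => l _.
      rewrite lift0 subSS -brZl gsS brBl; over.
    rewrite sumrB; congr (_ - _); rewrite big_ord_recl big1 ?addr0 ?subn0 // => l _.
    by rewrite br0l.
  rewrite e1.
  have e2 : \sum_(l < m.+2) l%:R *: br (gs x z l) (gs x z (m.+1 - l)%N) =
     \sum_(l < m.+2) (m.+1 - l)%:R *: br (gs x z l) (gs x z (m.+1 - l)%N).
    rewrite (reindex_inj rev_ord_inj) /=; apply: eq_bigr => l _.
    rewrite !subSS subKn; last by rewrite -ltnS.
    by rewrite br_symN1.
  rewrite [RHS]scaler_nat mulr2n {2}e2 -big_split scaler_sumr.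
  apply: eq_bigr => l _ /=; rewrite -scalerDl -natrD subnKC //; by rewrite -ltnS.
rewrite /curv scalerDr h1 scalerA mulrC -scalerA h2 brDr brZr br_sumr.
under [in RHS]eq_bigr => l _ do rewrite (br_der0 cx (cg _) (cg _)).
rewrite [in RHS]big_split /= conv_sym; apply: serP => w.
by rewrite !(serBE, serE); field.
Qed.

Hypothesis mcz : mc z.

Lemma curv0 m : curv m = 0.
Proof.
elim: m => [|m IH]; last first.
  have := curvS m; rewrite IH br0r => /eqP.
  by rewrite scaler_eq0 pnatr_eq0 /= => /eqP.
by rewrite /curv big_ord_recl big_ord0 addr0 subnn /= mcz.2 addNr.
Qed.

Lemma tri_sum (F : nat -> nat -> series B) N :
  \sum_(m < N) \sum_(l < m.+1) F l (m - l)%N = \sum_(l < N) \sum_(m < N - l) F l m.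
Proof.
elim: N => [|N IH]; first by rewrite !big_ord0.
rewrite big_ord_recr /= IH [RHS]big_ord_recr /= subSnn big_ord1.
rewrite [X in _ + X]big_ord_recr /= subnn addrA; congr (_ + _).
rewrite -big_split; apply: eq_bigr => l _ /=.
by rewrite subSn ?big_ord_recr //= ltnW.
Qed.

Lemma gact_mc : mc (gact x z).
Proof.
split; first exact: gact_cfree.
apply/eqP; rewrite -addr_eq0; apply/eqP; apply: low_all => N.
set G := gact x z; set T := \sum_(l < N) gs x z l.
have cT : cfree (-1) T by apply: cfree_sum => l _; apply: gs_cfree.
have cG : cfree (-1) G := gact_cfree.
have lGT : low N (G - T) := @gact_low N.
have e1 : low N (dd G - dd T).
  by rewrite -(linearB (der deg phi)) /=; apply: (@dd_low _ (-1)) => //; apply: cfreeB.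
have e2 : low N (br G G - br T T).
  have -> : br G G - br T T = br (G - T) G + br T (G - T).
    by rewrite brBl brBr; apply: serP => w; rewrite !(serBE, serE); ring.
  apply: lowD.
    by apply: (low_le _ (low_br _ lGT (cfree_low cG))); lia.
  by apply: (low_le _ (low_br _ (cfree_low cT) lGT)); lia.
have e3 : dd T + (1 / 2 : rat) *: \sum_(l < N) \sum_(m < N - l) br (gs x z l) (gs x z m) = 0.
  rewrite -(tri_sum (fun l m => br (gs x z l) (gs x z m))) /T linear_sum scaler_sumr.
  by rewrite -big_split big1 // => l _; apply: curv0.
have e4 : low N (br T T - \sum_(l < N) \sum_(m < N - l) br (gs x z l) (gs x z m)).
  rewrite /T br_suml -sumrB; apply: low_sum => l _; rewrite br_sumr.
  rewrite -(big_mkord xpredT (fun m => br (gs x z l) (gs x z m))).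
  rewrite -(big_mkord xpredT (fun m => br (gs x z l) (gs x z m))).
  rewrite (big_cat_nat (n := (N - l)%N) (p := N)) //= ?leq_subr //.
  rewrite addrAC subrr add0r big_nat_cond; apply: low_sum => m /andP[/andP[h _] _].
  by apply: (low_le _ (low_br _ (@gs_low l) (@gs_low m))); lia.
have -> : dd G + (1 / 2 : rat) *: br G G =
   (dd G - dd T) + (1 / 2 : rat) *: (br G G - br T T) +
   (1 / 2 : rat) *: (br T T - \sum_(l < N) \sum_(m < N - l) br (gs x z l) (gs x z m)) +
   (dd T + (1 / 2 : rat) *: \sum_(l < N) \sum_(m < N - l) br (gs x z l) (gs x z m)).
  by apply: serP => w; rewrite !(serBE, serE); ring.
rewrite e3 addr0; apply: lowD; last exact: lowZ.
by apply: lowD => //; apply: lowZ.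
Qed.

End OneGauge.

Lemma br_diff x x' y y' : br x y - br x' y' = br (x - x') y + br x' (y - y').
Proof. by rewrite brBl brBr addrA subrK. Qed.

Lemma gs_cont m x x' z l : cfree 0 x -> cfree 0 x' -> cfree (-1) z ->
  low m (x - x') -> low m (gs x z l - gs x' z l).
Proof.
move=> cx cx' cz lxx; elim: l => [|l IH] /=; first by rewrite subrr.
rewrite -scalerBr; apply: lowZ.
pose C u := if l is 0%N then dd u else 0.
rewrite -[X in low _ X]/(br x (gs x z l) - C x - (br x' (gs x' z l) - C x')).
have -> : br x (gs x z l) - C x - (br x' (gs x' z l) - C x') =
  (br x (gs x z l) - br x' (gs x' z l)) - (C x - C x').
  by apply: serP => w; rewrite !(serBE, serE); ring.
apply: lowB; last first.
  rewrite /C; case: l {IH C} => [|l]; last by rewrite subrr.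
  by rewrite -(linearB (der deg phi)); apply: (@dd_low _ 0) => //; apply: cfreeB.
rewrite br_diff; apply: lowD.
  by apply: (low_le _ (low_br _ lxx (cfree_low (gs_cfree cx cz l)))); lia.
by apply: (low_le _ (low_br _ (cfree_low cx') IH)); lia.
Qed.

Lemma gact_cont m x x' z : cfree 0 x -> cfree 0 x' -> cfree (-1) z ->
  low m (x - x') -> low m (gact x z - gact x' z).
Proof.
move=> cx cx' cz lxx w sw; rewrite serBE /gact -sumrB big1 // => l _.
exact: gs_cont sw.
Qed.

(** First order variation of the gauge action in x. The leading term d q of
    the change may cancel in length m + 1, so the change is computed in length
    m + 2, where the terms of degree two in the pair (x, q) still contribute -
    1/2 [q, d x]. This formula stands in for the Baker-Campbell-Hausdorff
    formula. *)
Lemma gact_variation m x q z : cfree 0 x -> cfree 0 q -> cfree (-1) z ->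
  low m.+1 q -> low m.+2 (dd q) ->
  low m.+3 (gact (x + q) z - gact x z
            - (br q z - dd q - (1 / 2 : rat) *: br q (dd x))).
Proof.
move=> cx cq cz lq ldq; set x' := x + q.
have cx' : cfree 0 x' by apply: cfreeD.
have lx := cfree_low cx; have lz := cfree_low cz.
set A := br q z - dd q.
have lA : low m.+2 A.
  by apply: lowB => //; have := low_br deg lq lz; rewrite addn1.
have g1 : gs x' z 1 - gs x z 1 = A.
  rewrite /= !invr1 !scale1r /x' brDl (linearD (der deg phi)) /A /=.
  by apply: serP => w; rewrite !(serBE, serE); ring.
clearbody A.
have g1E : gs x z 1 = br x z - dd x by rewrite /= invr1 scale1r.
pose rest l := gs x' z l - gs x z l.
have restS l : (0 < l)%N -> rest l.+1 = l.+1%:R^-1 *: (br x (rest l) + br q (gs x' z l)).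
  case: l => // l _; rewrite /rest /= !subr0 -scalerBr; congr (_ *: _).
  by rewrite {1}/x' brDl brBr; apply: serP => w; rewrite !(serBE, serE); ring.
have r2 : low m.+3 (rest 2 + (1 / 2 : rat) *: br q (dd x)).
  rewrite restS // {1}/rest g1 -[gs x' z 1](subrK (gs x z 1)) g1 g1E.
  have -> : 2%:R^-1 *: (br x A + br q (A + (br x z - dd x))) +
      (1 / 2 : rat) *: br q (dd x) =
      (1 / 2 : rat) *: (br x A + br q A + br q (br x z)).
    by rewrite !brDr brNr; apply: serP => w; rewrite !(serBE, serE); field.
  apply: lowZ; apply: lowD; first apply: lowD.
  - by apply: (low_le _ (low_br _ lx lA)); lia.
  - by apply: (low_le _ (low_br _ lq lA)); lia.
  - by apply: (low_le _ (low_br _ lq (low_br _ lx lz))); lia.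
have r2' : low m.+2 (rest 2).
  rewrite -[rest 2](addrK ((1 / 2 : rat) *: br q (dd x))); apply: lowB.
    by apply: low_le r2.
  apply: lowZ; have := low_br deg lq (dd_low cx lx); by rewrite addn1.
have r3 l : low m.+3 (rest l.+3).
  elim: l => [|l IH]; rewrite restS //; apply: lowZ; apply: lowD.
  - by apply: (low_le _ (low_br _ lx r2')); lia.
  - by apply: (low_le _ (low_br _ lq (@gs_low x' z cx' 2))); lia.
  - by apply: (low_le _ (low_br _ lx IH)); lia.
  - by apply: (low_le _ (low_br _ lq (@gs_low x' z cx' l.+3))); lia.
have -> : gact x' z - gact x z - (A - (1 / 2 : rat) *: br q (dd x)) =
  (gact x' z - \sum_(l < m.+3) gs x' z l) - (gact x z - \sum_(l < m.+3) gs x z l)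
  + (\sum_(l < m.+3) rest l - (A - (1 / 2 : rat) *: br q (dd x))).
  by rewrite /rest sumrB; apply: serP => w; rewrite !(serBE, serE); ring.
apply: lowD; first by apply: lowB; apply: gact_low.
have -> : \sum_(l < m.+3) rest l = A + (rest 2 + \sum_(l < m) rest l.+3).
  by rewrite !big_ord_recl {1}/rest subrr add0r -g1.
have -> : A + (rest 2 + \sum_(l < m) rest l.+3) - (A - (1 / 2 : rat) *: br q (dd x))
   = (rest 2 + (1 / 2 : rat) *: br q (dd x)) + \sum_(l < m) rest l.+3.
  by apply: serP => w; rewrite !(serBE, serE); ring.
by apply: lowD => //; apply: low_sum => l _.
Qed.

Lemma comp_br_lead m n f g : low m f -> low n g ->
  comp (m + n) (br f g) = br (comp m f) (comp n g).
Proof.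
move=> lf lg; rewrite comp_br.
have mlt : (m < (m + n).+1)%N by rewrite ltnS leq_addr.
rewrite (bigD1 (Ordinal mlt)) //= addKn big1 ?addr0 // => l nl.
case: (ltnP l m) => lm; first by rewrite (comp_low lm lf) br0l.
have ne : l != m :> nat by apply: contraNneq nl => e; apply/eqP/val_inj.
rewrite (comp_low _ lg) ?br0r //.
by have := ltn_ord l; rewrite ltnS; lia.
Qed.

(** Let D be the sum of the quadratic part of the differential and of ad c.
    In the spectral sequence of the length filtration, w is a cycle on the
    page formed by the homology of the linear part d_1, on which D acts; the
    conclusion is that it is a boundary on this page. *)
Definition exact_at (c : series B) := forall m (w : series B),
  free (-1) w -> homog (fun=> 1) m.+2%:Z w ->
  der deg (phi1 phi) w = 0 ->
  (exists2 v, supp S v & der deg (phi2 phi) w + br c w = der deg (phi1 phi) v) ->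
  exists p q, [/\ free 0 p /\ homog (fun=> 1) m.+1%:Z p,
    free 0 q /\ homog (fun=> 1) m.+2%:Z q, der deg (phi1 phi) p = 0 &
    w = der deg (phi1 phi) q + der deg (phi2 phi) p + br c p].

Local Notation d1 := (der deg (phi1 phi)).
Local Notation d2 := (der deg (phi2 phi)).

Lemma d1_free k f : free k f -> free (k - 1) (d1 f).
Proof.
elim => {k f} [b bS|k|k a f g _ hf _ hg|i j f g Ff hf Fg hg].
- by rewrite der_gen; apply: (phi1_free phi_cfree).
- by rewrite linear0; apply: free_zero.
- by rewrite linearP /=; apply: free_lin.
- rewrite (der_br (free_homog Ff) (free_homog Fg) (free_homog hf) (free_homog hg)).
  apply: freeD.
    have -> : i + j - 1 = (i - 1) + j by ring.
    exact: free_br.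
  apply: free_scale; have -> : i + j - 1 = i + (j - 1) by ring.
  exact: free_br.
Qed.

Lemma d1_br0 j f g : free 0 f -> free j g -> d1 (br f g) = br (d1 f) g + br f (d1 g).
Proof.
move=> Ff Fg; rewrite (der_br (free_homog Ff) (free_homog Fg)) ?expr0z ?scale1r //.
- exact: free_homog (d1_free Ff).
- exact: free_homog (d1_free Fg).
Qed.

(** A gauge transformation by e changes c by d_1 e. It fixes p and replaces q
    by q - [e, p]. *)
Lemma exact_at_shift c e : free 0 e -> homog (fun=> 1) 1 e ->
  exact_at c -> exact_at (c + d1 e).
Proof.
move=> Fe he ex m w Fw hw dw [v sv hv].
have dbr : d1 (br e w) = br (d1 e) w by rewrite (d1_br0 Fe Fw) dw br0r addr0.
have [|p [q [[Fp hp] [Fq hq] dp e1]]] := ex m w Fw hw dw.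
  exists (v - br e w).
    by apply: suppB => //; apply: br_supp; [exact: free_supp Fe|exact: free_supp Fw].
  by rewrite linearB /= -hv dbr brDl addrA addrK.
have Fep : free 0 (br e p) by rewrite -[0]addr0; apply: free_br.
exists p, (q - br e p); split => //.
- split; first exact: freeB.
  apply: homogB => //.
  have -> : m.+2%:Z = 1 + m.+1%:Z by [].
  exact: br_homog.
- rewrite e1 linearB /= (d1_br0 Fe Fp) dp br0r addr0 brDl.
  by apply: serP => u; rewrite !(serBE, serE); ring.
Qed.

Lemma gact_comp1 x z : cfree 0 x -> cfree (-1) z ->
  comp 1 (gact x z) = comp 1 z - d1 (comp 1 x).
Proof.
move=> cx cz; have lx := cfree_low cx; have lz := cfree_low cz.
have -> : comp 1 (gact x z) = comp 1 (gs x z 0 + gs x z 1).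
  apply/eqP; rewrite -subr_eq0 -linearB /=; apply/eqP/(@comp_low _ 1 2) => //.
  by have := @gact_low x z cx 2; rewrite !big_ord_recl big_ord0 addr0.
rewrite /= invr1 scale1r !linearD linearN /=.
rewrite (comp_der_lead phi_cfree (cfree_supp cx) lx).
by rewrite (comp_low _ (low_br deg lx lz)) // add0r.
Qed.

(** The leading term w of the difference of gact x z and y is closed by the
    linear part of the two Maurer-Cartan equations, and their next part gives
    the second hypothesis of exactness, at the linear part of y. The half of
    [q, d x] in gact_variation shifts it by one half of the differential of
    the linear part of x; the sum p + q obtained there removes w. *)
Lemma gact_step y z : mc y -> mc z -> exact_at (comp 1 y) ->
  forall m x, cfree 0 x -> low m.+2 (gact x z - y) ->
  exists q, [/\ cfree 0 q, low m.+1 q & low m.+3 (gact (x + q) z - y)].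
Proof.
move=> my mz ex m x cx lW; set z' := gact x z; set W := z' - y.
have cz := mz.1; have cy := my.1.
have [cz' ez'] := gact_mc cx mz.1 mz; rewrite -/z' in cz' ez'.
have cW : cfree (-1) W by apply: cfreeB.
have hW : W = z' - y by [].
have {}lW : low m.+2 W by [].
clearbody W.
have sW := cfree_supp cW.
have dW : dd W = - br y W - (1 / 2 : rat) *: br W W.
  rewrite {1}hW (linearB (der deg phi)) /= ez' my.2.
  have -> : z' = y + W by rewrite hW addrC subrK.
  rewrite !brDl !brDr (br_symN1 cW cy).
  by apply: serP => w; rewrite !(serBE, serE); field.
have ly := cfree_low cy.
pose w := comp m.+2 W.
have Fw : free (-1) w by apply: cfree_comp cW.
have lyW : low m.+3 (br y W) := low_br deg ly lW.
have lWW : low m.+4 (br W W).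
  by apply: (low_le _ (low_br deg lW lW)); lia.
have d1w : d1 w = 0.
  rewrite -(comp_der_lead phi_cfree sW lW) dW linearB linearN /=.
  rewrite (comp_low _ lyW) // (linearZZ (comp m.+2)) /= (comp_low _ lWW) //.
have d2w : d2 w + br (comp 1 y) w = d1 (- comp m.+3 W).
  have := comp_der_next phi_cfree sW lW; rewrite dW linearB linearN /=.
  rewrite (linearZZ (comp m.+3)) /= (comp_low _ lWW) // scaler0 subr0.
  rewrite -[in comp m.+3 (br y W)](add1n m.+2) (comp_br_lead ly lW) -/w.
  move=> h; rewrite (linearN d1) /=.
  have -> : d1 (comp m.+3 W) = - br (comp 1 y) w - d2 w by rewrite h addrK.
  by rewrite opprB opprK.
pose e := (1 / 2 : rat) *: comp 1 x.
have Fe : free 0 e by apply/free_scale/cfree_comp.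
have he : homog (fun=> 1) 1 e by apply/homogZ/comp_size.
have [|p [q [[Fp hp] [Fq hq] dp ew]]] :=
    exact_at_shift Fe he ex Fw (@comp_size _ m.+2 W) d1w.
  exists (br e w - comp m.+3 W).
    apply: suppB; first exact: br_supp (free_supp Fe) (free_supp Fw).
    exact: comp_supp.
  by rewrite linearB /= -linearN /= -d2w (d1_br0 Fe Fw) d1w br0r addr0 brDl [RHS]addrC addrA.
exists (p + q).
have cp := free_cfree Fp; have cq := free_cfree Fq.
have cpq : cfree 0 (p + q) by apply: cfreeD.
have lp : low m.+1 p by apply: low_homog.
have lq : low m.+2 q by apply: low_homog.
have lpq : low m.+1 (p + q) by apply: lowD => //; apply: low_le lq.
have spq := cfree_supp cpq.
have c1 : comp m.+1 (p + q) = p.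
  by rewrite linearD /= (comp_id hp) (comp_low _ lq) // addr0.
have c2 : comp m.+2 (p + q) = q.
  by rewrite linearD /= (comp_id hq) -(comp_id hp) comp_comp (gtn_eqF (ltnSn _)) add0r.
have ldpq : low m.+2 (dd (p + q)).
  have := low_rest (dd_low cpq lpq).
  by rewrite (comp_der_lead phi_cfree spq lpq) c1 dp subr0.
split=> //.
have hv := gact_variation cx cpq cz lpq ldpq; rewrite -/z' in hv.
set V := br (p + q) z - dd (p + q) - (1 / 2 : rat) *: br (p + q) (dd x) in hv.
have -> : gact (x + (p + q)) z - y = (gact (x + (p + q)) z - z' - V) + (V + W).
  by rewrite hW; apply: serP => u; rewrite !(serBE, serE); ring.
apply: lowD => //.
have lz := cfree_low cz; have lx := cfree_low cx.
have ldx := dd_low cx lx.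
have lV : low m.+2 (V + W).
  apply: lowD => //; apply: lowB; first apply: lowB => //.
    by have := low_br deg lpq lz; rewrite addn1.
  by apply: lowZ; have := low_br deg lpq ldx; rewrite addn1.
have := low_rest lV; suff -> : comp m.+2 (V + W) = 0 by rewrite subr0.
rewrite linearD -/w /= /V !linearB /= (linearZZ (comp m.+2)) /=.
rewrite (comp_der_next phi_cfree spq lpq) c1 c2.
rewrite -{1 2}[m.+2]addn1 (comp_br_lead lpq lz) (comp_br_lead lpq ldx) c1.
rewrite (comp_der_lead phi_cfree (cfree_supp cx) lx).
have cz1 : cfree (-1) (comp 1 z) by apply/free_cfree/cfree_comp.
have cx1 : cfree (-1) (d1 (comp 1 x)).
  by apply/free_cfree; rewrite -[-1]add0r; apply/d1_free/cfree_comp.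
rewrite (br_anti0 cp cz1) (br_anti0 cp cx1).
have y1 : comp 1 y = comp 1 z - d1 (comp 1 x).
  have -> : y = z' - W by rewrite hW opprB addrC subrK.
  rewrite linearB /= (comp_low _ lW) // subr0.
  exact: gact_comp1.
rewrite -/w ew y1 /e (linearZZ d1) /= brDl !brBl brZl.
by apply: serP => u; rewrite !(serBE, serE); field.
Qed.

(** Successive approximation: by exactness each step improves the agreement by
    one length, the corrections have growing length, and so their sum
    converges. *)
Lemma gact_connect y z x0 : mc y -> mc z -> exact_at (comp 1 y) ->
  cfree 0 x0 -> low 2 (gact x0 z - y) ->
  exists2 x, cfree 0 x & gact x z = y.
Proof.
move=> my mz ex cx0 l0.
pose ok (s : nat * series B) := cfree 0 s.2 /\ low s.1.+2 (gact s.2 z - y).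
have next (s : {s | ok s}) : exists s' : {s | ok s},
    (sval s').1 = (sval s).1.+1 /\ low (sval s).1.+1 ((sval s').2 - (sval s).2).
  case: s => -[m x] [/= cx lx].
  have [q [cq lq lx']] := gact_step my mz ex cx lx.
  have ok' : ok (m.+1, x + q) by split; first exact: cfreeD.
  by exists (exist _ (m.+1, x + q) ok'); split => //=; rewrite addrC addKr.
have [nxt hnxt] := choice next.
have ok0 : ok (0%N, x0) by [].
pose s m := iter m nxt (exist ok (0%N, x0) ok0).
pose X m := (sval (s m)).2.
have s1 m : (sval (s m)).1 = m.
  by elim: m => [//|m IH]; rewrite /s /= (hnxt _).1 -/(s m) IH.
have cX m : cfree 0 (X m) by rewrite /X; have [] := svalP (s m).
have lX m : low m.+2 (gact (X m) z - y).
  by rewrite /X -{1}(s1 m); have [] := svalP (s m).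
have dX m : low m.+1 (X m.+1 - X m).
  by rewrite -{1}(s1 m); apply: (hnxt (s m)).2.
have dX' m l : low m.+1 (X (m + l)%N - X m).
  elim: l => [|l IH]; first by rewrite addn0 subrr.
  rewrite addnS -(subrK (X (m + l)%N) (X _.+1)) -addrA; apply: lowD => //.
  by apply: low_le (dX _); rewrite ltnS leq_addr.
pose x : series B := fun w => X (size w) w.
have lx m : low m.+1 (x - X m).
  move=> w sw; rewrite serBE /x; have := @dX' (size w) (m - size w)%N w (leqnn _).
  by rewrite subnKC // serBE => h; apply/eqP; rewrite -oppr_eq0 opprB h.
have cx : cfree 0 x.
  apply/cfreeP => m; rewrite (_ : comp m x = comp m (X m)); first exact: cfree_comp.
  apply/eqP; rewrite -subr_eq0 -linearB /=; apply/eqP.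
  by apply: (@comp_low _ m m.+1).
exists x => //; apply: low_eq => m.
have -> : gact x z - y = (gact x z - gact (X m) z) + (gact (X m) z - y).
  by rewrite addrA subrK.
apply: lowD; last by apply: low_le (lX m); lia.
apply: (low_le (leqnSn m)); apply: gact_cont => //; exact: mz.1.
Qed.

End Gauge.

(** * Exactness from a contraction of the tensor algebra *)

Lemma generalized_inverse (B : finType) (m : B -> B -> rat) :
  exists k : B -> B -> rat, forall b c,
    \sum_e \sum_f m b e * k e f * m f c = m b c.
Proof.
pose A : 'M[rat]_#|B| := \matrix_(i, j) m (enum_val i) (enum_val j).
exists (fun b c => pinvmx A (enum_rank b) (enum_rank c)) => b c.
have := congr1 (fun M : 'M[rat]_#|B| => M (enum_rank b) (enum_rank c)) (mulmxKpV (submx_refl A)).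
have reidx (F : 'I_#|B| -> rat) : \sum_j F j = \sum_b F (enum_rank b).
  rewrite (reindex (@enum_rank B)) //.
  by exists (@enum_val B B) => x _; rewrite ?enum_valK ?enum_rankK.
rewrite /= !mxE !enum_rankK => <-; rewrite exchange_big reidx.
apply: eq_bigr => f _; rewrite !mxE enum_rankK reidx mulr_suml.
by apply: eq_bigr => e _; rewrite !mxE !enum_rankK.
Qed.

Section Exactness.
Variables (B : finType) (deg : B -> int) (S : {set B}) (phi : B -> series B).
Implicit Types (f g w x y z p q : series B) (m n : nat) (i j k : int) (b e : B).
Local Notation br := (ser_br deg).
Local Notation cfree := (cfree_hom deg S).
Local Notation free := (free_hom deg S).
Hypothesis phi_cfree : forall b, b \in S -> cfree (deg b - 1) (phi b).
Hypothesis phi_sq0 : forall b, b \in S -> der deg phi (phi b) = 0.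
Local Notation d1 := (der deg (phi1 phi)).
Local Notation d2 := (der deg (phi2 phi)).

Lemma der_ad c k f : homog deg (-1) c -> free k f ->
  der deg (fun b => br c (gen b)) f = br c f.
Proof.
move=> hc; elim => {k f} [b bS|k|k a f g _ hf _ hg|i j f g Ff hf Fg hg].
- exact: der_gen.
- by rewrite linear0 br0r.
- by rewrite linearP /= hf hg br_linearr.
- have h1 := free_homog Ff; have h2 := free_homog Fg.
  rewrite (der_br h1 h2) ?hf ?hg; first last.
  + by rewrite [j - 1]addrC; apply: br_homog.
  + by rewrite [i - 1]addrC; apply: br_homog.
  by rewrite (br_jacobi hc h1 h2) !sgnE.
Qed.

Let m1 b e : rat := if b \in S then phi b [:: e] else 0.

Lemma phi1E b : b \in S -> phi1 phi b = lin m1 b.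
Proof.
move=> bS; rewrite [LHS]size1E; last exact: comp_size.
by rewrite /lin /m1 bS; apply: eq_bigr => c _.
Qed.

Lemma m1_neq0 b e : m1 b e != 0 -> [/\ b \in S, e \in S & deg e = deg b - 1].
Proof.
rewrite /m1; case: ifP => [bS nz|]; last by rewrite eqxx.
split => //.
  by have := cfree_supp (phi_cfree bS) nz; rewrite /= andbT.
by have := cfree_homog (phi_cfree bS) nz; rewrite wdeg_cons wdeg_nil addr0.
Qed.

Lemma m1_sq0 b c : \sum_e m1 b e * m1 e c = 0.
Proof.
have [bS|nb] := boolP (b \in S); last first.
  by rewrite big1 // => e _; rewrite /m1 (negPf nb) mul0r.
have := phi1_sq0 phi_cfree phi_sq0 bS.
rewrite (phi1E bS) {1}/lin linear_sum /= => /(congr1 (fun f => f [:: c])).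
rewrite ser_sumE ser0E => e0; rewrite -[RHS]e0; apply: eq_bigr => e _.
rewrite linearZZ serE /= der_gen.
have [->|/m1_neq0[_ eS _]] := eqVneq (m1 b e) 0; first by rewrite !mul0r.
by rewrite (phi1E eS) lin1.
Qed.

(** If k is a generalized inverse of the linear part d_1, then P = 1 - d_1 k -
    k d_1 satisfies d_1 P = P d_1 = 0 and is homotopic to the identity. Its
    image is a model of the homology of d_1. *)
Lemma homology_projection : exists P k : B -> B -> rat,
  [/\ forall b e, b \in S -> P b e != 0 -> e \in S /\ deg e = deg b,
      forall b e, k b e != 0 -> e \in S /\ deg e = deg b + 1,
      forall b, b \in S -> d1 (lin P b) = 0,
      forall b, b \in S -> alg P (phi1 phi b) = 0 &
      forall b, b \in S ->
        d1 (lin k b) + \sum_e phi1 phi b [:: e] *: lin k e = gen b - lin P b].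
Proof.
have [k0 hk0] := generalized_inverse m1.
pose k b e := if [&& b \in S, e \in S & deg e == deg b + 1] then k0 b e else 0.
have kneq b e : k b e != 0 -> [/\ b \in S, e \in S & deg e = deg b + 1].
  by rewrite /k; case: and3P => [[-> -> /eqP ->]|_]; rewrite ?eqxx.
have hk b c : \sum_e \sum_f m1 b e * k e f * m1 f c = m1 b c.
  have [e0|ne] := eqVneq (deg c) (deg b - 1).
    rewrite -[RHS]hk0; apply: eq_bigr => e _; apply: eq_bigr => f _.
    have [->|/m1_neq0[_ eS de]] := eqVneq (m1 b e) 0; first by rewrite !mul0r.
    have [->|/m1_neq0[fS _ df]] := eqVneq (m1 f c) 0; first by rewrite !mulr0.
    rewrite /k eS fS; suff -> : deg f == deg e + 1 by [].
    by apply/eqP; move: de df e0; lia.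
  have -> : m1 b c = 0.
    by apply/eqP; apply: contra_neqT ne => /m1_neq0[].
  apply: big1 => e _; apply: big1 => f _; apply/eqP; apply: contra_neqT ne.
  rewrite !mulf_eq0 !negb_or => /andP[/andP[/m1_neq0[_ _ de] /kneq[_ _ df]] /m1_neq0[_ _ dc]].
  by rewrite dc df de; ring.
pose P b c := idm b c - \sum_e (m1 b e * k e c + k b e * m1 e c).
have hmm : forall b c, \sum_e \sum_f m1 b e * m1 e f * k f c = 0.
  move=> b c; rewrite exchange_big big1 // => f _.
  by rewrite -mulr_suml m1_sq0 mul0r.
have hkmm : forall b c, \sum_e \sum_f k b e * m1 e f * m1 f c = 0.
  move=> b c; rewrite big1 // => e _.
  under eq_bigr do rewrite -mulrA.
  by rewrite -mulr_sumr m1_sq0 mulr0.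
have Pm b c : \sum_e P b e * m1 e c = 0.
  under eq_bigr do rewrite mulrBl.
  rewrite sumrB (bigD1 b) //= {1}/idm eqxx mul1r [X in _ + X - _]big1 ?addr0; last first.
    by move=> e ne; rewrite /idm eq_sym (negPf ne) mul0r.
  under eq_bigr do rewrite big_split mulrDl !mulr_suml.
  rewrite big_split exchange_big /= hk.
  by rewrite [X in _ - (_ + X)]exchange_big /= hkmm addr0 subrr.
have mP b c : \sum_e m1 b e * P e c = 0.
  under eq_bigr do rewrite mulrBr.
  rewrite sumrB (bigD1 c) //= {1}/idm eqxx mulr1 [X in _ + X - _]big1 ?addr0; last first.
    by move=> e ne; rewrite /idm (negPf ne) mulr0.
  under eq_bigr do rewrite big_split mulrDr !mulr_sumr.
  rewrite big_split /=.
  under eq_bigr do under eq_bigr do rewrite mulrA.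
  rewrite hmm add0r.
  under [X in _ - X]eq_bigr do under eq_bigr do rewrite mulrA.
  by rewrite hk subrr.
have linP b : lin P b = gen b - \sum_e m1 b e *: lin k e - \sum_e k b e *: lin m1 e.
  rewrite /lin; apply: serP => w; rewrite !(serBE, serE).
  have -> : gen b w = \sum_c idm b c * gen c w.
    by rewrite -[X in X w](lin_idm b) /lin ser_sumE.
  under [X in _ - X - _]eq_bigr do rewrite serE ser_sumE mulr_sumr.
  under [X in _ - _ - X]eq_bigr do rewrite serE ser_sumE mulr_sumr.
  rewrite [X in _ - X - _]exchange_big [X in _ - _ - X]exchange_big /= -!sumrB.
  apply: eq_bigr => c _; rewrite serE /P big_split /= opprD addrA !mulrBl !mulr_suml.
  by congr (_ - _ - _); apply: eq_bigr => e _; rewrite serE mulrA.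
have d1lin (M : B -> B -> rat) b : (forall e, M b e != 0 -> e \in S) ->
    d1 (lin M b) = \sum_e M b e *: lin m1 e.
  move=> hM; rewrite {1}/lin linear_sum; apply: eq_bigr => e _.
  rewrite linearZZ /= der_gen; have [->|/hM eS] := eqVneq (M b e) 0.
    by rewrite !scale0r.
  by rewrite phi1E.
have linlin (M N : B -> B -> rat) b :
    (forall c, \sum_e M b e * N e c = 0) -> \sum_e M b e *: lin N e = 0.
  move=> h; rewrite /lin.
  under eq_bigr do rewrite scaler_sumr.
  rewrite exchange_big big1 //= => c _.
  under eq_bigr do rewrite scalerA.
  by rewrite -scaler_suml h scale0r.
have Pneq b e : b \in S -> P b e != 0 -> e \in S /\ deg e = deg b.
  move=> bS; have [<-|ne] := eqVneq b e; first by split.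
  rewrite /P /idm (negPf ne) sub0r oppr_eq0 => nz.
  have [c] : exists c, m1 b c * k c e + k b c * m1 c e != 0.
    by apply/existsP; apply: contraNT nz => /existsPn h; rewrite big1 // => c _;
       apply/eqP; rewrite -[_ == _]negbK h.
  have [e0|nz1] := eqVneq (m1 b c * k c e) 0; last first.
    move: nz1; rewrite mulf_eq0 negb_or => /andP[/m1_neq0[_ _ dc] /kneq[_ eS de]] _.
    by split => //; rewrite de dc subrK.
  rewrite e0 add0r mulf_eq0 negb_or => /andP[/kneq[_ _ dc] /m1_neq0[_ eS de]].
  by split => //; rewrite de dc addrK.
exists P, k; split => //.
- by move=> b e /kneq[].
- move=> b bS; rewrite d1lin; first exact: linlin.
  by move=> e /(Pneq _ _ bS)[].
- move=> b bS; rewrite (phi1E bS) {1}/lin linear_sum /=.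
  under eq_bigr do rewrite linearZZ /= alg_gen.
  exact: linlin.
- move=> b bS; rewrite linP d1lin; last by move=> e /kneq[].
  rewrite opprD !opprD !opprK addrA addrA subrr add0r addrC.
  congr (_ + _); apply: eq_bigr => e _; by rewrite (phi1E bS) lin1.
Qed.

Variables (c : series B) (h : B -> rat) (Pi : B -> B -> rat).
Hypothesis c_free : free (-1) c.
Hypothesis c_size : homog (fun=> 1) 1 c.
Hypothesis c_closed : d1 c = 0.
Hypothesis deg_ge : forall b, b \in S -> -1 <= deg b.

(** The values on the letters of the operator D = d_2 + ad c of exact_at. *)
Definition phiD b := phi2 phi b + br c (gen b).
Local Notation dD := (der deg phiD).

(** A contracting homotopy for D, modelled on the contraction with the
    augmentation h: under the hypotheses below it anticommutes with d_1
    (d1_hop), and D hop + hop D = 1 - alg Pi (dD_hop). It does not preserve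
    Lie elements, since its values on letters are scalars. *)
Definition hop := skew (tw deg Pi) (fun b => h b *: @one B).
HB.instance Definition _ := GRing.Linear.on hop.

Hypothesis h_deg : forall b, h b != 0 -> deg b = -1.
Hypothesis Pi_deg : forall b e, b \in S -> Pi b e != 0 -> e \in S /\ deg e = deg b.
Hypothesis Pi_d1 : forall b, b \in S -> d1 (lin Pi b) = alg Pi (phi1 phi b).
Hypothesis Pi_dD : forall b, b \in S -> dD (lin Pi b) = alg Pi (phiD b).
Hypothesis hop_phi1 : forall b, b \in S -> hop (phi1 phi b) = 0.
Hypothesis hop_phiD : forall b, b \in S -> hop (phiD b) = gen b - lin Pi b.
(* Pi is null-homologous on the letters of degree -1. *)
Hypothesis Pi_exact : forall b, b \in S -> deg b = -1 ->
  exists2 v, supp S v & lin Pi b = d1 v.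

Lemma phiD_free b : b \in S -> free (deg b - 1) (phiD b).
Proof.
move=> bS; apply: freeD; first exact: (phi2_free phi_cfree).
by rewrite addrC; apply: free_br => //; apply: free_gen.
Qed.

Lemma phiD_size b : homog (fun=> 1) 2 (phiD b).
Proof.
apply: homogD; first exact: comp_size.
exact: (br_homog (i := 1) (j := 1) c_size (homog_gen (fun=> 1) (b := b))).
Qed.

Lemma dDE k f : free k f -> dD f = d2 f + br c f.
Proof. by move=> Ff; rewrite der_phiD (der_ad (free_homog c_free) Ff). Qed.

Lemma lin_homog (wt : B -> int) (M : B -> B -> rat) b j :
  (forall e, M b e != 0 -> wt e = j) -> homog wt j (lin M b).
Proof.
move=> hM; apply: homog_sum => e _.
have [->|/hM <-] := eqVneq (M b e) 0; first by rewrite scale0r; apply: homog_zero.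
exact/homogZ/homog_gen.
Qed.

Lemma d1_dD f : supp S f -> d1 (dD f) + dD (d1 f) = 0.
Proof.
apply: der_anticomm => b bS.
- exact: free_homog (phi1_free phi_cfree bS).
- exact: free_homog (phiD_free bS).
have F1 := phi1_free phi_cfree bS.
rewrite (dDE F1) /phiD linearD /= addrACA (phi12_anticomm phi_cfree phi_sq0 bS) add0r.
rewrite (der_br (free_homog c_free) (homog_gen deg (b := b))).
- by rewrite c_closed br0l add0r der_gen scaleN1r addNr.
- by rewrite c_closed; apply: homog_zero.
- by rewrite der_gen; apply: free_homog F1.
Qed.

Lemma der_hop psi chi :
  (forall b, b \in S -> homog deg (deg b - 1) (psi b)) ->
  (forall b, b \in S -> der deg psi (lin Pi b) = alg Pi (psi b)) ->
  (forall b, b \in S -> hop (psi b) = chi b) ->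
  forall f, supp S f ->
  der deg psi (hop f) + hop (der deg psi f) = skew Pi chi f.
Proof.
move=> hpsi hPi hchi f sf; apply: (der_skew_anticomm (j := 1)) sf => // b bS.
- have [->|/h_deg ->] := eqVneq (h b) 0; first by rewrite scale0r; apply: homog_zero.
  by rewrite addNr; apply/homogZ/homog_one.
- by apply: lin_homog => e /(Pi_deg bS)[].
- by rewrite linearZZ /= der1 scaler0 add0r; apply: hchi.
Qed.

Lemma d1_hop f : supp S f -> d1 (hop f) = - hop (d1 f).
Proof.
move=> sf; apply/eqP; rewrite -addr_eq0.
rewrite (der_hop (chi := fun=> 0) _ Pi_d1) ?skew_phi0 // => b bS.
exact: free_homog (phi1_free phi_cfree bS).
Qed.

Lemma dD_hop f : supp S f -> dD (hop f) + hop (dD f) = f - alg Pi f.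
Proof.
move=> sf; rewrite (der_hop _ Pi_dD hop_phiD) ?(skew_sub_alg _ sf) // => b bS.
exact: free_homog (phiD_free bS).
Qed.

(** A word of negative degree contains a letter of degree -1. *)
Lemma alg_eq0 (M : B -> B -> rat) f k : k < 0 ->
  (forall b, b \in S -> deg b = -1 -> lin M b = 0) ->
  supp S f -> homog deg k f -> alg M f = 0.
Proof.
move=> k0 hM sf hf; apply: serP => w; rewrite /alg.
elim: w k k0 f sf hf => [|e w IH] k k0 f sf hf /=.
  by rewrite (homog0 hf) // wdeg_nil; apply: contraTneq k0 => <-.
rewrite big1 // => b _; have [bS|nb] := boolP (b \in S); last first.
  by rewrite (supp_dl0 sf nb) algw0 mulr0.
have [db|db] := eqVneq (deg b) (-1).
  by rewrite -lin1 hM // mul0r.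
rewrite (IH _ _ _ (supp_dl sf) (homog_dl hf)) ?mulr0 //.
have := deg_ge bS; move: db k0; lia.
Qed.

Lemma wdeg_th (u : seq B) :
  wdeg (fun b => deg b + 1) u = wdeg deg u + (size u)%:Z.
Proof. by elim: u => [|b u IH]; rewrite ?wdeg_nil // !wdeg_cons IH /=; lia. Qed.

(** The homotopy formula for w exhibits w as D z in the tensor algebra, where
    z = hop w, up to terms which P kills. The Dynkin operator with the weights
    deg + 1 commutes with D, because D lowers the degree and raises the length
    by one; it turns z into a Lie element, and w into its multiple by the
    total weight, which is (m + 2) - 1 = m + 1 and in particular not zero. The
    remaining error r is a Lie element closed under d_1 and killed by P, hence
    the boundary under d_1 of K r, and the Dynkin operator with the weights 1,
    which commutes with d_1, makes K r a Lie element. *)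
Lemma exactness : exact_at deg S phi c.
Proof.
move=> m w Fw sw dw [v sv hv].
have [P [k [hP hk d1P Pd1 hom]]] := homology_projection.
pose K := skew (tw deg P) (lin k).
have K0 : K 0 = 0 by apply: (linear0 (skew (tw deg P) (lin k))).
have phi1h b : b \in S -> homog deg (deg b - 1) (phi1 phi b).
  by move=> bS; apply: free_homog (phi1_free phi_cfree bS).
have lPh b : b \in S -> homog deg (deg b) (lin P b).
  by move=> bS; apply: lin_homog => e /(hP _ _ bS)[].
have lkh b : homog deg (deg b + 1) (lin k b).
  by apply: lin_homog => e /hk[].
have Kphi1 b : b \in S -> K (phi1 phi b) = \sum_e phi1 phi b [:: e] *: lin k e.
  move=> bS; rewrite {1}[phi1 phi b]size1E; last exact: comp_size.
  by rewrite /K linear_sum; apply: eq_bigr => e _; rewrite linearZZ /= skew_gen.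
have d1K f : supp S f -> d1 (K f) + K (d1 f) = f - alg P f.
  move=> sf; rewrite -(skew_sub_alg _ sf).
  apply: (der_skew_anticomm (j := 1)) sf => // b bS.
  - by rewrite d1P // Pd1.
  - by rewrite -/K (Kphi1 _ bS); apply: hom.
have Pkill f : supp S f -> alg P (d1 f) = 0.
  move=> sf; have := @intertwiner_eq0 _ _ S (tw deg P) (alg P \o d1) _ _ f sf.
  apply; first by rewrite /= der1 linear0.
  move=> b g bS sg; rewrite /= der_gen_mul linearD linearZZ /= !alg_mul Pd1 //.
  by rewrite cmul0l add0r alg_gen lin_tw cmulZl.
have killP f : supp S f -> d1 (alg P f) = 0.
  move=> sf; have := @intertwiner_eq0 _ _ S (tw deg P) (d1 \o alg P) _ _ f sf.
  apply; first by rewrite /= alg1 der1.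
  move=> b g bS sg; rewrite /= alg_gen_mul (der_mul _ _ (lPh _ bS)) d1P //.
  by rewrite cmul0l add0r lin_tw cmulZl.
have Psup f : supp S f -> supp S (alg P f).
  by move=> sf; apply: (alg_supp _ sf) => b e bS /(hP _ _ bS)[].
have Ksup f : supp S f -> supp S (K f).
  move=> sf; apply: (skew_supp _ _ sf) => [b e bS /tw_neq0/(hP _ _ bS)[] //|b bS].
  apply: supp_sum => e _; have [->|/hk[eS _]] := eqVneq (k b e) 0.
    by rewrite scale0r; apply: supp_zero.
  by apply/suppZ/supp_gen.
have d1sup f : supp S f -> supp S (d1 f).
  by apply: der_supp => b bS; apply: free_supp (phi1_free phi_cfree bS).
have dDsup f : supp S f -> supp S (dD f).
  by apply: der_supp => b bS; apply: free_supp (phiD_free bS).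
have hopsup f : supp S f -> supp S (hop f).
  move=> sf; apply: (skew_supp _ _ sf) => [b e bS /tw_neq0/(Pi_deg bS)[] //|b bS].
  by apply/suppZ/supp_one.
have sfw := free_supp Fw; have hfw := free_homog Fw.
set z := hop w.
have sz : supp S z by apply: hopsup.
have zdeg : homog deg 0 z.
  rewrite -(addNr 1).
  apply: (skew_homog _ _ sfw hfw) => [b e bS /tw_neq0/(Pi_deg bS)[] //|b bS].
  have [->|/h_deg ->] := eqVneq (h b) 0; first by rewrite scale0r; apply: homog_zero.
  by rewrite addNr; apply/homogZ/homog_one.
have zsize : homog (fun=> 1) m.+1%:Z z.
  have -> : m.+1%:Z = m.+2%:Z + -1 by lia.
  apply: (skew_homog _ _ sfw sw) => [//|b bS].
  by rewrite subrr; apply/homogZ/homog_one.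
have d1z : d1 z = 0 by rewrite d1_hop // dw linear0 oppr0.
have hwD : dD w = d1 v by rewrite (dDE Fw).
(* alg P kills everything in the homotopy formula for w but dD z *)
have Pw : alg P w = alg P (dD z).
  have e1 := dD_hop sfw.
  have -> : w = dD z + hop (dD w) + alg Pi w by rewrite e1 subrK.
  rewrite !linearD /= hwD -[hop (d1 v)]opprK -d1_hop // linearN /= Pkill; last exact: hopsup.
  rewrite oppr0 addr0 -[RHS]addr0; congr (_ + _).
  pose PPi b e := alg P (lin Pi b) [:: e].
  have PPiE b : lin PPi b = alg P (lin Pi b).
    rewrite [RHS]size1E //; apply: (@alg_homog _ _ _ _ [set: B]) => //.
      exact: suppT.
    exact: lin_homog.
  have -> : alg P (alg Pi w) = alg PPi w.
    apply: (@intertwiner_eq _ _ [set: B] PPi (alg P \o alg Pi) (alg PPi)).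
    - by rewrite /= !alg1.
    - by move=> b g _ _; rewrite /= !alg_gen_mul alg_mul PPiE cmulBr.
    - exact: suppT.
  apply: (alg_eq0 _ _ sfw hfw) => // b bS db.
  by rewrite PPiE; have [u su ->] := Pi_exact bS db; rewrite Pkill.
have PDz : alg P (dD z) = alg P (dD (alg P z)).
  have : alg P z = z - d1 (K z).
    have := d1K _ sz; rewrite d1z K0 addr0 => ->.
    by rewrite opprB addrC subrK.
  move=> ->; rewrite linearB /= linearB /=.
  have := d1_dD (Ksup _ sz) => /eqP; rewrite addrC addr_eq0 => /eqP ->.
  by rewrite linearN /= Pkill ?oppr0 ?subr0 //; apply/dDsup/Ksup.
pose th b := deg b + 1.
pose q0 := (m.+1%:R^-1 : rat) *: dynn deg th m.+1 (alg P z).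
have Pzdeg : homog deg 0 (alg P z).
  by apply: (alg_homog _ sz zdeg) => b e bS /(hP _ _ bS)[].
have Pzsize : homog (fun=> 1) m.+1%:Z (alg P z).
  by apply: (alg_homog (wt := fun=> 1) _ sz zsize).
have dynnE th' n f : homog (fun=> 1) n%:Z f -> dyn deg th' f = dynn deg th' n f.
  move=> hf; apply: serP => u; rewrite /dyn; have [->//|ne] := eqVneq (size u) n.
  rewrite -/(dyn deg th' f u) (homog0 (dyn_homog hf)) ?wdeg1; last by apply: contra_neq ne => -[].
  by rewrite (homog0 (dynn_homog (n := n) hf)) // wdeg1; apply: contra_neq ne => -[].
have q0E : q0 = (m.+1%:R^-1 : rat) *: dyn deg th (alg P z) by rewrite /q0 (dynnE _ m.+1).
have Fq0 : free 0 q0 by apply/free_scale/dynn_free => //; apply: Psup.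
have q0size : homog (fun=> 1) m.+1%:Z q0 by apply/homogZ/dynn_homog.
have hPth b e : b \in S -> P b e != 0 -> e \in S /\ deg e = deg b /\ th e = th b.
  by move=> bS /(hP _ _ bS)[eS de]; rewrite /th de.
have dynsup th' f j : supp S f -> homog deg j f -> supp S (dyn deg th' f).
  by move=> sf hf u; apply: (free_supp (dynn_free _ _ sf hf)).
have d1q0 : d1 q0 = 0.
  rewrite q0E linearZZ /= (dyn_alg hPth sz zdeg) killP ?scaler0 //.
  exact: dynsup zdeg.
have phiDth b : b \in S -> homog th (th b) (phiD b).
  move=> bS; apply: homogP => u; rewrite wdeg_th /th => nu.
  have [du|du] := eqVneq (wdeg deg u) (deg b - 1); last first.
    exact: (homog0 (free_homog (phiD_free bS))).
  rewrite (homog0 (@phiD_size b)) // wdeg1; apply: contraNneq nu => e.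
  by rewrite du e; apply/eqP; ring.
have dynDw : alg P w = alg P (dD q0).
  have wE : dyn deg th w = m.+1%:R *: w.
    rewrite (dyn_free th Fw); apply: serP => u; rewrite serE /wsc.
    have [->|nz] := eqVneq (w u) 0; first by rewrite !mulr0.
    rewrite wdeg_th (hfw _ nz) -wdeg1 (sw _ nz).
    by congr (_ * _); rewrite -[RHS]mulrz_nat; congr (_%:~R); lia.
  have e1 : m.+1%:R *: alg P w = dyn deg th (alg P w).
    by rewrite (dyn_alg hPth sfw hfw) wE linearZZ.
  rewrite q0E linearZZ /= linearZZ /=.
  rewrite -(dyn_der phiD_free phiDth (Psup _ sz) Pzdeg).
  have dDP : homog deg (0 - 1) (dD (alg P z)).
    apply: der_homog (Psup _ sz) Pzdeg => b bS.
    exact: free_homog (phiD_free bS).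
  rewrite -(dyn_alg hPth (dDsup _ (Psup _ sz)) dDP) -PDz -Pw -e1 scalerA.
  by rewrite mulVf ?scale1r // pnatr_eq0.
pose r := w - dD q0.
have FDq : free (-1) (dD q0).
  rewrite (dDE Fq0); apply: freeD; last by rewrite -[-1]addr0; apply: free_br.
  have : free (0 - 1) (comp m.+2 (der deg (phi2 phi) q0)).
    have c2 : forall b, b \in S -> cfree (deg b - 1) (phi2 phi b).
      by move=> b bS; apply/free_cfree/(phi2_free phi_cfree).
    by apply: cfree_comp; apply: (der_cfree c2); apply: free_cfree.
  by rewrite (@comp_der2 _ deg S phi m.+1 q0 (free_supp Fq0)) (comp_id q0size).
have Fr : free (-1) r by apply: freeB.
have sr := free_supp Fr; have hr := free_homog Fr.
have dDq_size : homog (fun=> 1) m.+2%:Z (dD q0).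
  have -> : m.+2%:Z = m.+1%:Z + 1 by lia.
  apply: der_homog (free_supp Fq0) q0size => b bS.
  exact: phiD_size.
have rsize : homog (fun=> 1) m.+2%:Z r.
  by apply: homogB.
have d1r : d1 r = 0.
  rewrite /r linearB /= dw sub0r; have /eqP := d1_dD (free_supp Fq0).
  by rewrite d1q0 linear0 addr0 => /eqP ->; rewrite oppr0.
have rE : r = d1 (K r).
  have := d1K _ sr; rewrite d1r K0 addr0 => ->.
  by rewrite {2}/r linearB /= dynDw subrr subr0.
have Kr_deg : homog deg 0 (K r).
  rewrite -(addNr 1).
  by apply: (skew_homog _ _ sr hr) => [b e bS /tw_neq0/(hP _ _ bS)[] //|b bS].
have Kr_size : homog (fun=> 1) m.+2%:Z (K r).
  rewrite -[m.+2%:Z]addr0; apply: (skew_homog _ _ sr rsize) => [//|b bS].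
  by rewrite addr0; apply: lin_homog.
exists q0, ((m.+2%:R^-1 : rat) *: dynn deg (fun=> 1) m.+2 (K r)); split => //.
- split; first by apply/free_scale/dynn_free => //; apply: Ksup.
  exact/homogZ/dynn_homog.
rewrite -addrA -(dDE Fq0) -(dynnE _ _ _ Kr_size) linearZZ /=.
rewrite -(dyn_der (phi1_free phi_cfree) _ (Ksup _ sr) Kr_deg); last first.
  by move=> b bS; apply: comp_size.
rewrite -rE (dyn_free _ Fr); suff -> : wsc (fun=> 1) r = m.+2%:R *: r.
  by rewrite scalerA mulVf ?pnatr_eq0 // scale1r /r subrK.
apply: serP => u; rewrite serE /wsc; have [->|nz] := eqVneq (r u) 0.
  by rewrite !mulr0.
by rewrite (rsize _ nz).
Qed.

End Exactness.

(** * The differential of the simplices *)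

Section ChangeOfLetters.
Variables (B C : finType) (degB : B -> int) (degC : C -> int).
Variables (S : {set B}) (S' : {set C}) (M : B -> C -> rat).
Hypothesis M_deg : forall b c, b \in S -> M b c != 0 -> c \in S' /\ degC c = degB b.
Implicit Types (f g : series B) (k : int).

Lemma alg_comp m f : comp m (alg M f) = alg M (comp m f).
Proof.
apply: serP => w; rewrite /alg /comp.
case: eqP => [<-|]; elim: w m f => [|c w IH] m f //=.
- by apply: eq_bigr => b _; rewrite IH //; congr (_ * algw _ _ _).
- by case: m.
move=> ne; rewrite big1 // => b _.
case: m ne => [|m] ne.
  rewrite (_ : dl b _ = 0); last exact: serP.
  by rewrite algw0 mulr0.
have <- := IH m (dl b f); first by rewrite mulr0.
by move=> e; apply: ne; rewrite e.
Qed.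

Lemma alg_cfree k f : cfree_hom degB S k f -> cfree_hom degC S' k (alg M f).
Proof.
move=> cf; apply/cfreeP => m; rewrite alg_comp.
elim: (cfree_comp m cf) => {k cf} [b bS|k|k a g g' _ hg _ hg'|i j g g' Fg hg Fg' hg'].
- rewrite alg_gen; apply: free_sum => c _.
  have [->|/(M_deg bS)[cS <-]] := eqVneq (M b c) 0.
    by rewrite scale0r; apply: free_zero.
  by apply/free_scale/free_gen.
- by rewrite linear0; apply: free_zero.
- by rewrite linearP /=; apply: free_lin.
- have Mdeg b c : b \in S -> M b c != 0 -> degC c = degB b by move=> bS /(M_deg bS)[].
  rewrite (alg_br Mdeg (free_supp Fg) (free_supp Fg') (free_homog Fg) (free_homog Fg')).
  exact: free_br.
Qed.
End ChangeOfLetters.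

Lemma free_mono (B : finType) (deg : B -> int) (S S' : {set B}) k f :
  S \subset S' -> free_hom deg S k f -> free_hom deg S' k f.
Proof.
move=> /fintype.subsetP sS; elim => {k f} [b bS|k|k a f g _ hf _ hg|i j f g _ hf _ hg].
- by apply: free_gen; apply: sS.
- exact: free_zero.
- exact: free_lin.
- exact: free_br.
Qed.

Lemma cfree_mono (B : finType) (deg : B -> int) (S S' : {set B}) k f :
  S \subset S' -> cfree_hom deg S k f -> cfree_hom deg S' k f.
Proof.
by move=> sS /cfreeP h; apply/cfreeP => m; apply: free_mono sS _; apply: h.
Qed.

Lemma lin_fun (B C : finType) (H : B -> C) b :
  lin (fun b c => (c == H b)%:R) b = gen (H b).
Proof.
rewrite /lin (bigD1 (H b)) //= eqxx scale1r big1 ?addr0 // => c nc.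
by rewrite (negPf nc) scale0r.
Qed.

Section ShortWords.
Variables (B : finType) (deg : B -> int).
Implicit Types (f g : series B) (a b c e : B).

Lemma gen_gen a b x y : (gen a ** gen b) [:: x; y] = (x == a)%:R * (y == b)%:R.
Proof. by rewrite gen_mul_cons /gen eqseq_cons andbT. Qed.

Lemma size2E f : homog (fun=> 1) 2 f ->
  f = \sum_a \sum_b f [:: a; b] *: (gen a ** gen b).
Proof.
have z (w : seq B) a b : size w != 2%N -> (gen a ** gen b) w = 0.
  move=> sw; apply: (homog0 (homog_mul (homog_gen (fun=> 1) (b := a)) (homog_gen (fun=> 1) (b := b)))).
  by rewrite wdeg1; apply: contra_neq sw => -[].
move=> hf; apply: serP => w; rewrite ser_sumE.
have [sw|sw] := eqVneq (size w) 2%N; last first.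
  rewrite (homog0 hf) ?wdeg1; last by apply: contra_neq sw => -[].
  by rewrite big1 // => a _; rewrite ser_sumE big1 // => b _; rewrite serE z ?mulr0.
case: w sw => [|a [|b [|? ?]]] // _.
rewrite (bigD1 a) //= ser_sumE (bigD1 b) //= serE gen_gen !eqxx !mulr1.
rewrite !big1 ?addr0 // => [c nc|c nc].
  by rewrite ser_sumE big1 // => e _; rewrite serE gen_gen eq_sym (negPf nc) mul0r mulr0.
by rewrite serE gen_gen [b == c]eq_sym (negPf nc) !mulr0.
Qed.

Lemma sum_delta (F : B -> rat) b : \sum_a F a * (b == a)%:R = F b.
Proof.
rewrite (bigD1 b) //= eqxx mulr1 big1 ?addr0 // => a na.
by rewrite eq_sym (negPf na) mulr0.
Qed.

Lemma der1_word2 phi f x y :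
  (forall b, homog (fun=> 1) 1 (phi b)) -> homog (fun=> 1) 2 f ->
  der deg phi f [:: x; y] =
  \sum_b phi b [:: x] * f [:: b; y] +
  (-1 : rat) ^ deg x * \sum_b phi b [:: y] * f [:: x; b].
Proof.
move=> hp hf; rewrite {1}(size2E hf) linear_sum ser_sumE mulr_sumr /=.
have E a b : der deg phi (f [:: a; b] *: (gen a ** gen b)) [:: x; y] =
   phi a [:: x] * f [:: a; b] * (y == b)%:R +
   (-1) ^ deg a * (phi b [:: y] * f [:: a; b]) * (x == a)%:R.
  rewrite linearZZ /= der_gen_mul der_gen serE serDE serZE gen_mul_cons.
  rewrite {1}(size1E (hp a)) cmul_suml ser_sumE.
  have -> : \sum_c (phi a [:: c] *: gen c ** gen b) [:: x; y] =
     \sum_c (phi a [:: c] * (y == b)%:R) * (x == c)%:R.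
    by apply: eq_bigr => c _; rewrite cmulZl serE gen_gen; ring.
  by rewrite sum_delta; ring.
under eq_bigr do rewrite linear_sum ser_sumE /=.
under eq_bigr do under eq_bigr do rewrite E.
under eq_bigr do rewrite big_split /= sum_delta -mulr_suml.
rewrite big_split sum_delta /=; congr (_ + _).
Qed.

Lemma antisym2 S k f a b : free_hom deg S k f ->
  f [:: a; b] = - ((-1) ^ (deg a * deg b) * f [:: b; a]).
Proof.
elim => {k f} [c _|k|k t f g _ hf _ hg|i j f g Ff _ Fg _].
- by rewrite /gen !eqseq_cons !andbF mulr0 oppr0.
- by rewrite serE mulr0 oppr0.
- by rewrite !serE hf hg; ring.
rewrite /ser_br !big_ord_recl !big_ord0 /=.
rewrite (free_nil Ff) (free_nil Fg) !wdeg_cons !wdeg_nil !(mul0r, mulr0) !sgnE.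
by case: (odz (deg a)); case: (odz (deg b)) => /=; ring.
Qed.

End ShortWords.

Section SimplexModel.
Variables (d : forall n, series {set 'I_n.+1} -> series {set 'I_n.+1}).
Arguments d : clear implicits.
Hypothesis hd : simplex_models d.

Lemma model_dE n k f : cfree_hom (@simplex_deg n) (full_simplex n) k f ->
  d n f = der (@simplex_deg n) (fun s => d n (gen s)) f.
Proof. by apply: dg_der; exact: (sm_cdgLie hd n).1. Qed.

Lemma set1_full n (v : 'I_n.+1) : [set v]%SET \in full_simplex n.
Proof. by rewrite inE; apply/set0Pn; exists v; rewrite inE. Qed.

Lemma simplex_deg1 n (v : 'I_n.+1) : simplex_deg [set v]%SET = -1.
Proof. by rewrite /simplex_deg cards1. Qed.

Lemma face_letter n (s : {set 'I_n.+1}) : s \in full_simplex n ->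
  cfree_hom (@simplex_deg n) (full_simplex n) (simplex_deg s) (gen s).
Proof. by move=> h; apply/free_cfree/free_gen. Qed.

Lemma homo_inj p n (h : 'I_p.+1 -> 'I_n.+1) :
  {homo h : i j / (i < j)%N} -> injective h.
Proof.
move=> hh i j e; apply/val_inj; case: (ltngtP i j) => // /hh; by rewrite e ltnn.
Qed.

Lemma ser_map_gen p n (h : 'I_p.+1 -> 'I_n.+1) s :
  ser_map (fun s : {set 'I_p.+1} => h @: s) (gen s) = gen (h @: s).
Proof. by rewrite ser_mapE alg_gen lin_fun. Qed.

Lemma ser_map_cfree p n (h : 'I_p.+1 -> 'I_n.+1) k f (S' : {set {set 'I_n.+1}}) :
  injective h ->
  (forall t, t \in full_simplex p -> h @: t \in S') ->
  cfree_hom (@simplex_deg p) (full_simplex p) k f ->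
  cfree_hom (@simplex_deg n) S' k (ser_map (fun s : {set 'I_p.+1} => h @: s) f).
Proof.
move=> hi hS cf; rewrite ser_mapE; apply: alg_cfree cf => b c bS.
have [->|_] := eqVneq c (h @: b); last by rewrite eqxx.
by move=> _; split; [exact: hS|rewrite /simplex_deg card_imset].
Qed.

(** The inclusion of the vertex carries the equation of the point to the
    simplex. *)
Lemma model_vertex n (v : 'I_n.+1) :
  d n (gen [set v]%SET) =
  - ((1 / 2 : rat) *: ser_br (@simplex_deg n) (gen [set v]%SET) (gen [set v]%SET)).
Proof.
case: n v => [|n] v; first by rewrite [v]ord1; exact: (sm_point hd).2.
pose h (i : 'I_1) := v.
have hh : {homo h : i j / (i < j)%N} by move=> i j; rewrite !ord1 ltnn.
have hi := homo_inj hh.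
have E : h @: [set ord0]%SET = [set v]%SET by rewrite imset_set1.
have c0 := face_letter (set1_full (ord0 : 'I_1)).
have := @sm_natural d hd 0 n.+1 h (ltn0Sn n) hh _ _ c0.
have pt : d 0 (gen [set ord0]%SET) = - ((1 / 2 : rat) *:
   ser_br (@simplex_deg 0) (gen [set ord0]%SET) (gen [set ord0]%SET)).
  exact: (sm_point hd).2.
rewrite ser_map_gen E => <-; rewrite pt !ser_mapE linearN linearZZ /=.
rewrite (@alg_br _ _ (@simplex_deg 0) (@simplex_deg n.+1) (full_simplex 0) _ (-1) (-1)) ?alg_gen ?lin_fun ?E //.
- move=> b c _; have [->|_] := eqVneq c (h @: b); last by rewrite eqxx.
  by rewrite /simplex_deg card_imset.
- exact/supp_gen/set1_full.
- exact/supp_gen/set1_full.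
- by rewrite -(simplex_deg1 (ord0 : 'I_1)); apply: homog_gen.
- by rewrite -(simplex_deg1 (ord0 : 'I_1)); apply: homog_gen.
Qed.

Definition faces n (s : {set 'I_n.+1}) : {set {set 'I_n.+1}} :=
  [set t : {set 'I_n.+1} | (t != finset.set0) && (t \subset s)]%SET.

Lemma enum_homo n (s : {set 'I_n.+1}) p : #|s| = p.+1 ->
  exists2 h : 'I_p.+1 -> 'I_n.+1, {homo h : i j / (i < j)%N} &
    h @: [set: 'I_p.+1]%SET = s.
Proof.
move=> cs; have sz : size (enum s) = p.+1 by rewrite -cardE.
pose h (i : 'I_p.+1) := nth ord0 (enum s) i.
have srt : sorted (fun i j : 'I_n.+1 => (i < j)%N) (enum s).
  suff : sorted ltn (map val (enum s)) by rewrite sorted_map.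
  apply: (@subseq_sorted _ _ ltn_trans _ (map val (enum 'I_n.+1))).
    by apply: map_subseq; rewrite enumT; apply: filter_subseq.
  by rewrite val_enum_ord iota_ltn_sorted.
exists h.
  move=> i j ij; apply: (sorted_ltn_nth _ ord0 srt) => //; rewrite ?inE ?sz //.
  by move=> a b e; apply: ltn_trans.
apply/setP => v; apply/imsetP/idP => [[i _ ->]|vs].
  by rewrite -mem_enum mem_nth // sz.
have iv : (index v (enum s) < p.+1)%N by rewrite -sz index_mem mem_enum.
by exists (Ordinal iv); rewrite ?inE // /h /= nth_index // mem_enum.
Qed.

(** A simplex is the image of the top simplex of a smaller standard simplex,
    and the differential is natural for this inclusion. *)
Lemma model_faces n (s : {set 'I_n.+1}) : s \in full_simplex n ->
  cfree_hom (@simplex_deg n) (faces s) (simplex_deg s - 1) (d n (gen s)).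
Proof.
move=> sf; have cs : (0 < #|s|)%N by rewrite card_gt0; move: sf; rewrite inE.
case e: #|s| cs => [//|p] _.
have pn : (p <= n)%N by rewrite -ltnS -e -[X in (_ <= X)%N](card_ord n.+1) max_card.
have hdeg m (t : {set 'I_m.+1}) : t \in full_simplex m ->
    cfree_hom (@simplex_deg m) (full_simplex m) (simplex_deg t - 1) (d m (gen t)).
  move=> tf; apply: (dgL_deg (sm_cdgLie hd m).1); exact: face_letter.
move: pn; rewrite leq_eqVlt => /orP[/eqP pn|pn].
  have sT : s = [set: 'I_n.+1]%SET.
    by apply/eqP; rewrite eqEcard finset.subsetT cardsT card_ord e pn /=.
  apply: cfree_mono (hdeg _ _ sf).
  by apply/fintype.subsetP => t; rewrite !inE sT finset.subsetT andbT.
have [h hh hs] := enum_homo e; have hi := homo_inj hh.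
have Tf : [set: 'I_p.+1]%SET \in full_simplex p.
  by rewrite inE; apply/set0Pn; exists ord0; rewrite inE.
have := @sm_natural d hd p n h pn hh _ _ (face_letter Tf).
rewrite ser_map_gen hs => <-.
have -> : simplex_deg s = simplex_deg [set: 'I_p.+1]%SET.
  by rewrite /simplex_deg -hs card_imset.
apply: ser_map_cfree (hdeg _ _ Tf) => // t; rewrite !inE => t0.
by rewrite imset_eq0 t0 -hs imsetS // finset.subsetT.
Qed.

Section FixedDimension.
Variable n : nat.
Implicit Types (s t e : {set 'I_n.+1}) (u v : 'I_n.+1).
Local Notation deg := (@simplex_deg n).
Local Notation full := (full_simplex n).
Let phi s := d n (gen s).

Lemma phi_full s : s \in full -> cfree_hom deg full (deg s - 1) (phi s).
Proof.
move=> sf; apply: cfree_mono (model_faces sf).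
by apply/fintype.subsetP => t; rewrite !inE => /andP[].
Qed.

Lemma phi_full_sq0 s : s \in full -> der deg phi (phi s) = 0.
Proof.
move=> sf; rewrite -(model_dE (phi_full sf)).
exact: (dgL_sq0 (sm_cdgLie hd n).1 (face_letter sf)).
Qed.

Lemma phi_face s (w : seq {set 'I_n.+1}) t : s \in full -> phi s w != 0 -> t \in w ->
  (t != finset.set0) && (t \subset s).
Proof.
move=> sf /(cfree_supp (model_faces sf))/allP h tw.
have : t \in faces s by apply: h.
by rewrite inE.
Qed.

Lemma phi_word1 s t : s \in full -> t \in full -> phi s [:: t] = boundary_coef s t.
Proof. by move=> sf tf; exact: (sm_linear hd sf tf). Qed.

Lemma phi_word1_set0 s : s \in full -> phi s [:: finset.set0] = 0.
Proof.
move=> sf; apply/eqP; apply/negPn/negP => /(phi_face sf) /(_ (mem_head _ _)).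
by rewrite eqxx.
Qed.

Lemma boundary_edge u v t : (u < v)%N ->
  boundary_coef [set u; v]%SET t = (t == [set v]%SET)%:R - (t == [set u]%SET)%:R.
Proof.
move=> uv; have nuv : u != v by apply: contraTneq uv => ->; rewrite ltnn.
rewrite /boundary_coef big_mkcondr /= big_setU1 ?inE //= big_set1.
have -> : [set u; v]%SET :\ u = [set v]%SET.
  apply/setP => x; rewrite !inE; have [->|] := eqVneq x u; last by [].
  by rewrite (negPf nuv).
have -> : [set u; v]%SET :\ v = [set u]%SET.
  apply/setP => x; rewrite !inE; have [->|] := eqVneq x v; last by rewrite orbF.
  by rewrite eq_sym (negPf nuv).
have -> : #|[set x in [set u; v] | (x < u)%N]%SET| = 0%N.
  apply/eqP; rewrite cards_eq0; apply/eqP/setP => x; rewrite !inE.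
  by have [->|_] := eqVneq x u; rewrite ?ltnn //=; have [->|_] := eqVneq x v; rewrite //= ltnNge ltnW.
have -> : #|[set x in [set u; v] | (x < v)%N]%SET| = 1%N.
  apply/eqP/cards1P; exists u; apply/setP => x; rewrite !inE.
  by have [->|_] := eqVneq x u; rewrite ?uv //=; have [->|_] := eqVneq x v; rewrite ?ltnn.
by rewrite expr0 expr1; case: (t == _); case: (t == _); rewrite ?subr0 ?sub0r ?addr0 ?add0r.
Qed.

Lemma phi_edge u v : (u < v)%N ->
  phi1 phi [set u; v]%SET = gen [set v]%SET - gen [set u]%SET.
Proof.
move=> uv; have ef : [set u; v]%SET \in full.
  by rewrite inE; apply/set0Pn; exists u; rewrite !inE eqxx.
rewrite /phi1 (size1E (@comp_size _ 1 _)); apply: serP => w; rewrite !(serBE, serE).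
have E t : comp 1 (phi [set u; v]%SET) [:: t] = (t == [set v]%SET)%:R - (t == [set u]%SET)%:R.
  rewrite /comp /=; have [->|t0] := eqVneq t finset.set0.
    rewrite (phi_word1_set0 ef).
    have h x : (finset.set0 == [set x]%SET :> {set 'I_n.+1}) = false.
      by apply/negbTE; rewrite eq_sym; apply/set0Pn; exists x; rewrite inE.
    by rewrite !h subrr.
  have tf : t \in full by rewrite inE.
  by rewrite (phi_word1 ef tf) boundary_edge.
under eq_bigr do rewrite serE E mulrBl.
rewrite sumrB; congr (_ - _).
  by rewrite (bigD1 [set v]%SET) //= eqxx mul1r big1 ?addr0 // => t /negPf->; rewrite mul0r.
by rewrite (bigD1 [set u]%SET) //= eqxx mul1r big1 ?addr0 // => t /negPf->; rewrite mul0r.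
Qed.

Lemma boundary_face s v : v \in s -> boundary_coef s (s :\ v) != 0.
Proof.
move=> vs; rewrite /boundary_coef (big_pred1 v) ?signr_eq0 // => x /=.
apply/andP/eqP => [[xs /eqP e]|-> //].
apply/eqP/negPn/negP => nxv; have : x \in s :\ v by rewrite !inE nxv.
by rewrite e !inE eqxx.
Qed.

Lemma boundary_vertex s v : #|s| != 2%N -> boundary_coef s [set v]%SET = 0.
Proof.
move=> s2; rewrite /boundary_coef big1 // => x /andP[xs /eqP e].
case/negP: s2; have := cardsD1 x s; rewrite xs -e cards1; by move=> ->.
Qed.

(** Only edges have vertices in their boundary, and the boundary of an edge is
    the difference of its endpoints. *)
Lemma phi_aug s : s \in full -> \sum_v phi s [:: [set v]%SET] = 0.
Proof.
move=> sf; under eq_bigr do rewrite phi_word1 ?set1_full //.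
have [/eqP/cards2P[u [v [nuv ->]]]|s2] := eqVneq #|s| 2%N; last first.
  by rewrite big1 // => v _; apply: boundary_vertex.
have wlg (a b : 'I_n.+1) : (a < b)%N -> \sum_x boundary_coef [set a; b]%SET [set x]%SET = 0.
  move=> ab; under eq_bigr do rewrite boundary_edge // !(inj_eq set1_inj).
  rewrite sumrB (bigD1 b) //= eqxx big1 => [|x /negPf-> //].
  by rewrite (bigD1 a) //= eqxx big1 => [|x /negPf-> //]; rewrite subrr.
case: (ltngtP u v) => h; first exact: wlg.
  by rewrite finset.setUC; apply: wlg.
by case/eqP: nuv; apply: val_inj.
Qed.

Lemma vertex_sq v : phi [set v]%SET = - (gen [set v]%SET ** gen [set v]%SET).
Proof.
rewrite /phi model_vertex; have h := homog_gen deg (b := [set v]%SET).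
rewrite (brE h h) simplex_deg1 /= !sgnE /= expr1 scaleN1r opprK.
by apply: serP => w; rewrite !serE; field.
Qed.

Lemma phi_size2_face s v t : s \in full -> phi s [:: [set v]%SET; t] != 0 -> t = s.
Proof.
move=> sf nz; have := cfree_homog (phi_full sf) nz.
rewrite !wdeg_cons wdeg_nil addr0 simplex_deg1 /simplex_deg => e.
have /andP[_ ts] : (t != finset.set0) && (t \subset s).
  by apply: (phi_face sf nz); rewrite !inE eqxx orbT.
apply/eqP; rewrite eqEcard ts /=; move: e; move: #|t| #|s| => p q e. lia.
Qed.

(** The quadratic part of the differential is dual to a product for which the
    augmentation is a unit: for degree reasons the contraction of d_2 s with
    the augmentation is a multiple of s, the factor is the same for a simplex
    and for its faces because d^2 = 0, and it is -1 for the vertices. *)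
Lemma phi_counit s t : s \in full ->
  \sum_v phi s [:: [set v]%SET; t] = - (t == s)%:R.
Proof.
have off s' t' : s' \in full -> t' != s' -> \sum_v phi s' [:: [set v]%SET; t'] = 0.
  move=> sf ne; rewrite big1 // => v _; apply/eqP; apply: contra_neqT ne.
  exact: phi_size2_face.
move=> sf; have [->|ne] := eqVneq t s; last by rewrite off // oppr0.
elim: {s}#|s| {-2}s (leqnn #|s|) sf {t} => [|m IH] s.
  by rewrite leqn0 cards_eq0 inE => ->.
move=> sm sf; have /set0Pn[v vs] : s != finset.set0 by move: sf; rewrite inE.
have [/eqP s0|t0] := eqVneq (s :\ v) finset.set0.
  have es : s = [set v]%SET.
    by apply/eqP; rewrite finset.eqEsubset finset.sub1set vs andbT -finset.setD_eq0.
  rewrite es (bigD1 v) //= vertex_sq serE gen_gen eqxx mulr1 big1 ?addr0 // => u nu.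
  by rewrite serE gen_gen (inj_eq set1_inj) (negPf nu) mul0r oppr0.
set t := s :\ v; have tf : t \in full by rewrite inE.
have ts : t \subset s by apply: subD1set.
have ct : \sum_v phi t [:: [set v]%SET; t] = - 1.
  rewrite IH ?eqxx // -ltnS; apply: leq_trans sm.
  by rewrite [X in (_ < X)%N](cardsD1 v) vs.
have nts : s != t.
  by apply: contraTneq vs => ->; rewrite !inE eqxx.
have h1 b : homog (fun=> 1) 1 (phi1 phi b) by apply: comp_size.
have h2 : homog (fun=> 1) 2 (phi2 phi s) by apply: comp_size.
have e1 : phi1 phi s = \sum_c phi s [:: c] *: gen c.
  exact: (size1E (@comp_size _ 1 (phi s))).
have := phi12_anticomm phi_full phi_full_sq0 sf.
move=> /(congr1 (fun f => \sum_u f [:: [set u]%SET; t])) /=.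
rewrite [RHS]big1 // => h; move: h.
under eq_bigr => u _.
  rewrite serDE (der1_word2 deg _ _ h1 h2).
  rewrite e1 linear_sum ser_sumE /=.
  rewrite simplex_deg1 expN1r mulN1r; over.
rewrite /= !big_split /= sumrN exchange_big /=.
rewrite [X in X - _]big1 => [|e _]; last first.
  have [e0|nz] := eqVneq (phi2 phi s [:: e; t]) 0.
    by rewrite big1 // => u _; rewrite e0 mulr0.
  have ef : e \in full.
    rewrite inE; have /andP[] // : (e != finset.set0) && (e \subset s).
    by apply: (phi_face sf (w := [:: e; t])) => //; rewrite inE eqxx.
  by rewrite -mulr_suml [X in X * _](phi_aug ef) mul0r.
rewrite sub0r exchange_big /= (bigD1 s) //= -mulr_sumr.
rewrite [X in - (_ + X)]big1 ?addr0 => [|e ne]; last first.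
  rewrite -mulr_sumr; apply/eqP; rewrite mulf_eq0 orbC.
  by rewrite [X in X == 0](off _ _ sf ne) eqxx.
rewrite [X in _ + X]exchange_big /= (bigD1 t) //=.
under [X in _ + (X + _)]eq_bigr do rewrite linearZZ /= der_gen serE.
rewrite -mulr_sumr ct [X in _ + (_ + X)]big1 ?addr0 => [|e ne]; last first.
  under eq_bigr do rewrite linearZZ /= der_gen serE.
  rewrite -mulr_sumr; have [e0|e0] := eqVneq e finset.set0.
    by rewrite e0 /comp /= phi_word1_set0 // mul0r.
  by rewrite [X in _ * X]off ?mulr0 ?inE // eq_sym.
rewrite /phi1 /comp /= phi_word1 // => /eqP.
rewrite -mulrN -mulrDr mulf_eq0 (negPf (boundary_face vs)) /= addr_eq0 => /eqP e.
exact: oppr_inj e.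
Qed.

End FixedDimension.
End SimplexModel.

(** * Exactness for the model of a complex *)

Section Components.
Variables (V : finType) (Y : {set {set V}}).
Hypothesis hY : simplicial_complex Y.
Implicit Types (s t : {set V}) (u v w : V).

Definition adj u v := [set u; v]%SET \in Y.

Lemma adj_sym u v : adj u v = adj v u.
Proof. by rewrite /adj finset.setUC. Qed.

Lemma adj_connect_sym : connect_sym adj.
Proof. exact/sym_connect_sym/adj_sym. Qed.

Lemma adj_mem s u v : s \in Y -> u \in s -> v \in s -> adj u v.
Proof.
move=> sY us vs; apply: (hY.2 s) => //.
  by apply/fintype.subsetP => x; rewrite !inE => /orP[/eqP->|/eqP->].
by apply/set0Pn; exists u; rewrite !inE eqxx.
Qed.

Lemma root_mem s u v : s \in Y -> u \in s -> v \in s -> fingraph.root adj u = fingraph.root adj v.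
Proof.
move=> sY us vs; apply/eqP; rewrite root_connect; last exact: adj_connect_sym.
exact/connect1/(adj_mem sY).
Qed.

Lemma vertex_mem s v : s \in Y -> v \in s -> [set v]%SET \in Y.
Proof. by move=> sY vs; have := adj_mem sY vs vs; rewrite /adj finset.setUid. Qed.

Lemma mem_neq0 s : s \in Y -> s != finset.set0.
Proof. by move=> sY; apply: contraNneq hY.1 => <-. Qed.

Definition in_comp (r : V) s := [exists v in s, fingraph.root adj v == r].

Lemma in_compP r s v : s \in Y -> v \in s -> in_comp r s = (fingraph.root adj v == r).
Proof.
move=> sY vs; apply/existsP/idP => [[u /andP[us]]|e]; last by exists v; rewrite vs.
by rewrite (root_mem sY us vs).
Qed.

Lemma in_comp_face r s t : s \in Y -> t \subset s -> t != finset.set0 ->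
  in_comp r t = in_comp r s.
Proof.
move=> sY ts t0; have /set0Pn[v vt] := t0.
have tY : t \in Y by apply: (hY.2 s).
by rewrite (in_compP _ tY vt) (in_compP _ sY (fintype.subsetP ts _ vt)).
Qed.

End Components.

Section Classification.
Variables (d : forall n, series {set 'I_n.+1} -> series {set 'I_n.+1}).
Arguments d : clear implicits.
Hypothesis hd : simplex_models d.
Variables (n : nat) (Y : {set {set 'I_n.+1}}).
Hypothesis hY : simplicial_complex Y.
Implicit Types (s t e : {set 'I_n.+1}) (u v : 'I_n.+1).
Implicit Types (f g x y z : series {set 'I_n.+1}).
Local Notation deg := (@simplex_deg n).
Local Notation br := (ser_br deg).
Local Notation phi := (fun s => d n (gen s)).
Local Notation d1 := (der deg (phi1 phi)).
Local Notation d2 := (der deg (phi2 phi)).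
Local Notation adj := (adj Y).
Local Notation rt := (fingraph.root adj).
Local Notation free := (free_hom deg Y).
Local Notation cfree := (cfree_hom deg Y).
Local Notation pt v := (gen [set v]%SET : series {set 'I_n.+1}).

Lemma Y_full s : s \in Y -> s \in full_simplex n.
Proof. by move=> sY; rewrite inE; apply: (mem_neq0 hY). Qed.

Lemma Y_sub_full : Y \subset full_simplex n.
Proof. by apply/fintype.subsetP => s; apply: Y_full. Qed.

Lemma phi_cfree s : s \in Y -> cfree (deg s - 1) (phi s).
Proof.
move=> sY; apply: cfree_mono (model_faces hd (Y_full sY)).
by apply/fintype.subsetP => t; rewrite inE => /andP[t0 ts]; apply: (hY.2 s).
Qed.

Lemma phi_sq0 s : s \in Y -> der deg phi (phi s) = 0.
Proof. by move=> /Y_full; apply: phi_full_sq0. Qed.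

Lemma deg_geN1 s : s \in Y -> -1 <= deg s.
Proof.
move=> /(mem_neq0 hY); rewrite -card_gt0 /simplex_deg.
by move: #|s| => p; lia.
Qed.

Lemma degN1 s : s \in Y -> deg s = -1 -> exists v, s = [set v]%SET.
Proof.
move=> _ e; apply/cards1P; move: e; rewrite /simplex_deg.
by move: #|s| => p; lia.
Qed.

Lemma phi_in_comp r s (w : seq {set 'I_n.+1}) t : s \in Y -> phi s w != 0 -> t \in w ->
  in_comp Y r t = in_comp Y r s.
Proof.
move=> sY nz tw; have /andP[t0 ts] := phi_face hd (Y_full sY) nz tw.
exact: (in_comp_face hY).
Qed.

Lemma in_comp1 r v : [set v]%SET \in Y -> in_comp Y r [set v]%SET = (rt v == r).
Proof. by move=> vY; rewrite (in_compP hY _ vY (set11 v)). Qed.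

Definition aug (P : pred 'I_n.+1) t : rat := \sum_(v | P v) (t == [set v]%SET)%:R.

Lemma aug1 P v : aug P [set v]%SET = (P v)%:R.
Proof.
rewrite /aug big_mkcond (bigD1 v) //= eqxx big1 ?addr0 => [|u nu].
  by case: ifP.
by rewrite (inj_eq set1_inj) [v == u]eq_sym (negPf nu) if_same.
Qed.

Lemma aug_neq0 P t : aug P t != 0 -> exists2 v, t = [set v]%SET & P v.
Proof.
move=> nz; have [v /andP[Pv /eqP tv]] : exists v, P v && (t == [set v]%SET).
  apply/existsP; apply: contraNT nz => /existsPn h.
  rewrite /aug big1 // => v Pv; have := h v; rewrite Pv /=.
  by case: (t == _).
by exists v.
Qed.

Lemma sum_aug P (F : {set 'I_n.+1} -> rat) :
  \sum_t aug P t * F t = \sum_(v | P v) F [set v]%SET.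
Proof.
under eq_bigr do rewrite mulr_suml.
rewrite exchange_big /=; apply: eq_bigr => v _.
by rewrite (bigD1 [set v]%SET) //= eqxx mul1r big1 ?addr0 // => t /negPf->; rewrite mul0r.
Qed.

(** All vertices of a simplex lie in the same component. *)
Lemma sum_component r s (F : 'I_n.+1 -> rat) : s \in Y ->
  (forall v, F v != 0 -> v \in s) ->
  \sum_(v | rt v == r) F v = (in_comp Y r s)%:R * \sum_v F v.
Proof.
move=> sY hF; rewrite big_mkcond mulr_sumr; apply: eq_bigr => v _.
have [->|/hF vs] := eqVneq (F v) 0; first by rewrite mulr0 if_same.
by rewrite (in_compP hY r sY vs); case: eqP; rewrite ?mul1r ?mul0r.
Qed.

Lemma phi_vertex s (w : seq {set 'I_n.+1}) v : s \in Y -> phi s w != 0 ->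
  [set v]%SET \in w -> v \in s.
Proof.
move=> sY nz vw; have /andP[_] := phi_face hd (Y_full sY) nz vw.
by rewrite finset.sub1set.
Qed.

Lemma phi_aug_comp r s : s \in Y -> \sum_(v | rt v == r) phi s [:: [set v]%SET] = 0.
Proof.
move=> sY; rewrite (sum_component r sY) ?(phi_aug hd (Y_full sY)) ?mulr0 // => v nz.
by apply: (phi_vertex sY nz); rewrite mem_head.
Qed.

Lemma phi_counit_comp r s t : s \in Y ->
  \sum_(v | rt v == r) phi s [:: [set v]%SET; t] = - ((t == s) && in_comp Y r s)%:R.
Proof.
move=> sY; rewrite (sum_component r sY) => [|v nz].
  by rewrite (phi_counit hd t (Y_full sY)) mulrN -natrM mulnb andbC.
by apply: (phi_vertex sY nz); rewrite mem_head.
Qed.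

Lemma phi_counit_right r s t : s \in Y ->
  \sum_(v | rt v == r) phi s [:: t; [set v]%SET] =
  (-1) ^ deg s * ((t == s) && in_comp Y r s)%:R.
Proof.
move=> sY; have F2 := phi2_free phi_cfree sY.
have E v : phi s [:: t; [set v]%SET] = - ((-1) ^ deg t * phi s [:: [set v]%SET; t]).
  have := antisym2 t [set v]%SET F2; rewrite simplex_deg1 mulrN1.
  by rewrite !sgnE.
under eq_bigr do rewrite E.
rewrite sumrN -mulr_sumr phi_counit_comp // mulrN opprK.
by have [->|] := eqVneq t s; rewrite ?mulr0.
Qed.

Lemma vertex_sqr v : phi [set v]%SET = - (pt v ** pt v).
Proof. exact: vertex_sq. Qed.

Lemma phi1_vertex v : phi1 phi [set v]%SET = 0.
Proof.
have l1 : low 1 (pt v) by apply: low1.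
by rewrite /phi1 vertex_sqr linearN /= (comp_low _ (low_mul l1 l1)) ?oppr0.
Qed.

Lemma phi2_vertex v : phi2 phi [set v]%SET = - (pt v ** pt v).
Proof.
rewrite /phi2 vertex_sqr linearN /= comp_id //.
exact: (homog_mul (i := 1) (j := 1) (homog_gen (fun=> 1) (b := _)) (homog_gen (fun=> 1) (b := _))).
Qed.

Lemma pt_deg v : homog deg (-1) (pt v).
Proof. by rewrite -(simplex_deg1 v); apply: homog_gen. Qed.

Lemma pt_free v : [set v]%SET \in Y -> free (-1) (pt v).
Proof. by move=> vY; rewrite -(simplex_deg1 v); apply: free_gen. Qed.

Lemma alg0 f : alg (fun _ _ : {set 'I_n.+1} => 0 : rat) f = f [::] *: one.
Proof.
apply: serP => -[|c w]; rewrite serE /alg /=; first by rewrite mulr1.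
by rewrite mulr0 big1 // => b _; rewrite mul0r.
Qed.

Lemma lin0 s : lin (fun _ _ : {set 'I_n.+1} => 0 : rat) s = 0.
Proof. by rewrite /lin big1 // => t _; rewrite scale0r. Qed.

Section Hop.
Variables (h : {set 'I_n.+1} -> rat) (Pi : {set 'I_n.+1} -> {set 'I_n.+1} -> rat).
Local Notation hopn := (hop deg h Pi).

Lemma hop_gen s : hopn (gen s) = h s *: one.
Proof. exact: skew_gen. Qed.

Lemma hop_gen_mul s g : hopn (gen s ** g) =
  h s *: g + (-1 : rat) ^ deg s *: (lin Pi s ** hopn g).
Proof. by rewrite /hop skew_gen_mul lin_tw !cmulZl cmul1l. Qed.

Lemma hop_size1 f : homog (fun=> 1) 1 f -> hopn f = (\sum_s h s * f [:: s]) *: one.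
Proof.
move=> hf; rewrite {1}(size1E hf) linear_sum scaler_suml; apply: eq_bigr => s _.
by rewrite linearZZ /= hop_gen scalerA mulrC.
Qed.

Lemma hop_size2 f : homog (fun=> 1) 2 f ->
  hopn f = \sum_t (\sum_s h s * f [:: s; t]) *: gen t +
          \sum_s ((-1) ^ deg s * \sum_t h t * f [:: s; t]) *: lin Pi s.
Proof.
move=> hf; rewrite {1}(size2E hf) linear_sum /=.
under eq_bigr do rewrite linear_sum /=.
have E s t : hopn (f [:: s; t] *: (gen s ** gen t)) =
  (h s * f [:: s; t]) *: gen t +
  ((-1) ^ deg s * (h t * f [:: s; t])) *: lin Pi s.
  rewrite linearZZ /= hop_gen_mul hop_gen cmulZr cmul1r scalerDr !scalerA.
  by congr (_ *: _ + _ *: _); ring.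
under eq_bigr do under eq_bigr do rewrite E.
under eq_bigr do rewrite big_split.
rewrite big_split /= exchange_big; congr (_ + _).
  by apply: eq_bigr => t _; rewrite -scaler_suml.
by apply: eq_bigr => s _; rewrite -scaler_suml mulr_sumr.
Qed.
End Hop.

(** By phi_counit, the negative of the augmentation contracts the whole tensor
    algebra, that is, Pi = 0 in the homotopy formula. *)
Lemma exact_zero : exact_at deg Y phi 0.
Proof.
pose h t : rat := - aug xpredT t.
have sumh (F : {set 'I_n.+1} -> rat) : \sum_t h t * F t = - \sum_v F [set v]%SET.
  by under eq_bigr do rewrite mulNr; rewrite sumrN sum_aug.
apply: (@exactness _ deg Y phi phi_cfree phi_sq0 0 h (fun _ _ => 0)).
- exact: free_zero.
- exact: homog_zero.
- exact: linear0.
- exact: deg_geN1.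
- by move=> t; rewrite oppr_eq0 => /aug_neq0[v -> _]; apply: simplex_deg1.
- by move=> s t _; rewrite eqxx.
- move=> s sY; rewrite lin0 linear0 alg0.
  by rewrite (free_nil (phi1_free phi_cfree sY)) scale0r.
- move=> s sY; rewrite lin0 linear0 alg0.
  have F : free (-1 + deg s) (br 0 (gen s)) by rewrite br0l; apply: free_zero.
  by rewrite /phiD br0l addr0 (free_nil (phi2_free phi_cfree sY)) scale0r.
- move=> s sY; rewrite hop_size1; last exact: comp_size.
  by rewrite sumh (phi_aug hd (Y_full sY)) oppr0 scale0r.
- move=> s sY; rewrite /phiD br0l addr0 lin0 subr0 hop_size2; last exact: comp_size.
  rewrite [X in _ + X]big1 ?addr0 => [|t _]; last by rewrite lin0 scaler0.
  rewrite (bigD1 s) //= sumh (phi_counit hd s (Y_full sY)) eqxx opprK scale1r.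
  rewrite big1 ?addr0 // => t nt.
  by rewrite sumh (phi_counit hd t (Y_full sY)) (negPf nt) mulr0n !oppr0 scale0r.
- by move=> s _ _; exists 0; [exact: supp_zero|rewrite lin0 linear0].
Qed.

(** Telescoping sum of the edges of a path, with the signs of their
    orientations. *)
Lemma vertex_path u v : connect adj u v ->
  exists2 e, free 0 e /\ homog (fun=> 1) 1 e & d1 e = pt u - pt v.
Proof.
move=> /connectP[p]; elim: p u => [|w p IH] u /=.
  move=> _ ->; exists 0; last by rewrite linear0 subrr.
  by split; [exact: free_zero|exact: homog_zero].
move=> /andP[uw pw] e; have [c [Fc sc] hc] := IH w pw e.
have [b [Fb sb] hb] : exists2 b, free 0 b /\ homog (fun=> 1) 1 b & d1 b = pt u - pt w.
  have dg (x y : 'I_n.+1) : (x < y)%N -> deg [set x; y]%SET = 0.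
    by move=> xy; rewrite /simplex_deg cards2; case: eqP xy => // ->; rewrite ltnn.
  have Fe (x y : 'I_n.+1) : (x < y)%N -> adj x y -> free 0 (gen [set x; y]%SET).
    by move=> xy a; rewrite -(dg _ _ xy); apply: free_gen.
  case: (ltngtP u w) => h.
  - exists (- gen [set u; w]%SET); last first.
      by rewrite linearN /= der_gen (phi_edge hd h) opprB.
    rewrite -scaleN1r; split; first by apply/free_scale/Fe.
    exact/homogZ/homog_gen.
  - rewrite adj_sym in uw; exists (gen [set w; u]%SET).
      by split; [exact: Fe|apply: homog_gen].
    by rewrite der_gen (phi_edge hd h).
  - have -> : u = w by apply: val_inj.
    exists 0; last by rewrite linear0 subrr.
    by split; [exact: free_zero|exact: homog_zero].
exists (b + c); last by rewrite linearD /= hb hc addrA subrK.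
by split; [exact: freeD|exact: homogD].
Qed.

(** Let r be the component of a. The morphism alg Pi kills the simplices
    outside r, replaces the vertices v of r by v - a, and fixes the other
    simplices of r. Its image is stable under the differential twisted by a,
    and by phi_counit the augmentation of r contracts the tensor algebra onto
    it. There the letters v - a of degree -1 are boundaries, as exactness
    requires. *)
Lemma exact_vertex a : [set a]%SET \in Y -> exact_at deg Y phi (pt a).
Proof.
move=> aY; pose r := rt a; pose h := aug (fun v => rt v == r).
pose chi s : rat := (in_comp Y r s)%:R.
pose Pi s t : rat := chi s * idm s t - h s * idm [set a]%SET t.
have ha : h [set a]%SET = 1 by rewrite /h aug1 eqxx.
have ca : chi [set a]%SET = 1 by rewrite /chi in_comp1 // eqxx.
have linPi s : lin Pi s = chi s *: gen s - h s *: pt a.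
  rewrite -!lin_idm /lin !scaler_sumr -sumrB; apply: eq_bigr => t _.
  by rewrite !scalerA -scalerBl.
have linPia : lin Pi [set a]%SET = 0 by rewrite linPi ca ha subrr.
have hdeg s : h s != 0 -> deg s = -1 by move=> /aug_neq0[v -> _]; apply: simplex_deg1.
have hsg s : (-1 : rat) ^ deg s * h s = - h s.
  by have [->|/hdeg ->] := eqVneq (h s) 0; rewrite ?mulr0 ?oppr0 // expN1r mulN1r.
have hchi s : s \in Y -> h s != 0 -> chi s = 1.
  by move=> sY /aug_neq0[v sv rv]; rewrite /chi sv in_comp1 -?sv // rv.
have chih s : s \in Y -> chi s * h s = h s.
  by move=> sY; have [->|/(hchi _ sY) ->] := eqVneq (h s) 0; rewrite ?mulr0 ?mul1r.
have chi2 s : chi s * chi s = chi s by rewrite /chi; case: in_comp; rewrite ?mul1r ?mul0r.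
have br_pt s : br (pt a) (gen s) = pt a ** gen s - (-1 : rat) ^ deg s *: (gen s ** pt a).
  by rewrite (brE (pt_deg (v := a)) (homog_gen deg (b := s))) mulN1r !sgnE.
have counitL s t : s \in Y -> \sum_b h b * phi s [:: b; t] = - ((t == s)%:R * chi s).
  move=> sY; rewrite (sum_aug _ (fun b => phi s [:: b; t])) phi_counit_comp //.
  by rewrite -natrM mulnb.
have counitR s t : s \in Y ->
    \sum_b h b * phi s [:: t; b] = (-1) ^ deg s * ((t == s)%:R * chi s).
  move=> sY; rewrite (sum_aug _ (fun b => phi s [:: t; b])) phi_counit_right //.
  by rewrite -natrM mulnb.
have sg2 s : (-1 : rat) ^ deg s * (-1) ^ deg s = 1.
  by rewrite signzE -expr2 sqrr_sign.
have phiDa : phiD deg phi (pt a) [set a]%SET = pt a ** pt a.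
  rewrite /phiD phi2_vertex br_pt simplex_deg1 expN1r scaleN1r opprK.
  by rewrite addrA addNr add0r.
apply: (@exactness _ deg Y phi phi_cfree phi_sq0 (pt a) h Pi).
- exact: pt_free.
- exact: homog_gen.
- by rewrite der_gen phi1_vertex.
- exact: deg_geN1.
- exact: hdeg.
- move=> s t sY nz; have [->|nts] := eqVneq t s; first by [].
  have hs : h s != 0.
    apply: contra_neq nz => e; rewrite /Pi e mul0r subr0 /idm eq_sym.
    by rewrite (negPf nts) mulr0.
  have ta : t = [set a]%SET.
    apply/eqP; apply: contra_neqT nz => nta; rewrite /Pi /idm.
    by rewrite [s == t]eq_sym (negPf nts) eq_sym (negPf nta) !mulr0 subrr.
  by rewrite ta aY simplex_deg1 hdeg.
- move=> s sY; rewrite linPi linearB !linearZZ /= !der_gen phi1_vertex scaler0 subr0.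
  have e1 := size1E (@comp_size _ 1 (phi s)) : phi1 phi s = _.
  rewrite [in RHS]e1 linear_sum /=.
  have E t : alg Pi (phi s [:: t] *: gen t) =
      (chi s * phi s [:: t]) *: gen t - (h t * phi s [:: t]) *: pt a.
    rewrite linearZZ /= alg_gen linPi scalerBr !scalerA [h t * _]mulrC.
    have [->|nz] := eqVneq (phi s [:: t]) 0; first by rewrite !(mul0r, mulr0).
    have tt : t \in [:: t] by rewrite mem_head.
    rewrite /chi (phi_in_comp r sY nz tt).
    by congr (_ *: _ - _); apply: mulrC.
  under eq_bigr do rewrite E.
  rewrite sumrB -scaler_suml (sum_aug _ (fun b => phi s [:: b])).
  rewrite phi_aug_comp // scale0r subr0.
  under eq_bigr do rewrite -scalerA.
  by rewrite -scaler_sumr -e1.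
- move=> s sY; rewrite linPi linearB !linearZZ /= !der_gen phiDa.
  rewrite /phiD (linearD (alg Pi)) /= br_pt (linearB (alg Pi)) (linearZZ (alg Pi)) /= !alg_mul !alg_gen linPia.
  rewrite cmul0l cmul0r scaler0 subrr addr0.
  have e2 := size2E (@comp_size _ 2 (phi s)) : phi2 phi s = _.
  rewrite [in RHS]e2 linear_sum /=.
  under [RHS]eq_bigr do rewrite linear_sum /=.
  have E t t' : alg Pi (phi s [:: t; t'] *: (gen t ** gen t')) =
      chi s *: (phi s [:: t; t'] *: (gen t ** gen t'))
      - (chi s * (h t * phi s [:: t; t'])) *: (pt a ** gen t')
      - (chi s * (h t' * phi s [:: t; t'])) *: (gen t ** pt a)
      + (h t' * (h t * phi s [:: t; t'])) *: (pt a ** pt a).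
    have [e0|nz] := eqVneq (phi s [:: t; t']) 0.
      rewrite e0 !(mulr0, scale0r, scaler0) (linear0 (alg Pi)).
      by apply: serP => w; rewrite !(serBE, serE); ring.
    have tt : t \in [:: t; t'] by rewrite mem_head.
    have tt' : t' \in [:: t; t'] by rewrite !inE eqxx orbT.
    have c1 : chi t = chi s by rewrite /chi (phi_in_comp r sY nz tt).
    have c2 : chi t' = chi s by rewrite /chi (phi_in_comp r sY nz tt').
    rewrite linearZZ /= alg_mul !alg_gen !linPi c1 c2.
    rewrite !(cmulBl, cmulBr, cmulZl, cmulZr); apply: serP => w.
    rewrite !(serBE, serE); have := chi2 s; set c := chi s => c3.
    by ring: c3.
  under [RHS]eq_bigr do under eq_bigr do rewrite E.
  under [RHS]eq_bigr do rewrite big_split !sumrB /=.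
  rewrite big_split !sumrB /=.
  under [X in _ = X - _ - _ + _]eq_bigr do rewrite -scaler_sumr.
  rewrite -scaler_sumr -e2.
  have -> : \sum_t \sum_t' (chi s * (h t * phi s [:: t; t'])) *: (pt a ** gen t') =
     - chi s *: (pt a ** gen s).
    rewrite exchange_big /= (bigD1 s) //= -scaler_suml -mulr_sumr counitL //.
    rewrite eqxx mul1r mulrN chi2 big1 ?addr0 // => t nt.
    by rewrite -scaler_suml -mulr_sumr counitL // (negPf nt) mulr0n mul0r oppr0 mulr0 scale0r.
  have -> : \sum_t \sum_t' (chi s * (h t' * phi s [:: t; t'])) *: (gen t ** pt a) =
     (chi s * (-1) ^ deg s) *: (gen s ** pt a).
    rewrite (bigD1 s) //= -scaler_suml -mulr_sumr counitR //.
    rewrite eqxx mul1r mulrCA chi2 mulrC big1 ?addr0 // => t nt.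
    by rewrite -scaler_suml -mulr_sumr counitR // (negPf nt) mulr0n mul0r !mulr0 scale0r.
  have -> : \sum_t \sum_t' (h t' * (h t * phi s [:: t; t'])) *: (pt a ** pt a) =
     - h s *: (pt a ** pt a).
    rewrite exchange_big /= (bigD1 s) //= -scaler_suml -mulr_sumr counitL //.
    rewrite eqxx mul1r mulrN mulrC chih // big1 ?addr0 // => t nt.
    by rewrite -scaler_suml -mulr_sumr counitL // (negPf nt) mulr0n mul0r oppr0 mulr0 scale0r.
  by apply: serP => w; rewrite !(serBE, serE); ring.
- move=> s sY; rewrite hop_size1; last exact: comp_size.
  by rewrite (sum_aug _ (fun b => phi s [:: b])) phi_aug_comp // scale0r.
- move=> s sY; rewrite /phiD (linearD (hop deg h Pi)) /= br_pt (linearB (hop deg h Pi)) (linearZZ (hop deg h Pi)) /= !hop_gen_mul !hop_gen.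
  rewrite linPia cmul0l scaler0 addr0 ha scale1r cmulZr cmul1r scale1r.
  rewrite hop_size2; last exact: comp_size.
  have -> : \sum_t (\sum_b h b * phi2 phi s [:: b; t]) *: gen t = - chi s *: gen s.
    rewrite (bigD1 s) //= [X in X *: _](counitL s s sY) eqxx mul1r big1 ?addr0 // => t nt.
    by rewrite [X in X *: _](counitL s t sY) (negPf nt) mulr0n mul0r oppr0 scale0r.
  have -> : \sum_t ((-1) ^ deg t * \sum_b h b * phi2 phi s [:: t; b]) *: lin Pi t =
      chi s *: lin Pi s.
    rewrite (bigD1 s) //= [X in (_ * X) *: _](counitR s s sY) eqxx mul1r mulrA sg2 mul1r.
    rewrite big1 ?addr0 // => t nt.
    by rewrite [X in (_ * X) *: _](counitR s t sY) (negPf nt) mulr0n mul0r !mulr0 scale0r.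
  have := chih s sY; have := hsg s; have := sg2 s; have := chi2 s; rewrite linPi.
  move=> e1 e2 e3 e4; apply: serP => w; rewrite !(serBE, serE).
  move: e1 e2 e3 e4; move: (chi s) (h s) ((-1 : rat) ^ deg s) (gen s w) (pt a w).
  move=> c1 h1 s1 x1 x2 e1 e2 e3 e4.
  rewrite [s1 * (_ + _)]mulrDr [s1 * (s1 * _)]mulrA [s1 * (h1 * _)]mulrA e2 e3.
  by rewrite [c1 * (_ - _)]mulrBr ![c1 * (_ * _)]mulrA e1 e4; ring.
- move=> s sY /(degN1 sY)[v sv]; rewrite sv in sY *.
  rewrite linPi /chi (in_comp1 _ sY) /h aug1.
  case: (rt v =P r) => [e|_]; last by exists 0; rewrite ?linear0 ?scale0r ?subrr //; exact: supp_zero.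
  have cva : connect adj v a.
    by rewrite -(root_connect (adj_connect_sym Y)); apply/eqP.
  by have [b [Fb _] hb] := vertex_path cva; exists b; rewrite ?hb ?scale1r //; exact: free_supp Fb.
Qed.

End Classification.

(** * Gauge orbits of Maurer-Cartan elements *)

(** The term of order l of the path (t x) . z is the difference of the
    corresponding terms of the two exponential series. *)
Lemma gauge_gact (B : finType) (deg : B -> int) (S : {set B})
  (phi : B -> series B) (D : series B -> series B) (x z y : series B) :
  (forall b, b \in S -> cfree_hom deg S (deg b - 1) (phi b)) ->
  (forall k f, cfree_hom deg S k f -> D f = der deg phi f) ->
  cfree_hom deg S 0 x -> cfree_hom deg S (-1) z ->
  gauge (L := @DgLie (cfree_lie deg S) D) x z y <-> y = gact deg phi x z.
Proof.
move=> hphi hD cx cz; set L := DgLie _.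
pose u i : series B := (i`!%:R^-1 : rat) *: iter i (ser_br deg x) z.
pose v i : series B := (i.+1`!%:R^-1 : rat) *: iter i (ser_br deg x) (D x).
have cDx : cfree_hom deg S (-1) (D x).
  by rewrite (hD _ _ cx) -[-1]add0r; apply: der_cfree.
have citer f i : cfree_hom deg S (-1) f -> cfree_hom deg S (-1) (iter i (ser_br deg x) f).
  by move=> cf; elim: i => //= i IH; rewrite -[-1]add0r; apply: cfree_br.
have liter f i : cfree_hom deg S (-1) f -> low i.+1 (iter i (ser_br deg x) f).
  move=> cf; elim: i => /= [|i IH]; first exact: cfree_low cf.
  by rewrite -add1n; apply: low_br IH; exact: cfree_low cx.
have cu i : cfree_hom deg S (-1) (u i) by apply/cfreeZ/citer.
have cv i : cfree_hom deg S (-1) (v i) by apply/cfreeZ/citer.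
have gsE N : \sum_(i < N.+1) gs deg phi x z i = \sum_(0 <= i < N.+1) u i - \sum_(0 <= i < N) v i.
  have g0 : gs deg phi x z 0 = u 0%N by rewrite /u /= invr1 scale1r.
  have gS i : gs deg phi x z i.+1 = u i.+1 - v i.
    elim: i => [|i IH].
      by rewrite /u /v /= !invr1 !scale1r (hD _ _ cx).
    rewrite [LHS]/= subr0 -[X in ser_br deg x X]/(gs deg phi x z i.+1) IH.
    rewrite brBr /u /v !brZr scalerBr !scalerA /=.
    by congr (_ *: _ - _ *: _); rewrite [in RHS]factS natrM invfM.
  have -> : \sum_(i < N.+1) gs deg phi x z i = u 0%N + \sum_(i < N) (u i.+1 - v i).
    by rewrite big_ord_recl -g0; congr (_ + _); apply: eq_bigr => i _; apply: gS.
  by rewrite !big_mkord [in RHS]big_ord_recl sumrB addrA.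
have lowu N M : (N <= M)%N -> low N (\sum_(0 <= i < M) u i - \sum_(0 <= i < N) u i).
  move=> NM; rewrite (big_cat_nat (n := N) (p := M)) //= addrAC subrr add0r.
  rewrite big_nat_cond; apply: low_sum => i /andP[/andP[h _] _]; apply: lowZ.
  by apply: (low_le _ (liter _ _ cz)); lia.
have lowv N M : (N <= M)%N -> low N (\sum_(0 <= i < M) v i - \sum_(0 <= i < N) v i).
  move=> NM; rewrite (big_cat_nat (n := N) (p := M)) //= addrAC subrr add0r.
  rewrite big_nat_cond; apply: low_sum => i /andP[/andP[h _] _]; apply: lowZ.
  by apply: (low_le _ (liter _ _ cDx)); lia.
have glow N : low N (gact deg phi x z - (\sum_(0 <= i < N.+1) u i - \sum_(0 <= i < N) v i)).
  rewrite -gsE; apply: (@low_le _ N N.+1) => //.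
  exact: (@gact_low _ deg S phi hphi x z cx N.+1).
have mk (a : nat -> series B) : (forall i, cfree_hom deg S (-1) (a i)) ->
   (forall N M, (N <= M)%N -> low N (\sum_(0 <= i < M) a i - \sum_(0 <= i < N) a i)) ->
   exists s, sums_to (L := cfree_lie deg S) (-1) a s.
  move=> ca la; exists (fun w => (\sum_(0 <= i < (size w).+1) a i) w).
  set s := fun w => _.
  have ls N : low N (s - \sum_(0 <= i < N) a i : series B).
    move=> w sw; rewrite serBE /s.
    by have := la _ _ sw w (ltnSn _); rewrite serBE => h; rewrite -opprB h oppr0.
  have cs : cfree_hom deg S (-1) s.
    apply/cfreeP => m; rewrite (_ : comp m s = comp m (\sum_(0 <= i < m.+1) a i)).
      by apply: cfree_comp; apply: cfree_sum.
    apply: serP => w; rewrite /comp; case: eqP => // e.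
    by have := ls m.+1 w; rewrite e ltnSn serBE => /(_ isT)/eqP; rewrite subr_eq0 => /eqP.
  apply/(sums_toP _ ca); split => // N; exists N => M NM.
  by apply: low_le (ls M).
have key s t : sums_to (L := cfree_lie deg S) (-1) u s ->
    sums_to (L := cfree_lie deg S) (-1) v t -> s - t = gact deg phi x z.
  move=> /(sums_toP _ cu)[cs hs] /(sums_toP _ cv)[ct ht].
  apply: low_eq => N; have [N1 h1] := hs N; have [N2 h2] := ht N.
  pose M := maxn N (maxn N1 N2).
  have -> : s - t - gact deg phi x z = (s - \sum_(0 <= i < M.+1) u i)
     - (t - \sum_(0 <= i < M) v i)
     - (gact deg phi x z - (\sum_(0 <= i < M.+1) u i - \sum_(0 <= i < M) v i)).
    by apply: serP => w; rewrite !(serBE, serE); ring.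
  apply: lowB; last by apply: low_le (glow M); rewrite leq_maxl.
  by apply: lowB; [apply: h1|apply: h2]; rewrite /M; lia.
split=> [[s [t [/(sums_toP _ cu) hs /(sums_toP _ cv) ht ->]]]|->].
  by apply: key; apply/sums_toP.
have [s hs] := mk u cu lowu; have [t ht] := mk v cv lowv.
by exists s, t; split => //; rewrite (key s t).
Qed.

Section MaurerCartanClasses.
Variables (d : forall n, series {set 'I_n.+1} -> series {set 'I_n.+1}).
Arguments d : clear implicits.
Hypothesis hd : simplex_models d.
Variables (n : nat) (Y : {set {set 'I_n.+1}}).
Hypothesis hY : simplicial_complex Y.
Implicit Types (s t e : {set 'I_n.+1}) (u v r : 'I_n.+1).
Implicit Types (f g x y z : series {set 'I_n.+1}).
Local Notation deg := (@simplex_deg n).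
Local Notation br := (ser_br deg).
Local Notation phi := (fun s => d n (gen s)).
Local Notation d1 := (der deg (phi1 phi)).
Local Notation d2 := (der deg (phi2 phi)).
Local Notation adj := (adj Y).
Local Notation rt := (fingraph.root adj).
Local Notation free := (free_hom deg Y).
Local Notation cfree := (cfree_hom deg Y).
Local Notation pt v := (gen [set v]%SET : series {set 'I_n.+1}).
Local Notation mc := (mc deg Y phi).
Local Notation gact := (gact deg phi).
Let pc := phi_cfree hd hY.
Let psq := phi_sq0 hd hY.

(** The masses of the components are the coordinates of the linear part of f
    in degree -1 of the homology of d_1. *)
Definition mass r f : rat := \sum_(v | rt v == r) f [:: [set v]%SET].

Lemma massB r f g : mass r (f - g) = mass r f - mass r g.
Proof. by rewrite /mass -sumrB. Qed.
Lemma mass_comp r f : mass r (comp 1 f) = mass r f.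
Proof. by []. Qed.

Lemma word1_supp f s : supp Y f -> s \notin Y -> f [:: s] = 0.
Proof. by move=> sf sY; apply: (supp0 sf); rewrite /= andbT. Qed.

Lemma mass_d1 r f : supp Y f -> mass r (d1 f) = 0.
Proof.
move=> sf; rewrite -mass_comp (@comp_der1 _ deg Y) //.
rewrite (size1E (@comp_size _ 1 f)) linear_sum /mass.
under eq_bigr do rewrite ser_sumE.
rewrite exchange_big big1 //= => s _.
under eq_bigr do rewrite linearZZ serE /= der_gen.
rewrite -mulr_sumr; have [sY|nsY] := boolP (s \in Y).
  by rewrite [X in _ * X](phi_aug_comp hd hY r sY) mulr0.
by rewrite /comp /= word1_supp // mul0r.
Qed.

Lemma mass_gact r x z : cfree 0 x -> cfree (-1) z -> mass r (gact x z) = mass r z.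
Proof.
move=> cx cz; rewrite -mass_comp (gact_comp1 pc) // massB mass_d1 ?subr0 //.
exact/comp_supp/(cfree_supp cx).
Qed.

Lemma degN1_word1 f s : cfree (-1) f -> f [:: s] != 0 ->
  exists2 v, s = [set v]%SET & [set v]%SET \in Y.
Proof.
move=> cf nz; have sY : s \in Y by have := cfree_supp cf nz; rewrite /= andbT.
have ds : deg s = -1 by have := cfree_homog cf nz; rewrite wdeg_cons wdeg_nil addr0.
by have [v sv] := degN1 sY ds; exists v; rewrite -?sv.
Qed.

Lemma comp1_vertices f : cfree (-1) f ->
  comp 1 f = \sum_v f [:: [set v]%SET] *: pt v.
Proof.
move=> cf; rewrite [LHS](size1E (@comp_size _ 1 f)).
apply: serP => w; rewrite !ser_sumE.
have E s : comp 1 f [:: s] * gen s w = \sum_v (f [:: [set v]%SET] * pt v w) * (s == [set v]%SET)%:R.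
  have [e0|nz] := eqVneq (f [:: s]) 0.
    rewrite /comp /= e0 mul0r big1 // => v _.
    by have [e|] := eqVneq s [set v]%SET; rewrite ?mulr0 // -e e0 !mul0r.
  have [v sv _] := degN1_word1 cf nz; rewrite sv (bigD1 v) //= eqxx mulr1.
  rewrite big1 ?addr0 // => u nu.
  by rewrite (inj_eq set1_inj) [v == u]eq_sym (negPf nu) mulr0.
under eq_bigr do rewrite serE E.
rewrite exchange_big; apply: eq_bigr => v _ /=.
rewrite (bigD1 [set v]%SET) //= eqxx mulr1 serE big1 ?addr0 // => s ns.
by rewrite (negPf ns) mulr0.
Qed.

(** Modulo boundaries, each vertex can be moved to the chosen vertex of its
    component, where the coefficients add up to the mass. *)
Lemma mass0_boundary f : cfree (-1) f -> (forall r, mass r f = 0) ->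
  exists2 e, free 0 e /\ homog (fun=> 1) 1 e & d1 e = comp 1 f.
Proof.
move=> cf h0.
have path v : exists b, (free 0 b /\ homog (fun=> 1) 1 b) /\ d1 b = pt v - pt (rt v).
  by have [b hb e] := vertex_path hd (connect_root adj v); exists b.
have [b hb] := choice path.
exists (\sum_v f [:: [set v]%SET] *: b v).
  split; first by apply: free_sum => v _; apply/free_scale; case: (hb v) => -[].
  by apply: homog_sum => v _; apply/homogZ; case: (hb v) => -[].
rewrite linear_sum /= comp1_vertices //.
under eq_bigr do rewrite linearZZ /= (hb _).2 scalerBr.
rewrite sumrB [X in _ - X](partition_big rt xpredT) //= [X in _ - X]big1 ?subr0 // => r _.
rewrite (eq_bigr (fun v => f [:: [set v]%SET] *: pt r)) => [|v /eqP-> //].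
by rewrite -scaler_suml [X in X *: _]h0 scale0r.
Qed.

(** The quadratic term of the Maurer-Cartan equation, projected to the
    homology of the linear part, says that the masses are orthogonal
    idempotents. *)
Lemma mass_idem y r r' : mc y -> mass r y * mass r' y = (r == r')%:R * mass r y.
Proof.
move=> [cy ey]; have ly := cfree_low cy; have sy := cfree_supp cy.
have := comp_der_next pc sy ly; rewrite ey linearN linearZZ /=.
rewrite (comp_br_lead deg ly ly).
have h1 : homog deg (-1) (comp 1 y) by apply/comp_homog/(cfree_homog cy).
rewrite (brE h1 h1) /= !sgnE /= expr1 scaleN1r opprK.
have -> : - ((1 / 2 : rat) *: (comp 1 y ** comp 1 y + comp 1 y ** comp 1 y)) =
   - (comp 1 y ** comp 1 y).
  by apply: serP => w; rewrite !serE; field.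
set c := comp 1 y => e.
have cE v : c [:: [set v]%SET] = y [:: [set v]%SET] by [].
have cN : c [::] = 0 by [].
have := congr1 (fun f => \sum_(v | rt v == r) \sum_(v' | rt v' == r')
    f [:: [set v]%SET; [set v']%SET]) e.
have -> : \sum_(v | rt v == r) \sum_(v' | rt v' == r')
    (- (c ** c)) [:: [set v]%SET; [set v']%SET] = - (mass r y * mass r' y).
  rewrite /mass mulr_suml -sumrN; apply: eq_bigr => v _.
  rewrite mulr_sumr -sumrN; apply: eq_bigr => v' _.
  rewrite serE !mul_cons cN mul0r add0r mul_nil.
  have -> : dl [set v']%SET (dl [set v]%SET c) [::] = 0 by [].
  by rewrite mul0r addr0.
have d2c : d2 c = - \sum_v y [:: [set v]%SET] *: (pt v ** pt v).
  rewrite /c comp1_vertices // linear_sum -sumrN; apply: eq_bigr => v _.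
  by rewrite linearZZ /= der_gen (phi2_vertex hd) scalerN.
have sum_d2 : \sum_(v | rt v == r) \sum_(v' | rt v' == r')
    (d2 c) [:: [set v]%SET; [set v']%SET] = - ((r == r')%:R * mass r y).
  rewrite d2c /mass mulr_sumr -[RHS]sumrN; apply: eq_bigr => v /eqP rv.
  have E v' : (- \sum_u y [:: [set u]%SET] *: (pt u ** pt u)) [:: [set v]%SET; [set v']%SET]
      = - (y [:: [set v]%SET] * (v' == v)%:R).
    rewrite serE ser_sumE (bigD1 v) //= serE gen_gen eqxx mul1r (inj_eq set1_inj).
    rewrite big1 ?addr0 // => u nu; rewrite serE gen_gen (inj_eq set1_inj).
    by rewrite [v == u]eq_sym (negPf nu) mul0r mulr0.
  under eq_bigr do rewrite E.
  rewrite sumrN big_mkcond (bigD1 v) //= eqxx mulr1 rv [X in _ + X]big1 ?addr0 => [|u nu].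
    by case: eqP => _; rewrite ?mul1r ?mul0r.
  by rewrite (negPf nu) mulr0 if_same.
have sum_d1 : \sum_(v | rt v == r) \sum_(v' | rt v' == r')
    (d1 (comp 2 y)) [:: [set v]%SET; [set v']%SET] = 0.
  have hp b : homog (fun=> 1) 1 (phi1 phi b) by apply: comp_size.
  under eq_bigr do under eq_bigr do rewrite (der1_word2 deg _ _ hp (@comp_size _ 2 y)).
  under eq_bigr do rewrite big_split /=.
  rewrite big_split /=.
  have z (F : {set 'I_n.+1} -> rat) q : (forall b, b \notin Y -> F b = 0) ->
      \sum_(v | rt v == q) \sum_b phi1 phi b [:: [set v]%SET] * F b = 0.
    move=> hF; rewrite exchange_big big1 //= => b _; rewrite -mulr_suml.
    have [bY|nb] := boolP (b \in Y); last by rewrite hF ?mulr0.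
    by rewrite [X in X * _](phi_aug_comp hd hY q bY) mul0r.
  rewrite [X in X + _]exchange_big [X in X + _]big1 ?add0r => [|v' _].
    rewrite big1 // => v _.
    under eq_bigr do rewrite mulrC mulr_suml.
    under eq_bigr do under eq_bigr do rewrite -mulrA.
    apply: (z (fun b => comp 2 y [:: [set v]%SET; b] * (-1) ^ deg [set v]%SET)) => b nb.
    rewrite /comp /= (supp0 sy) ?mul0r //=.
    by rewrite (negPf nb) !andbF.
  apply: z => b nb; rewrite /comp /= (supp0 sy) //=.
  by rewrite (negPf nb).
move=> h; rewrite -[LHS]opprK [X in - X]h.
under eq_bigr do rewrite big_split /=.
by rewrite big_split /= sum_d1 add0r sum_d2 opprK.
Qed.

Lemma mc_zero : mc 0.
Proof.
split; first exact: cfree_zero.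
by rewrite linear0 br0r scaler0 oppr0.
Qed.

Lemma mc_pt v : [set v]%SET \in Y -> mc (pt v).
Proof.
move=> vY; split; first exact/free_cfree/pt_free.
by rewrite der_gen (model_vertex hd).
Qed.

Lemma mass_pt r v : mass r (pt v) = (rt v == r)%:R.
Proof.
rewrite /mass big_mkcond (bigD1 v) //= /gen eqxx big1 ?addr0 => [|u nu].
  by case: ifP.
by rewrite eqseq_cons (inj_eq set1_inj) andbT (negPf nu) if_same.
Qed.

Lemma mass_zero r : mass r 0 = 0.
Proof. by rewrite /mass big1. Qed.

(** The component of nonzero mass; by labelP there is at most one. *)
Definition label y : option 'I_n.+1 := [pick r | mass r y != 0].

(** Orthogonal idempotents of a field: at most one mass is nonzero, and it is
    1. *)
Lemma labelP y : mc y ->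
  (label y = None /\ forall r, mass r y = 0) \/
  exists a, [/\ [set a]%SET \in Y, label y = Some (rt a) &
                forall r, mass r y = (rt a == r)%:R].
Proof.
move=> my; rewrite /label; case: pickP => [r nz|h]; last first.
  by left; split => // r; apply/eqP; rewrite -[_ == _]negbK h.
right; have [v /andP[/eqP rv nzv]] : exists v, (rt v == r) && (y [:: [set v]%SET] != 0).
  apply/existsP; apply: contraNT nz => /existsPn h.
  rewrite /mass big1 // => v rv; have := h v; rewrite rv /= negbK => /eqP //.
have [a /set1_inj va aY] := degN1_word1 my.1 nzv.
exists a; rewrite -va rv; split => //; first by rewrite va.
move=> r'; have [<-|nr] := eqVneq r r'.
  have := mass_idem r r my; rewrite eqxx mul1r => e.
  by apply: (mulfI nz); rewrite e mulr1.
have := mass_idem r r' my; rewrite (negPf nr) mul0r => /eqP.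
by rewrite mulf_eq0 (negPf nz) /= => /eqP.
Qed.

(** By labelP and mass0_boundary, the linear part of y is 0 or a vertex up to
    a boundary. *)
Lemma exact_mc y : mc y -> exact_at deg Y phi (comp 1 y).
Proof.
move=> my; case: (labelP my) => [[_ h]|[a [aY _ h]]].
  have [e [Fe se] he] := mass0_boundary my.1 h.
  rewrite -he -[d1 e]add0r.
  exact: (exact_at_shift pc Fe se (exact_zero hd hY)).
have cpt : cfree (-1) (pt a) by apply/free_cfree/pt_free.
have [|e [Fe se] he] := @mass0_boundary (y - pt a) (cfreeB my.1 cpt).
  by move=> r; rewrite massB h mass_pt subrr.
have -> : comp 1 y = pt a + d1 e.
  rewrite he linearB /= [comp 1 (pt a)]comp_id; last exact: homog_gen.
  by rewrite addrC subrK.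
exact: (exact_at_shift pc Fe se (exact_vertex hd hY aY)).
Qed.

(** Elements with the same label have the same masses, so their linear parts
    differ by a boundary d_1 e; the gauge transformation by e makes the linear
    parts equal, and gact_connect does the rest. *)
Lemma gauge_label z y : mc z -> mc y ->
  label y = label z -> exists2 x, cfree 0 x & gact x z = y.
Proof.
move=> mz my e.
have ecc r : mass r y = mass r z.
  move: e; case: (labelP my) => [[-> hy]|[a [_ -> hy]]];
    case: (labelP mz) => [[-> hz]|[b [_ -> hz]]] //.
    by rewrite hy hz.
  by case=> e; rewrite hy hz e.
have [|e1 [Fe se] he] := @mass0_boundary (z - y) (cfreeB mz.1 my.1).
  by move=> r; rewrite massB ecc subrr.
have ce := free_cfree Fe.
apply: (gact_connect pc psq my mz (exact_mc my) ce).
have cW : cfree (-1) (gact e1 z - y).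
  by apply: cfreeB my.1; apply: gact_cfree mz.1.
have := low_rest (cfree_low cW).
rewrite (linearB (comp 1)) /= (gact_comp1 pc ce mz.1) (comp_id se) he (linearB (comp 1)) /=.
by rewrite subKr subrr subr0.
Qed.

Lemma label_gact x z : cfree 0 x -> mc z -> mc (gact x z) /\ label (gact x z) = label z.
Proof.
move=> cx mz; split; first exact: gact_mc mz.1 mz.
by apply: eq_pick => r; rewrite /= mass_gact //; exact: mz.1.
Qed.

Lemma label_pt v : [set v]%SET \in Y -> label (pt v) = Some (rt v).
Proof.
move=> vY; case: (labelP (mc_pt vY)) => [[_ /(_ (rt v))]|[a [_ -> /(_ (rt v))]]].
  by rewrite mass_pt eqxx.
by rewrite mass_pt eqxx; case: eqP => [->|].
Qed.

Lemma label_zero : label 0 = None.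
Proof. by rewrite /label; case: pickP => // r; rewrite mass_zero eqxx. Qed.

Local Notation L := (complex_model d Y).

Lemma model_der k f : cfree k f -> d n f = der deg phi f.
Proof. by move=> /(cfree_mono (Y_sub_full hY)); apply: model_dE. Qed.

Lemma MC_mc y : MC L y <-> mc y.
Proof.
rewrite /MC /mc /=; split => -[cy ey]; split => //.
  by rewrite -(model_der cy).
by rewrite /dg_d /= (model_der cy).
Qed.

Lemma gauge_orbitE z : mc z ->
  gauge_orbit (L := L) z = [set y | mc y /\ label y = label z].
Proof.
move=> mz; apply/seteqP; split => y /=.
  move=> [x cx /(gauge_gact y pc model_der cx mz.1) ->].
  exact: label_gact.
move=> [my e]; have [x cx <-] := gauge_label mz my e.
by exists x => //; apply/(gauge_gact _ pc model_der cx mz.1).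
Qed.

End MaurerCartanClasses.

(** * Path components of realizations *)

Section PathComponents.
Variables (R : realType) (U : finType) (Z : {set {set U}}).
Hypothesis hZ : simplicial_complex Z.
Implicit Types (u v : U) (x y z : {ptws U -> R}) (s : {set U}).
Local Notation A := (realization R Z).

Definition carrier x : {set U} := [set v | x v != 0]%SET.

Lemma ptws_continuous (p : R -> {ptws U -> R}) :
  (forall u, continuous (fun t => p t u)) -> continuous p.
Proof.
move=> h t; apply/cvg_sup => u.
exact: (@continuous_comp_initial {ptws U -> R} R R (fun f => f u) p (h u) t).
Qed.

Lemma coord_continuous (B : set R) (p : R -> {ptws U -> R}) u :
  {within B, continuous p} -> {within B, continuous (fun t => p t u)}.
Proof.
move=> hp t.
exact: (continuous_comp (hp t) (@proj_continuous U (fun=> R) u (p t))).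
Qed.

Lemma sum_continuous (X : topologicalType) (P : pred U) (f : U -> X -> R) :
  (forall u, continuous (f u)) -> continuous (fun t => \sum_(u | P u) f u t).
Proof. by move=> hf t; apply: cvg_big => // [|u _]; [exact: add_continuous|exact: hf]. Qed.

(** Two paths which are constant outside [0, 1] are concatenated by adding
    them and subtracting the common endpoint, so no gluing of continuous maps
    is involved. *)
Definition joined x y := exists p : R -> {ptws U -> R},
  [/\ continuous p, forall t, A (p t), forall t, t <= 0 -> p t = x &
      forall t, 1 <= t -> p t = y].

Lemma joined_path x y : joined x y -> path_joined R A x y.
Proof.
move=> [p [cp Ap p0 p1]]; exists p; split => //.
- exact: continuous_subspaceT.
- exact: p0.
- exact: p1.
Qed.

Lemma joined_sym x y : joined x y -> joined y x.
Proof.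
move=> [p [cp Ap p0 p1]]; exists (fun t => p (1 - t)); split => //.
- move=> t; have ct : {for t, continuous (fun t : R => 1 - t)}.
    by apply: cvgB; [exact: cvg_cst|exact: cvg_id].
  exact: (continuous_comp ct (cp _)).
- by move=> t t0; apply: p1; lra.
- by move=> t t1; apply: p0; lra.
Qed.

Lemma joined_trans y x z : joined x y -> joined y z -> joined x z.
Proof.
move=> [p [cp Ap p0 p1]] [q [cq Aq q0 q1]].
pose r t : {ptws U -> R} := fun u => p (2 * t) u + q (2 * t - 1) u - y u.
have rl t : t <= 1 / 2 -> r t = p (2 * t).
  by move=> h; apply/funext => u; rewrite /r q0 ?addrK //; lra.
have rr t : 1 / 2 <= t -> r t = q (2 * t - 1).
  by move=> h; apply/funext => u; rewrite /r p1; [rewrite addrAC subrr add0r|lra].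
have cc (f : R -> {ptws U -> R}) (a b : R) u : continuous f ->
    continuous (fun t => f (a * t - b) u).
  move=> cf t; have cu : continuous (fun t => f t u).
    by move=> t'; exact: (continuous_comp (cf t') (@proj_continuous U (fun=> R) u (f t'))).
  have ct : {for t, continuous (fun t : R => a * t - b)}.
    by apply: cvgB; [apply: cvgM; [exact: cvg_cst|exact: cvg_id]|exact: cvg_cst].
  exact: (continuous_comp ct (cu _)).
exists r; split.
- apply: ptws_continuous => u t; apply: cvgB; last exact: cvg_cst.
  apply: cvgD; last exact: cc.
  have := cc p 2 0 u cp.
  rewrite (_ : (fun t => p (2 * t - 0) u) = (fun t => p (2 * t) u)); first exact.
  by apply/funext => t'; rewrite subr0.
- by move=> t; case: (leP t (1 / 2)) => h; [rewrite rl|rewrite rr // ltW].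
- by move=> t h; rewrite rl; [apply: p0|]; lra.
- by move=> t h; rewrite rr; [apply: q1|]; lra.
Qed.

Lemma joined_refl x : A x -> joined x x.
Proof. by move=> Ax; exists (fun=> x); split => // t; apply: cvg_cst. Qed.

Definition clamp (t : R) : R := Num.max 0 (Num.min 1 t).

Lemma clamp_continuous : continuous clamp.
Proof.
move=> t; apply: continuous_max; first exact: cvg_cst.
by apply: continuous_min; [exact: cvg_cst|exact: cvg_id].
Qed.

Lemma clamp_ge0 t : 0 <= clamp t. Proof. by rewrite /clamp le_max lexx. Qed.
Lemma clamp_le1 t : clamp t <= 1.
Proof. by rewrite /clamp ge_max ler01 ge_min lexx. Qed.

(** The carrier of a convex combination lies in the union of the carriers. *)
Lemma joined_segment s x y : A x -> A y -> s \in Z ->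
  carrier x \subset s -> carrier y \subset s -> joined x y.
Proof.
move=> [x0 x1 xZ] [y0 y1 yZ] sZ xs ys.
pose p t : {ptws U -> R} := fun u => (1 - clamp t) * x u + clamp t * y u.
exists p; split.
- apply: ptws_continuous => u t; apply: cvgD.
    apply: cvgM; last exact: cvg_cst.
    by apply: cvgB; [exact: cvg_cst|exact: clamp_continuous].
  by apply: cvgM; [exact: clamp_continuous|exact: cvg_cst].
- move=> t; have c0 := clamp_ge0 t; have c1 := clamp_le1 t.
  have sum1 : \sum_u p t u = 1.
    by rewrite big_split -!mulr_sumr /= x1 y1; ring.
  split => //.
    move=> u; rewrite /p; apply: addr_ge0; apply: mulr_ge0 => //.
    by rewrite subr_ge0.
  apply: (hZ.2 s) => //.
    apply/fintype.subsetP => u; rewrite !inE => nz.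
    have [e|n] := eqVneq (x u) 0; last by apply: (fintype.subsetP xs); rewrite inE.
    have [e'|n] := eqVneq (y u) 0; last by apply: (fintype.subsetP ys); rewrite inE.
    by move: nz; rewrite /p e e' !mulr0 addr0 eqxx.
  apply/negP => /eqP e0; have := oner_neq0 R; rewrite -sum1 big1 ?eqxx // => u _.
  by have /setP/(_ u) := e0; rewrite !inE => /negbFE/eqP.
- move=> t t0; apply/funext => u; rewrite /p.
  have -> : clamp t = 0.
    by rewrite /clamp min_r ?max_l //; lra.
  by rewrite subr0 mul1r mul0r addr0.
- move=> t t1; apply/funext => u; rewrite /p.
  have -> : clamp t = 1.
    by rewrite /clamp min_l ?max_r //; lra.
  by rewrite subrr mul0r mul1r add0r.
Qed.

Definition vertex u : {ptws U -> R} := fun v => (v == u)%:R.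

Lemma carrier_vertex u : carrier (vertex u) = [set u]%SET.
Proof.
by apply/setP => v; rewrite !inE /vertex pnatr_eq0 eqb0 negbK.
Qed.

Lemma vertex_in u : [set u]%SET \in Z -> A (vertex u).
Proof.
move=> uZ; split; last by rewrite -/(carrier _) carrier_vertex.
  by move=> v; rewrite /vertex ler0n.
rewrite (bigD1 u) //= /vertex eqxx big1 ?addr0 // => v /negPf -> //.
Qed.

Lemma carrier_in x : A x -> carrier x \in Z. Proof. by case. Qed.

Lemma carrier_pick x : A x -> exists u, u \in carrier x.
Proof. by move=> /carrier_in/(mem_neq0 hZ)/set0Pn. Qed.

Lemma joined_vertex x u : A x -> u \in carrier x -> joined x (vertex u).
Proof.
move=> Ax ux; have xZ := carrier_in Ax.
apply: (joined_segment Ax _ xZ) => //.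
  exact/vertex_in/(vertex_mem hZ xZ).
by rewrite carrier_vertex finset.sub1set.
Qed.

Lemma joined_connect u v : [set u]%SET \in Z -> connect (adj Z) u v ->
  joined (vertex u) (vertex v).
Proof.
move=> uZ /connectP[p]; elim: p u uZ => [|w p IH] u uZ /=.
  by move=> _ ->; apply/joined_refl/vertex_in.
move=> /andP[uw pw] e.
have wZ : [set w]%SET \in Z by apply: (vertex_mem hZ uw); rewrite !inE eqxx orbT.
apply: joined_trans (IH _ wZ pw e).
apply: (joined_segment (vertex_in uZ) (vertex_in wZ) uw); rewrite carrier_vertex finset.sub1set !inE eqxx ?orbT //.
Qed.

Lemma half_neq (b : bool) : b%:R != 1 / 2 :> R.
Proof. by case: b; rewrite ?mulr1n ?mulr0n; apply/eqP => h; lra. Qed.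

(* A labelling of the vertices by the components of the edge graph. *)
Variables (I : eqType) (kappa : U -> I).
Hypothesis kappa_simplex : forall s u v, s \in Z -> u \in s -> v \in s -> kappa u = kappa v.
Hypothesis kappa_connect : forall u v, [set u]%SET \in Z -> [set v]%SET \in Z ->
  kappa u = kappa v -> connect (adj Z) u v.

Lemma kappa_mass x u i : A x -> u \in carrier x ->
  \sum_(v | kappa v == i) x v = (kappa u == i)%:R.
Proof.
move=> Ax ux; case: (Ax) => _ x1 _; rewrite big_mkcond.
have E v : (if kappa v == i then x v else 0) = (kappa u == i)%:R * x v.
  have [->|nz] := eqVneq (x v) 0; first by rewrite mulr0 if_same.
  have -> : kappa v = kappa u.
    have vx : v \in carrier x by rewrite inE.
    exact: (kappa_simplex (carrier_in Ax) vx ux).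
  by case: eqP => _; rewrite ?mul1r ?mul0r.
by under eq_bigr do rewrite E; rewrite -mulr_sumr x1 mulr1.
Qed.

(** Along a path the total mass of the vertices with a given label is
    continuous with values 0 and 1, hence constant. Conversely the segments in
    simplices connect each point to a vertex and the ends of each edge. *)
Lemma path_joinedE x y u v : A x -> A y -> u \in carrier x -> v \in carrier y ->
  path_joined R A x y <-> kappa u = kappa v.
Proof.
move=> Ax Ay ux vy; split; last first.
  move=> e; apply: joined_path.
  have uZ := vertex_mem hZ (carrier_in Ax) ux.
  have vZ := vertex_mem hZ (carrier_in Ay) vy.
  apply: joined_trans (joined_vertex Ax ux) _.
  apply: joined_trans (joined_connect uZ (kappa_connect uZ vZ e)) _.
  exact/joined_sym/joined_vertex.
move=> [p [cp Ap p0 p1]]; apply/eqP/negPn/negP => nuv.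
pose g t := \sum_(w | kappa w == kappa u) p t w.
have cg : {within `[0, 1], continuous g}.
  by apply: sum_continuous => w; apply: coord_continuous.
have g0 : g 0 = 1 by rewrite /g p0 (kappa_mass _ Ax ux) eqxx.
have g1 : g 1 = 0 by rewrite /g p1 (kappa_mass _ Ay vy) eq_sym (negPf nuv).
have [|t] := IVT (ler01 : 0 <= 1 :> R) cg (v := 1 / 2).
  by rewrite g0 g1 min_r ?max_l ?ler01 //; lra.
rewrite in_itv /= => /Ap Apt; have [w wt] := carrier_pick Apt.
rewrite /g (kappa_mass _ Apt wt).
by move/eqP; rewrite (negPf (half_neq _)).
Qed.

End PathComponents.

(** * The bijection *)

(** Both sets of classes are in bijection with the common image. *)
Lemma fibre_bij (A B I : Type) (PA : set A) (PB : set B) (ka : A -> I) (kb : B -> I) :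
  ka @` PA = kb @` PB ->
  exists F : set A -> set B, set_bij
    [set C | exists2 x, PA x & C = [set y | PA y /\ ka y = ka x]]
    [set C | exists2 x, PB x & C = [set y | PB y /\ kb y = kb x]] F.
Proof.
move=> im.
pose F (C : set A) : set B := [set y | PB y /\ exists2 x, C x & kb y = ka x].
have FE x y : PA x -> PB y -> ka x = kb y ->
    F [set z | PA z /\ ka z = ka x] = [set z | PB z /\ kb z = kb y].
  move=> Px Py e; apply/seteqP; split => z /=.
    by move=> [Pz [x' [_ ex'] ez]]; split => //; rewrite ez ex'.
  by move=> [Pz ez]; split => //; exists x => //; rewrite ez e.
exists F; split.
- move=> C /= [x Px ->]; have : (kb @` PB) (ka x) by rewrite -im; exists x.
  by move=> [y Py e]; exists y => //; apply: FE.
- move=> C C' /set_mem[x Px ->] /set_mem[x' Px' ->] e.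
  have : (kb @` PB) (ka x) by rewrite -im; exists x.
  move=> [y Py ey]; have : (kb @` PB) (ka x') by rewrite -im; exists x'.
  move=> [y' Py' ey'].
  rewrite (FE x y) // (FE x' y') // in e.
  have : [set z | PB z /\ kb z = kb y'] y by rewrite -e.
  by move=> [_]; rewrite ey ey' => ->.
- move=> C /= [y Py ->]; have : (ka @` PA) (kb y) by rewrite im; exists y.
  move=> [x Px e]; exists [set z | PA z /\ ka z = ka x]; first by exists x.
  exact: FE.
Qed.

Section ComplexPlus.
Variables (R : realType) (T : finType) (X : {set {set T}}).
Hypothesis hX : simplicial_complex X.
Variables (n : nat) (e : T -> 'I_n.+1).
Hypothesis he : injective e.
Local Notation Y := (complex_image e X).
Local Notation Z := (complex_plus X).
Local Notation rt := (fingraph.root (adj Y)).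

Lemma complex_image_simplicial (U : finType) (f : T -> U) :
  simplicial_complex (complex_image f X).
Proof.
split.
  apply/imsetP => -[s sX /eqP]; rewrite eq_sym imset_eq0 => /eqP s0.
  by have := hX.1; rewrite -s0 sX.
move=> s t /imsetP[s' sX ->] ts t0; apply/imsetP.
exists (f @^-1: t :&: s')%SET; last first.
  apply/setP => y; apply/idP/imsetP => [yt|[x]].
    have /imsetP[x xs yx] := fintype.subsetP ts _ yt.
    by exists x => //; rewrite !inE -yx yt.
  by rewrite !inE => /andP[xt _] ->.
apply: (hX.2 s') => //; first exact: finset.subsetIr.
have /set0Pn[y yt] := t0; have /imsetP[x xs yx] := fintype.subsetP ts _ yt.
by apply/set0Pn; exists x; rewrite !inE -yx yt.
Qed.

Lemma complex_plus_simplicial : simplicial_complex Z.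
Proof.
have [h1 h2] := complex_image_simplicial (@Some T).
split.
  rewrite inE (negPf h1) /= inE; apply/eqP => h.
  by have : None \in (finset.set0 : {set option T}); [rewrite h inE|rewrite inE].
move=> s t; rewrite !inE => /orP[sX|/eqP->] ts t0.
  by rewrite (h2 s).
by move: ts; rewrite finset.subset1 (negPf t0) orbF => ->; rewrite orbT.
Qed.

Let hY := complex_image_simplicial e.
Let hZ := complex_plus_simplicial.

(** The isolated point gets the label None, which is also the label of the
    Maurer-Cartan element 0. *)
Definition component (u : option T) : option 'I_n.+1 :=
  if u is Some v then Some (rt (e v)) else None.

Lemma mem_complex_image (s : {set T}) : (e @: s \in Y) = (s \in X).
Proof.
apply/imsetP/idP => [[s' sX /(imset_inj he)-> //]|sX]; by exists s.
Qed.

Lemma Some_inj : injective (@Some T). Proof. by move=> x y []. Qed.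

Lemma mem_plus (s : {set T}) : s \in X -> (@Some T) @: s \in Z.
Proof. by move=> sX; rewrite inE; apply/orP; left; apply/imsetP; exists s. Qed.

Lemma vertex_plus (v : T) : ([set Some v]%SET \in Z) = ([set e v]%SET \in Y).
Proof.
rewrite -(imset_set1 e v) mem_complex_image inE -(imset_set1 (@Some T) v).
have -> : ((@Some T) @: [set v]%SET \in complex_image Some X) = ([set v]%SET \in X).
  by apply/imsetP/idP => [[s sX /(imset_inj Some_inj)-> //]|sX]; exists [set v]%SET.
suff -> : ((@Some T) @: [set v]%SET \in [set [set None]]%SET) = false by rewrite orbF.
by rewrite inE imset_set1 (inj_eq set1_inj).
Qed.

Lemma component_simplex (s : {set option T}) u v :
  s \in Z -> u \in s -> v \in s -> component u = component v.
Proof.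
rewrite inE => /orP[/imsetP[t tX ->]|]; last by rewrite inE => /eqP->; rewrite !inE => /eqP-> /eqP->.
move=> /imsetP[x xt ->] /imsetP[y yt ->] /=; congr Some.
by apply: (root_mem hY (s := e @: t)); rewrite ?mem_complex_image ?imset_f.
Qed.

Lemma component_connect u v : [set u]%SET \in Z -> [set v]%SET \in Z ->
  component u = component v -> connect (adj Z) u v.
Proof.
case: u v => [u|] [v|] //= _ _ [] /eqP; rewrite root_connect; last exact: adj_connect_sym.
move=> /connectP[p]; elim: p u => [|w p IH] u /=; first by move=> _ /he ->.
move=> /andP[uw pw] lst.
have /imsetP[t tX et] := uw.
have : w \in e @: t by rewrite -et !inE eqxx orbT.
move=> /imsetP[x xt ex]; rewrite ex in uw pw lst.
apply: connect_trans (IH x pw lst); apply: connect1.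
have := mem_plus (s := [set u; x]%SET); rewrite imsetU1 imset_set1; apply.
by rewrite -mem_complex_image imsetU1 imset_set1.
Qed.

Definition point_component (x : {ptws option T -> R}) : option 'I_n.+1 :=
  if [pick u in carrier x] is Some u then component u else None.

Lemma point_componentE x u : realization R Z x -> u \in carrier x ->
  point_component x = component u.
Proof.
move=> Ax ux; rewrite /point_component; case: pickP => [v vx|/(_ u)]; last by rewrite ux.
exact: component_simplex (carrier_in Ax) vx ux.
Qed.

Lemma pi0E : pi0 R Z = [set C | exists2 x, realization R Z x &
  C = [set y | realization R Z y /\ point_component y = point_component x]].
Proof.
have E x : realization R Z x -> [set y | path_joined R (realization R Z) x y] =
    [set y | realization R Z y /\ point_component y = point_component x].
  move=> Ax; have [u ux] := carrier_pick hZ Ax.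
  have H y : realization R Z y ->
      path_joined R (realization R Z) x y <-> point_component y = point_component x.
    move=> Ay; have [v vy] := carrier_pick hZ Ay.
    rewrite (path_joinedE hZ component_simplex component_connect Ax Ay ux vy).
    by rewrite (point_componentE Ax ux) (point_componentE Ay vy); split.
  apply/seteqP; split => y /=.
    move=> j; have Ay : realization R Z y.
      by case: j => p [_ Ap _ <-]; apply: Ap; rewrite ler01 lexx.
    by split => //; apply/(H y Ay).
  by move=> [Ay /(H y Ay)].
by apply/seteqP; split => C [x Ax ->]; exists x => //; rewrite E.
Qed.

Variable d : forall n : nat, series {set 'I_n.+1} -> series {set 'I_n.+1}.
Arguments d : clear implicits.
Hypothesis hd : simplex_models d.

Lemma MC_tildeE : MC_tilde (complex_model d Y) =
  [set C | exists2 z, MC (complex_model d Y) z &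
     C = [set y | MC (complex_model d Y) y /\ label Y y = label Y z]].
Proof.
apply/seteqP; split => C [z mz ->]; exists z => //;
  rewrite (gauge_orbitE hd hY (proj1 (MC_mc hd hY z) mz));
  by apply/seteqP; split => y /= [my ey]; split => //; apply/(MC_mc hd hY).
Qed.

(** The vertices of X and the isolated point give all path components; as
    Maurer-Cartan elements, the vertices of the complex and 0 have the same
    labels, and labelP leaves no others. *)
Lemma component_label :
  point_component @` realization R Z = label Y @` MC (complex_model d Y).
Proof.
apply/seteqP; split => i [].
  move=> x Ax <-; have [[v|] vx] := carrier_pick hZ Ax;
    rewrite (point_componentE Ax vx).
    have vY : [set e v]%SET \in Y by rewrite -vertex_plus (vertex_mem hZ (carrier_in Ax) vx).
    exists (gen [set e v]%SET); last exact: (label_pt hd hY vY).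
    by apply/(MC_mc hd hY); apply: mc_pt.
  exists 0; last exact: label_zero.
  by apply/(MC_mc hd hY); apply: mc_zero.
move=> z /(MC_mc hd hY) mz <-.
case: (labelP hd hY mz) => [[-> _]|[a [aY -> _]]].
  have NZ : [set None]%SET \in Z by rewrite !inE eqxx orbT.
  exists (vertex R None); first exact: vertex_in.
  by rewrite (@point_componentE _ None) ?carrier_vertex ?inE //; apply: vertex_in.
have [v av] : exists v, a = e v.
  have /imsetP[s sX es] := aY; have : a \in e @: s by rewrite -es set11.
  by move=> /imsetP[v _ ->]; exists v.
rewrite av in aY *; rewrite -vertex_plus in aY.
exists (vertex R (Some v)); first exact: vertex_in.
by rewrite (@point_componentE _ (Some v)) ?carrier_vertex ?inE //; apply: vertex_in.
Qed.

End ComplexPlus.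

Theorem theorem1 (R : realType)
    (d : forall n : nat, series {set 'I_n.+1} -> series {set 'I_n.+1})
    (hd : simplex_models d)
    (T : finType) (X : {set {set T}}) (hX : simplicial_complex X)
    (n : nat) (e : T -> 'I_n.+1) (he : injective e) :
  exists F : set {ptws option T -> R} -> set (series {set 'I_n.+1}),
    set_bij (pi0 R (complex_plus X))
            (MC_tilde (complex_model d (complex_image e X))) F.
Proof.
rewrite (pi0E R hX he) (MC_tildeE hX e hd).
exact/fibre_bij/component_label.
Qed.
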